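(* Assume Condition C (i)–(iv) and $\sqrt{k_n}\beta_{\varepsilon_2}(b_n)\to0$ for some $\varepsilon_2>0$, and let $\Sigma_m^{\mathrm{db}},\Sigma_m^{\mathrm{sb}}$ be the asymptotic covariance matrices of $(s^{\mathrm{db}}_{n,j})_{1\le j\le m}$ and $(s^{\mathrm{sb}}_{n,j})_{1\le j\le m}$, and $\Gamma_m^{\mathrm{mb}}=A_m\Sigma_m^{\mathrm{mb}}A_m^\top$ those of $(v^{\mathrm{mb}}_{n,j})_{1\le j\le m}$. Then for every $m\in\mathbb N_{\ge1}$, $$\Sigma_m^{\mathrm{sb}}\le_L\Sigma_m^{\mathrm{db}}\quad\text{and}\quad\Gamma_m^{\mathrm{sb}}\le_L\Gamma_m^{\mathrm{db}},$$ where $\le_L$ is the Loewner order on symmetric matrices. In particular, for every $j\in\mathbb N_{\ge1}$ the asymptotic variance of $s^{\mathrm{sb}}_{n,j}$ (resp. $v^{\mathrm{sb}}_{n,j}$) does not exceed that of $s^{\mathrm{db}}_{n,j}$ (resp. $v^{\mathrm{db}}_{n,j}$).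
   Context: Setup. $(X_t)_{t\in\mathbb Z}$ is a strictly stationary real-valued time series whose marginal c.d.f. $F$ is continuous; $U_s=F(X_s)$; $F^{\leftarrow}(p)=\inf\{x:F(x)\ge p\}$. For $\varepsilon\in(0,1]$ and $-\infty\le p<q\le\infty$, $\mathcal B^{\varepsilon}_{p:q}$ is the $\sigma$-field generated by $\{U_s\mathbf 1(U_s>1-\varepsilon):p\le s\le q\}$, and for $\ell\ge1$, $\alpha_\varepsilon(\ell)=\sup_{k\in\mathbb N}\alpha(\mathcal B^\varepsilon_{1:k},\mathcal B^\varepsilon_{k+\ell:\infty})$, $\beta_\varepsilon(\ell)=\sup_{k\in\mathbb N}\beta(\mathcal B^\varepsilon_{1:k},\mathcal B^\varepsilon_{k+\ell:\infty})$, where $\alpha(\mathcal F_1,\mathcal F_2)=\sup_{A\in\mathcal F_1,B\in\mathcal F_2}|P(A\cap B)-P(A)P(B)|$ and $\beta(\mathcal F_1,\mathcal F_2)=\frac12\sup\sum_i\sum_j|P(A_i\cap B_j)-P(A_i)P(B_j)|$, the supremum over finite partitions $(A_i)\subset\mathcal F_1$, $(B_j)\subset\mathcal F_2$ of the sample space. Limit objects. $\theta\in(0,1]$ is the extremal index: for every $\tau>0$, with $u_n(\tau)=F^{\leftarrow}(1-\tau/n)$, $P(\max_{1\le t\le n}X_t\le u_n(\tau))\to e^{-\theta\tau}$. For $\tau\ge0$ and Borel $B\subset E=(0,1]$, $N_n^{(\tau)}(B)=\sum_{t=1}^n\mathbf 1(t/n\in B,\,X_t>u_n(\tau))$; for $\tau_1\ge\tau_2\ge0$,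 $\tau_1>0$, the two-level point process is $\mathbf N_n^{(\tau_1,\tau_2)}=(N_n^{(\tau_1)},N_n^{(\tau_2)})$. Let $\mathcal J=\{(i,j)\in\mathbb N_{\ge0}^2:i\ge j\ge0,\,i\ge1\}$. $\{\pi_2^{(\sigma)}:\sigma\in[0,1]\}$ is a family of probability measures on $\mathcal J$ whose first marginal $\pi$ (a probability measure on $\mathbb N_{\ge1}$, the limiting cluster size distribution) does not depend on $\sigma$, and $\mathbf N^{(\tau_1,\tau_2)}$ denotes a point process on $E$ whose total mass $\mathbf N^{(\tau_1,\tau_2)}(E)$ is distributed as $\sum_{i=1}^{\eta}(\xi_{i,1},\xi_{i,2})$ with $\eta\sim\mathrm{Poisson}(\theta\tau_1)$ independent of i.i.d. $(\xi_{i,1},\xi_{i,2})\sim\pi_2^{(\tau_2/\tau_1)}$. For $\tau\ge0$, $p^{(\tau)}$ is the compound Poisson law with intensity $\theta\tau$ and compounding law $\pi$: $p^{(\tau)}(0)=e^{-\theta\tau}$, $p^{(\tau)}(m)=\sum_{j=1}^m e^{-\theta\tau}(\theta\tau)^j\pi^{*j}(m)/j!$ for $m\ge1$. $H(x)=(1-e^{-\theta x})\mathbf 1(x\ge0)$ and $\bar p(m)=\int_0^\infty p^{(\tau)}(m)\,dH(\tau)$. Blocks and estimators. $(b_n)$ is an integer sequence with $b_n\to\infty$, $b_n=o(n)$, $k_n=\lfloor n/b_n\rfloor$. Disjoint blocks: $I_i^{\mathrm{db}}=\{(i-1)b_n+1,\dots,ib_n\}$, $1\le i\le k_n$; sliding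 blocks: $I_i^{\mathrm{sb}}=\{i,\dots,i+b_n-1\}$, $1\le i\le n-b_n+1$; $M_{ni}^{\mathrm{mb}}=\max_{t\in I_i^{\mathrm{mb}}}X_t$, $Z_{ni}^{\mathrm{mb}}=b_n\{1-F(M_{ni}^{\mathrm{mb}})\}$; $\varphi_{n,m}(\tau)=P(\sum_{s=1}^{b_n}\mathbf 1(U_s>1-\tau/b_n)=m)$. $\hat{\bar p}_n^{\mathrm{db}}(m)=\frac{1}{k_n(k_n-1)}\sum_{i\ne i'}\mathbf 1\{\sum_{s\in I_{i'}^{\mathrm{db}}}\mathbf 1(X_s>M_{ni}^{\mathrm{db}})=m\}$; $\hat{\bar p}_n^{\mathrm{sb}}(m)=\frac{1}{|D_n|}\sum_{(i,i')\in D_n}\mathbf 1\{\sum_{s\in I_{i'}^{\mathrm{sb}}}\mathbf 1(X_s>M_{ni}^{\mathrm{sb}})=m\}$ with $D_n$ the set of pairs $(i,i')$ with disjoint sliding blocks. $\hat\pi_n^{\mathrm{mb}}(m)=4\hat{\bar p}_n^{\mathrm{mb}}(m)-2\sum_{k=1}^{m-1}\hat\pi_n^{\mathrm{mb}}(m-k)\hat{\bar p}_n^{\mathrm{mb}}(k)$. $s^{\mathrm{mb}}_{n,j}=\sqrt{k_n}\{\hat{\bar p}_n^{\mathrm{mb}}(j)-\bar p(j)\}$, $v^{\mathrm{mb}}_{n,j}=\sqrt{k_n}\{\hat\pi_n^{\mathrm{mb}}(j)-\pi(j)\}$. Under the hypotheses, $(s^{\mathrm{mb}}_{n,j})_{j\le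 m}\to\mathcal N_m(0,\Sigma_m^{\mathrm{mb}})$ for both $\mathrm{mb}$; $A_m$ is the matrix expressing $v_j=4s_j-2\sum_{k<j}\pi(j-k)s_k-2\sum_{k<j}\bar p(j-k)v_k$ (with $v_1=4s_1$) as $v=A_ms$. Condition C. (i) The series has an extremal index $\theta\in(0,1]$ and, for all $\tau_1\ge\tau_2\ge0$ with $\tau_1>0$, $\mathbf N_n^{(\tau_1,\tau_2)}$ converges in distribution to $\mathbf N^{(\tau_1,\tau_2)}$. (ii) There are $\varepsilon_1\in(0,1)$, $\eta>2$, $C>0$ with $\alpha_{\varepsilon_1}(n)\le Cn^{-\eta}$ for all $n$; $b_n\to\infty$ and $k_n=o(b_n^\eta)$; and there is $\ell_n\to\infty$ with $\ell_n=o(b_n)$ and $k_n\alpha_{\varepsilon_1}(\ell_n)\to0$. (iii) For some $c>1-\varepsilon_1$, $P(\min_{1\le i\le 2k_n}N'_{ni}\le c)\to0$, where $N'_{ni}=\max\{U_s:(i-1)b_n/2+1\le s\le ib_n/2\}$. (iv) For every $j\in\mathbb N_{\ge1}$, $E[\varphi_{n,j}(Z_{n1}^{\mathrm{db}})]=\bar p(j)+o(k_n^{-1/2})$. *)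

(* Defs.v *)
From HB Require Import structures.
From mathcomp Require Import all_boot all_order all_algebra.
From mathcomp Require Import all_classical all_reals all_analysis.
Set Implicit Arguments.
Unset Strict Implicit.
Unset Printing Implicit Defensive.
Import Order.TTheory GRing.Theory Num.Theory Num.Def.
Import numFieldNormedType.Exports.
Local Open Scope classical_set_scope.
Local Open Scope ring_scope.

Definition Pr {R : realType} {d} {Omega : measurableType d}
  (P : probability Omega R) (A : set Omega) : R := fine (P A).

Definition Ex {R : realType} {d} {Omega : measurableType d}
  (P : probability Omega R) (f : Omega -> R) : R :=
  fine (\int[P]_w (f w)%:E)%E.

(* strict stationarity: all finite-dimensional distributions are shift
   invariant (stated on measurable rectangles, which generate the
   product sigma-algebra of R^k). *)
Definition strictly_stationary {R : realType} {d} {Omega : measurableType d}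
  (P : probability Omega R) (X : int -> Omega -> R) : Prop :=
  forall (h : int) (k : nat) (t : nat -> int) (B : nat -> set R),
    (forall i, measurable (B i)) ->
    P [set w | forall i, (i < k)%N -> B i (X (t i + h) w)] =
    P [set w | forall i, (i < k)%N -> B i (X (t i) w)].

(* marginal c.d.f. F and its generalized inverse F^{<-}(p) = inf{x : F(x) >= p},
   valued in the extended reals (inf of the empty set = +oo) *)
Definition Fcdf {R : realType} {d} {Omega : measurableType d}
  (P : probability Omega R) (X : int -> Omega -> R) (x : R) : R :=
  Pr P [set w | X 0 w <= x].

Definition qinv {R : realType} {d} {Omega : measurableType d}
  (P : probability Omega R) (X : int -> Omega -> R) (p : R) : \bar R :=
  ereal_inf [set x%:E | x in [set x : R | p <= Fcdf P X x]].

Definition Uv {R : realType} {d} {Omega : measurableType d}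
  (P : probability Omega R) (X : int -> Omega -> R) (s : int) (w : Omega) : R :=
  Fcdf P X (X s w).

Definition Ytr {R : realType} {d} {Omega : measurableType d}
  (P : probability Omega R) (X : int -> Omega -> R) (eps : R) (s : int)
  (w : Omega) : R :=
  Uv P X s w * (if 1 - eps < Uv P X s w then 1 else 0).

Definition sigB {R : realType} {d} {Omega : measurableType d}
  (P : probability Omega R) (X : int -> Omega -> R) (eps : R) (I : set int)
  : set (set Omega) :=
  <<s [set A | exists s B, I s /\ measurable B /\ A = Ytr P X eps s @^-1` B] >>.

Definition alpha_c {R : realType} {d} {Omega : measurableType d}
  (P : probability Omega R) (F1 F2 : set (set Omega)) : R :=
  sup [set `|Pr P (A `&` B) - Pr P A * Pr P B| | A in F1 & B in F2].

Definition fpartition {d} {Omega : measurableType d}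
  (F : set (set Omega)) (As : seq (set Omega)) : Prop :=
  [/\ forall i, (i < size As)%N -> F (nth set0 As i),
      forall i j, (i < j)%N -> (j < size As)%N ->
        nth set0 As i `&` nth set0 As j = set0
    & forall w, exists2 i, (i < size As)%N & nth set0 As i w].

Definition beta_c {R : realType} {d} {Omega : measurableType d}
  (P : probability Omega R) (F1 F2 : set (set Omega)) : R :=
  2^-1 * sup [set \sum_(A <- As) \sum_(B <- Bs)
                    `|Pr P (A `&` B) - Pr P A * Pr P B|
             | As in fpartition F1 & Bs in fpartition F2].

Definition alpha_eps {R : realType} {d} {Omega : measurableType d}
  (P : probability Omega R) (X : int -> Omega -> R) (eps : R) (l : nat) : R :=
  sup [set alpha_c P (sigB P X eps [set s : int | 1 <= s <= k%:Z])
                     (sigB P X eps [set s : int | (k + l)%:Z <= s])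
      | k in [set k : nat | (1 <= k)%N]].

Definition beta_eps {R : realType} {d} {Omega : measurableType d}
  (P : probability Omega R) (X : int -> Omega -> R) (eps : R) (l : nat) : R :=
  sup [set beta_c P (sigB P X eps [set s : int | 1 <= s <= k%:Z])
                    (sigB P X eps [set s : int | (k + l)%:Z <= s])
      | k in [set k : nat | (1 <= k)%N]].

Definition uthr {R : realType} {d} {Omega : measurableType d}
  (P : probability Omega R) (X : int -> Omega -> R) (n : nat) (tau : R) : \bar R :=
  qinv P X (1 - tau / n%:R).

Definition has_extremal_index {R : realType} {d} {Omega : measurableType d}
  (P : probability Omega R) (X : int -> Omega -> R) (theta : R) : Prop :=
  0 < theta <= 1 /\
  forall tau : R, 0 < tau ->
    Pr P [set w | forall t : nat, (1 <= t <= n)%N -> ((X t%:Z w)%:E <= uthr P X n tau)%E]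
      @[n --> \oo] --> expR (- (theta * tau)).

(* A (finite) point measure on E = (0,1] is represented by the finite
   list of its atoms (with multiplicity); N(B) = number of atoms in B. *)
Definition pm_count {R : realType} (mu : seq R) (B : set R) : nat :=
  count (fun x => `[< B x >]) mu.

Definition point_config {R : realType} (mu : seq R * seq R) : Prop :=
  (forall x, x \in mu.1 -> 0 < x <= 1) /\ (forall x, x \in mu.2 -> 0 < x <= 1).

Definition Nn {R : realType} {d} {Omega : measurableType d}
  (P : probability Omega R) (X : int -> Omega -> R) (n : nat) (tau : R)
  (w : Omega) : seq R :=
  [seq t%:R / n%:R | t <- iota 1 n & (uthr P X n tau < (X t%:Z w)%:E)%E].

Definition Nn2 {R : realType} {d} {Omega : measurableType d}
  (P : probability Omega R) (X : int -> Omega -> R) (n : nat) (tau1 tau2 : R)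
  (w : Omega) : seq R * seq R :=
  (Nn P X n tau1 w, Nn P X n tau2 w).

Definition pm_int {R : realType} (f : R -> R) (mu : seq R) : R :=
  \sum_(x <- mu) f x.

Definition testfun {R : realType} (f : R -> R) : Prop :=
  {within [set x : R | 0 < x <= 1], continuous f} /\
  exists M : R, forall x, 0 < x <= 1 -> 0 <= f x <= M.

(* continuity of G w.r.t. the (product of the) weak topologies on pairs of
   finite point measures on E, i.e. the initial topology generated by the
   maps mu |-> \int f dmu, f bounded continuous nonnegative on E. *)
Definition weak_continuous {R : realType} (G : seq R * seq R -> R) : Prop :=
  forall mu, point_config mu -> forall e : R, 0 < e ->
    exists (k : nat) (f g : nat -> R -> R) (delta : R),
      [/\ 0 < delta, forall i, testfun (f i) /\ testfun (g i) &
        forall nu, point_config nu ->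
          (forall i, (i < k)%N ->
             `|pm_int (f i) nu.1 - pm_int (f i) mu.1| < delta /\
             `|pm_int (g i) nu.2 - pm_int (g i) mu.2| < delta) ->
          `|G nu - G mu| < e].

Fixpoint conv2 {R : realType} (q : nat -> nat -> R) (e : nat) (a b : nat) : R :=
  match e with
  | 0 => ((a == 0%N) && (b == 0%N))%:R
  | e'.+1 => \sum_(i < a.+1) \sum_(j < b.+1) q i j * conv2 q e' (a - i) (b - j)
  end.

(* law of sum_{i=1}^etaC (xi_{i1}, xi_{i2}), etaC ~ Poisson(lam) independent of
   i.i.d. xi ~ q; since q charges only pairs with first coordinate >= 1, only
   etaC <= a contributes to the mass at (a,b). *)
Definition cpois2 {R : realType} (lam : R) (q : nat -> nat -> R) (a b : nat) : R :=
  \sum_(e < a.+1) expR (- lam) * lam ^+ e / (e`!)%:R * conv2 q e a b.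

Definition pp_converges {R : realType} {d} {Omega : measurableType d}
  (P : probability Omega R) (X : int -> Omega -> R) (theta : R)
  (pi2 : R -> nat -> nat -> R) (tau1 tau2 : R) : Prop :=
  exists (d' : measure_display) (T : measurableType d') (Q : probability T R)
         (N : T -> seq R * seq R),
    [/\ forall w, point_config (N w),
        forall a b : nat,
          measurable [set w | size (N w).1 = a /\ size (N w).2 = b] /\
          Pr Q [set w | size (N w).1 = a /\ size (N w).2 = b] =
            cpois2 (theta * tau1) (pi2 (tau2 / tau1)) a b
      & forall G : seq R * seq R -> R,
          (exists M : R, forall mu, `|G mu| <= M) -> weak_continuous G ->
          measurable_fun setT (G \o N) /\
          Ex P (fun w => G (Nn2 P X n tau1 tau2 w)) @[n --> \oo] -->
            Ex Q (G \o N)].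

Definition cluster_family {R : realType} (pi : nat -> R)
  (pi2 : R -> nat -> nat -> R) : Prop :=
  forall s : R, 0 <= s <= 1 ->
    [/\ forall i j, 0 <= pi2 s i j,
        forall i j, pi2 s i j != 0 -> (1 <= i)%N /\ (j <= i)%N,
        (\sum_(i < N) \sum_(j < i.+1) pi2 s i j) @[N --> \oo] --> (1 : R)
      & forall i, pi i = \sum_(j < i.+1) pi2 s i j].

Fixpoint convp {R : realType} (pi : nat -> R) (j : nat) (m : nat) : R :=
  match j with
  | 0 => (m == 0%N)%:R
  | j'.+1 => \sum_(k < m.+1) pi k * convp pi j' (m - k)
  end.

Definition cpois {R : realType} (theta : R) (pi : nat -> R) (tau : R) (m : nat) : R :=
  if m == 0%N then expR (- (theta * tau))
  else \sum_(1 <= j < m.+1)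
         expR (- (theta * tau)) * (theta * tau) ^+ j * convp pi j m / (j`!)%:R.

Definition pbar {R : realType} (theta : R) (pi : nat -> R) (m : nat) : R :=
  fine (\int[@lebesgue_measure R]_(t in [set t : R | (0 <= t)%R])
          (cpois theta pi t m * (theta * expR (- (theta * t))))%R%:E)%E.

Definition bmax {R : realType} {Omega : Type} (X : int -> Omega -> R)
  (a : int) (len : nat) (w : Omega) : R :=
  \big[Num.max/X a w]_(u < len) X (a + u%:Z) w.

Definition bcnt {R : realType} {Omega : Type} (X : int -> Omega -> R)
  (a : int) (len : nat) (x : R) (w : Omega) : nat :=
  \sum_(u < len) nat_of_bool (x < X (a + u%:Z) w)%R.

Definition kn (b : nat -> nat) (n : nat) : nat := (n %/ b n)%N.

(* disjoint blocks estimator: block i (0-based) starts at i*b_n + 1 *)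
Definition phat_db {R : realType} {Omega : Type} (X : int -> Omega -> R)
  (b : nat -> nat) (n m : nat) (w : Omega) : R :=
  ((kn b n * (kn b n).-1)%:R)^-1 *
  \sum_(i < kn b n) \sum_(i' < kn b n | i' != i)
    (bcnt X (i' * b n).+1%:Z (b n) (bmax X (i * b n).+1%:Z (b n) w) w == m)%:R.

(* sliding blocks estimator: block i (0-based) starts at i+1,
   i < n - b_n + 1; D_n = pairs of disjoint sliding blocks *)
Definition sb_disj (b : nat -> nat) (n i i' : nat) : bool :=
  (i + b n <= i')%N || (i' + b n <= i)%N.

Definition phat_sb {R : realType} {Omega : Type} (X : int -> Omega -> R)
  (b : nat -> nat) (n m : nat) (w : Omega) : R :=
  ((\sum_(i < (n - b n).+1) \sum_(i' < (n - b n).+1 | sb_disj b n i i') 1)%N%:R)^-1 *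
  \sum_(i < (n - b n).+1) \sum_(i' < (n - b n).+1 | sb_disj b n i i')
    (bcnt X i'.+1%:Z (b n) (bmax X i.+1%:Z (b n) w) w == m)%:R.

(* the vectors (s_{n,j})_{1<=j<=m}; entry j (0-based) is s_{n,j+1} *)
Definition s_db {R : realType} {Omega : Type} (X : int -> Omega -> R)
  (b : nat -> nat) (theta : R) (pi : nat -> R) (m n : nat) (w : Omega) : 'cV[R]_m :=
  \col_(j < m) (Num.sqrt (kn b n)%:R * (phat_db X b n j.+1 w - pbar theta pi j.+1)).

Definition s_sb {R : realType} {Omega : Type} (X : int -> Omega -> R)
  (b : nat -> nat) (theta : R) (pi : nat -> R) (m n : nat) (w : Omega) : 'cV[R]_m :=
  \col_(j < m) (Num.sqrt (kn b n)%:R * (phat_sb X b n j.+1 w - pbar theta pi j.+1)).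

Definition phi_nm {R : realType} {d} {Omega : measurableType d}
  (P : probability Omega R) (X : int -> Omega -> R) (b : nat -> nat)
  (n m : nat) (tau : R) : R :=
  Pr P [set w | (\sum_(s < b n) nat_of_bool (1 - tau / (b n)%:R < Uv P X s.+1%:Z w)%R)%N = m].

Definition Z1db {R : realType} {d} {Omega : measurableType d}
  (P : probability Omega R) (X : int -> Omega -> R) (b : nat -> nat)
  (n : nat) (w : Omega) : R :=
  (b n)%:R * (1 - Fcdf P X (bmax X 1 (b n) w)).

Definition conditionC {R : realType} {d} {Omega : measurableType d}
  (P : probability Omega R) (X : int -> Omega -> R) (theta : R)
  (pi : nat -> R) (pi2 : R -> nat -> nat -> R) (b : nat -> nat) : Prop :=
  [/\ has_extremal_index P X theta /\
      (forall tau1 tau2 : R, 0 <= tau2 <= tau1 -> 0 < tau1 ->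
         pp_converges P X theta pi2 tau1 tau2),
      exists (eps1 etaC C : R),
        [/\ [/\ 0 < eps1 < 1, 2 < etaC & 0 < C],
            forall l : nat, (1 <= l)%N -> alpha_eps P X eps1 l <= C * powR l%:R (- etaC),
            (((b n)%:R : R) @[n --> \oo] --> +oo%R) /\
            ((kn b n)%:R / powR (b n)%:R etaC @[n --> \oo] --> (0:R)),
            (exists ell : nat -> nat,
              [/\ ((ell n)%:R : R) @[n --> \oo] --> +oo%R,
                  ((ell n)%:R / (b n)%:R : R) @[n --> \oo] --> (0:R) &
                  (kn b n)%:R * alpha_eps P X eps1 (ell n) @[n --> \oo] --> (0:R)])
          &
            exists c : R, 1 - eps1 < c /\
              Pr P [set w | exists i : nat, (1 <= i <= 2 * kn b n)%N /\
                     forall s : int,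
                       (((i.-1 * b n)%:R / 2 + 1 : R) <= (s%:~R : R) <= ((i * b n)%:R / 2 : R)) ->
                       Uv P X s w <= c] @[n --> \oo] --> (0:R)]
  &
    forall j : nat, (1 <= j)%N ->
      Num.sqrt (kn b n)%:R *
        (Ex P (fun w => phi_nm P X b n j (Z1db P X b n w)) - pbar theta pi j)
        @[n --> \oo] --> (0:R)].

(* c.d.f. of N(0, v) (v >= 0; for v = 0 the Dirac mass at 0) *)
Definition normal_cdf {R : realType} (v x : R) : R :=
  if 0 < v then fine (normal_prob 0 (Num.sqrt v) [set y : R | y <= x])
  else if 0 <= x then 1 else 0.

(* Y_n converges in distribution to N(0, v): convergence of c.d.f.s at all
   continuity points of the limit c.d.f. *)
Definition cvg_law_normal {R : realType} {d} {Omega : measurableType d}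
  (P : probability Omega R) (Y : nat -> Omega -> R) (v : R) : Prop :=
  forall x : R, 0 < v \/ x != 0 ->
    Pr P [set w | Y n w <= x] @[n --> \oo] --> normal_cdf v x.

(* S_n converges in distribution to N_m(0, Sig) (via Cramer-Wold: every
   linear combination c^T S_n converges to N(0, c^T Sig c)) *)
Definition cvg_law_mnormal {R : realType} {d} {Omega : measurableType d}
  (P : probability Omega R) (m : nat) (S : nat -> Omega -> 'cV[R]_m)
  (Sig : 'M[R]_m) : Prop :=
  forall c : 'cV[R]_m,
    cvg_law_normal P (fun n w => (c^T *m S n w) 0 0) ((c^T *m Sig *m c) 0 0).

Definition cov_matrix {R : realType} (m : nat) (S : 'M[R]_m) : Prop :=
  S^T = S /\ forall x : 'cV[R]_m, 0 <= (x^T *m S *m x) 0 0.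

Definition loewner_le {R : realType} (m : nat) (S1 S2 : 'M[R]_m) : Prop :=
  forall x : 'cV[R]_m, 0 <= (x^T *m (S2 - S1) *m x) 0 0.

(* A_m: the matrix with v = A_m s, where v_j = 4 s_j - 2 sum_{k<j} pi(j-k) s_k
   - 2 sum_{k<j} pbar(j-k) v_k (indices 0-based here; differences unchanged) *)
Definition is_Am {R : realType} (theta : R) (pi : nat -> R) (m : nat)
  (A : 'M[R]_m) : Prop :=
  forall (s : 'cV[R]_m) (j : 'I_m),
    (A *m s) j 0 =
      4 * s j 0
      - 2 * (\sum_(k < m | (k < j)%N) pi (j - k)%N * s k 0)
      - 2 * (\sum_(k < m | (k < j)%N) pbar theta pi (j - k)%N * (A *m s) k 0).

(* Main.v *)
(* Truncating the uniformized series at level 1 - eps1 changes the estimators only on an event of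
   vanishing probability (condition C (iii)) and makes them functions of an alpha-mixing sequence.
   The number of exceedances of the maximum M_i of block i in block i' is at least j iff M_i is smaller
   than the j-th largest value W_i' of block i', so the estimators are combinations of U-statistics
   with kernel 1(x < y) in (M_i, W_i').  Even after multiplication by sqrt k_n their Hoeffding
   degenerate part vanishes in L^1: cut the line into about sqrt k cells of small probability and bound the
   variance of the empirical frequency of each cell by mixing, using k_n alpha(b_n) -> 0.  What is left
   is, for both block schemes, the centered average of the same bounded function of a block plus the
   same deterministic shift.  The average over sliding blocks is an average over b_n shifts of averages
   over disjoint blocks, all with the same law, so E g(sliding) <= E g(disjoint) + o(1) for convex g.
   For g(x) = max(x - t, 0) both sides are integrals of tail probabilities and pass to the limit, and
   for large t the tail integrals of centered normal laws are strictly increasing in the variance. *)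
Require Import Defs.
From HB Require Import structures.
From mathcomp Require Import all_boot all_order all_algebra.
From mathcomp Require Import all_classical all_reals all_analysis.
From mathcomp Require Import measurable_realfun ring lra zify.
Set Implicit Arguments.
Unset Strict Implicit.
Unset Printing Implicit Defensive.
Import Order.TTheory GRing.Theory Num.Theory Num.Def.
Import numFieldNormedType.Exports.
Local Open Scope classical_set_scope.
Local Open Scope ring_scope.

(** * Expectations of bounded random variables *)

(** The limits are limits in law, so the variances of the estimators themselves need not converge to
    the entries of [Sdb] and [Ssb]. Convex test functions of linear growth get around this: an upper
    bound by second moments is needed for the linear part of one scheme only. A direct variance
    bound for the degenerate part would involve four blocks in any order. Cells replace the kernel
    by products of empirical frequencies, whose variances involve two blocks at a time. With [K]
    cells a fraction of order [1 / K] of the pairs stays undecided, and this must be small against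
    [1 / sqrt k], so [K] is a large multiple of [sqrt k]. The frequencies of the cells themselves
    have variances adding up to about [1 / k], because the cells are disjoint; the sets lying above
    the cells overlap, and their variances are only known to add up to about [K / k]. A weighted
    AM-GM inequality, with a large weight on the first family, balances the two. The common shift is
    never computed: tightness of the disjoint scheme bounds it from above, and that suffices to cut
    off the tails. *)

Definition bounded_measurable {R : realType} {d} {T : measurableType d} (f : T -> R) :=
  measurable_fun setT f /\ exists M : R, forall w, `|f w| <= M.

Section BoundedExpectation.
Context {R : realType} {d} {Omega : measurableType d} (P : probability Omega R).
Implicit Types (f g : Omega -> R) (A : set Omega).
Local Notation bm := bounded_measurable.

(** [Ex] is [fine] of an extended integral, hence additive on integrable functions. Boundedness on a
    probability space settles integrability, and all the operations below preserve it. *)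
Lemma bm_integrable f : bm f -> P.-integrable setT (EFin \o f).
Proof.
move=> [mf [M fM]]; apply: measurable_bounded_integrable => //.
  by have := probability_le1 P measurableT; move=> /le_lt_trans; apply; rewrite ltry.
by exists M; split; rewrite ?num_real// => x Mx w _; exact: (le_trans (fM w) (ltW Mx)).
Qed.

Lemma bm_cst (c : R) : bm (fun _ : Omega => c).
Proof. by split; [exact: measurable_cst|exists `|c|]. Qed.

Lemma bmD f g : bm f -> bm g -> bm (fun w => f w + g w).
Proof.
move=> [mf [M fM]] [mg [N gN]]; split; first exact: measurable_funD.
by exists (M + N) => w; rewrite (le_trans (ler_normD _ _))// lerD.
Qed.

Lemma bmM f g : bm f -> bm g -> bm (fun w => f w * g w).
Proof.
move=> [mf [M fM]] [mg [N gN]]; split; first exact: measurable_funM.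
by exists (M * N) => w; rewrite normrM ler_pM.
Qed.

Lemma bmZ (c : R) f : bm f -> bm (fun w => c * f w).
Proof. by move=> bf; apply: bmM => //; exact: bm_cst. Qed.

Lemma bmN f : bm f -> bm (fun w => - f w).
Proof.
move=> [mf [M fM]]; split; first exact: measurable_funN.
by exists M => w; rewrite normrN.
Qed.

Lemma bmB f g : bm f -> bm g -> bm (fun w => f w - g w).
Proof. by move=> bf bg; apply: bmD => //; exact: bmN. Qed.

Lemma bm_norm f : bm f -> bm (fun w => `|f w|).
Proof.
move=> [mf [M fM]]; split; first by apply: measurableT_comp.
by exists M => w; rewrite normr_id.
Qed.

Lemma bmX f n : bm f -> bm (fun w => f w ^+ n).
Proof.
move=> bf; elim: n => [|n IH]; first by under eq_fun do rewrite expr0; exact: bm_cst.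
by under eq_fun do rewrite exprS; exact: bmM.
Qed.

Lemma bm_max f g : bm f -> bm g -> bm (fun w => Num.max (f w) (g w)).
Proof.
move=> [mf [M fM]] [mg [N gN]]; split; first exact: measurable_maxr.
exists (Num.max M N) => w.
by case: (leP (f w) (g w)) => _; rewrite le_max ?fM ?gN ?orbT.
Qed.

Lemma bm_min f g : bm f -> bm g -> bm (fun w => Num.min (f w) (g w)).
Proof.
move=> [mf [M fM]] [mg [N gN]]; split; first exact: measurable_minr.
exists (Num.max M N) => w.
by case: (leP (f w) (g w)) => _; rewrite le_max ?fM ?gN ?orbT.
Qed.

Lemma bm_sum (I : Type) (s : seq I) (p : pred I) (h : I -> Omega -> R) :
  (forall i, bm (h i)) -> bm (fun w => \sum_(i <- s | p i) h i w).
Proof.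
move=> bh; elim: s => [|x s IH].
  by under eq_fun do rewrite big_nil; exact: bm_cst.
under eq_fun do rewrite big_cons; case: (p x) => //; exact: bmD.
Qed.

Lemma bm_indic A : measurable A -> bm (\1_A : Omega -> R).
Proof.
move=> mA; split; first exact: measurable_indic.
by exists 1 => w; rewrite indicE; case: (_ \in _); rewrite ?normr1 ?normr0.
Qed.

Lemma bm_bool (e : Omega -> bool) : measurable [set w | e w] -> bm (fun w => (e w)%:R : R).
Proof.
move=> me; rewrite (_ : (fun w => _) = \1_[set w | e w]); first exact: bm_indic.
by apply/funext => w; rewrite indicE; congr (_%:R); rewrite /in_mem /mem /= /in_set asboolb.
Qed.

Lemma bm_ext f g : f =1 g -> bm f -> bm g.
Proof. by move=> /funext ->. Qed.

Lemma ExE f : Ex P f = (\int[P]_w f w)%R.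
Proof. by []. Qed.

Lemma ExD f g : bm f -> bm g -> Ex P (fun w => f w + g w) = Ex P f + Ex P g.
Proof. by move=> bf bg; rewrite !ExE RintegralD//; exact: bm_integrable. Qed.

Lemma ExB f g : bm f -> bm g -> Ex P (fun w => f w - g w) = Ex P f - Ex P g.
Proof. by move=> bf bg; rewrite !ExE RintegralB//; exact: bm_integrable. Qed.

Lemma ExZ c f : bm f -> Ex P (fun w => c * f w) = c * Ex P f.
Proof. by move=> bf; rewrite !ExE RintegralZl//; exact: bm_integrable. Qed.

Lemma Ex_le f g : bm f -> bm g -> (forall w, f w <= g w) -> Ex P f <= Ex P g.
Proof. by move=> bf bg fg; rewrite !ExE le_Rintegral//; exact: bm_integrable. Qed.

Lemma Ex_cst c : Ex P (fun=> c) = c.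
Proof.
rewrite ExE Rintegral_cst//; transitivity (c * fine (1%E : \bar R)); last exact: mulr1.
by congr (_ * fine _); exact: probability_setT.
Qed.

Lemma Ex_ge0 f : (forall w, 0 <= f w) -> 0 <= Ex P f.
Proof. by move=> f0; rewrite ExE Rintegral_ge0. Qed.

Lemma Ex_sum (I : Type) (s : seq I) (p : pred I) (h : I -> Omega -> R) :
  (forall i, bm (h i)) ->
  Ex P (fun w => \sum_(i <- s | p i) h i w) = \sum_(i <- s | p i) Ex P (h i).
Proof.
move=> bh; elim: s => [|x s IH].
  by under [X in Ex P X]eq_fun do rewrite big_nil; rewrite Ex_cst big_nil.
under [X in Ex P X]eq_fun do rewrite big_cons; rewrite big_cons; case: (p x) => //.
by rewrite ExD ?IH//; exact: bm_sum.
Qed.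

Lemma Ex_indic A : measurable A -> Ex P (\1_A) = Pr P A.
Proof.
by move=> mA; rewrite /Ex /Pr integral_indic// setIT.
Qed.

Lemma Ex_bool (e : Omega -> bool) : measurable [set w | e w] ->
  Ex P (fun w => (e w)%:R) = Pr P [set w | e w].
Proof.
move=> me; rewrite -Ex_indic//; congr Ex.
by apply/funext => w; rewrite indicE; congr (_%:R); rewrite /in_mem /mem /= /in_set asboolb.
Qed.

Lemma Ex_norm_triangle f g h : bm f -> bm g -> bm h ->
  Ex P (fun w => `|f w - h w|) <=
  Ex P (fun w => `|f w - g w|) + Ex P (fun w => `|g w - h w|).
Proof.
move=> bf bg bh; rewrite -ExD; [|by apply: bm_norm; exact: bmB..].
apply: Ex_le => [||w]; [by apply: bm_norm; exact: bmB|apply: bmD; apply: bm_norm; exact: bmB|].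
by rewrite (le_trans _ (ler_normD _ _))// addrA subrK.
Qed.

Lemma Pr_fin A : measurable A -> P A = (Pr P A)%:E.
Proof. by move=> mA; rewrite /Pr fineK// fin_num_measure. Qed.

Lemma Pr_ge0 A : 0 <= Pr P A.
Proof. by rewrite /Pr fine_ge0. Qed.

Lemma Pr_le A B : measurable A -> measurable B -> A `<=` B -> Pr P A <= Pr P B.
Proof.
by move=> mA mB AB; rewrite -lee_fin -!Pr_fin// le_measure// inE.
Qed.

Lemma Pr_le1 A : measurable A -> Pr P A <= 1.
Proof. by move=> mA; rewrite -lee_fin -Pr_fin// probability_le1. Qed.

Lemma Pr_setU A B : measurable A -> measurable B -> Pr P (A `|` B) <= Pr P A + Pr P B.
Proof.
by move=> mA mB; rewrite -lee_fin EFinD -!Pr_fin//; [exact: measureU2|exact: measurableU].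
Qed.

Lemma Pr_setC A : measurable A -> Pr P (~` A) = 1 - Pr P A.
Proof.
move=> mA; apply: EFin_inj; rewrite EFinB -!Pr_fin//; last exact: measurableC.
exact: probability_setC.
Qed.

Lemma Pr_setT : Pr P setT = 1.
Proof. by rewrite /Pr probability_setT. Qed.

Lemma measurable_gt (f : Omega -> R) x : measurable_fun setT f -> measurable [set w | x < f w].
Proof.
move=> mf; have /measurable_fun_ltr : measurable_fun setT (fun _ : Omega => x) by exact: measurable_cst.
by move=> /(_ _ mf measurableT [set true]); rewrite setTI; apply.
Qed.

Lemma measurable_ltf (f : Omega -> R) x : measurable_fun setT f -> measurable [set w | f w < x].
Proof.
move=> mf; have /(measurable_fun_ltr mf) : measurable_fun setT (fun _ : Omega => x) by exact: measurable_cst.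
by move=> /(_ measurableT [set true]); rewrite setTI; apply.
Qed.

Lemma measurable_lef (f : Omega -> R) x : measurable_fun setT f -> measurable [set w | f w <= x].
Proof.
move=> mf; have /(measurable_fun_ler mf) : measurable_fun setT (fun _ : Omega => x) by exact: measurable_cst.
by move=> /(_ measurableT [set true]); rewrite setTI; apply.
Qed.

Lemma measurable_preim (f : Omega -> R) (C : set R) : measurable_fun setT f -> measurable C ->
  measurable [set w | C (f w)].
Proof. by move=> mf mC; have := mf measurableT _ mC; rewrite setTI. Qed.

End BoundedExpectation.

(** The integral of [1(x < z)] over [[0, Q h]] is the truncated positive part of [z]. The sum is its
    left-endpoint Riemann sum; the integrand being nonincreasing with values in [[0, 1]], the excess
    is at most one step. *)
Lemma layer_cake {R : realType} (h z : R) (Q : nat) : 0 < h ->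
  Num.min (Num.max z 0) (Q%:R * h) <= h * \sum_(q < Q) (q%:R * h < z)%R%:R
  <= Num.min (Num.max z 0) (Q%:R * h) + h.
Proof.
move=> h0; elim: Q => [|Q /andP[IH1 IH2]].
  rewrite big_ord0 mul0r mulr0; case: (leP z 0) => z0; apply/andP; split.
  - by rewrite /Num.min ltxx.
  - by rewrite /Num.min ltxx add0r ltW.
  - by rewrite ge_min lexx orbT.
  - by rewrite min_r ?add0r ltW.
have SQ : \sum_(q < Q) ((q%:R * h < z)%R%:R : R) <= Q%:R.
  rewrite -[leRHS](_ : \sum_(q < Q) 1 = _); last by rewrite big_const_ord iter_addr_0.
  by apply: ler_sum => i _; case: (_ < _).
rewrite big_ord_recr /= mulrDr.
have Qh : 0 <= Q%:R * h by rewrite mulr_ge0 ?ler0n// ltW.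
have SE : (Q.+1%:R * h = Q%:R * h + h :> R) by rewrite -natr1 mulrDl mul1r.
have hS : h * \sum_(q < Q) ((q%:R * h < z)%R%:R : R) <= Q%:R * h by rewrite mulrC ler_pM2r.
case: (ltP (Q%:R * h) z) => zQ.
  have z0 : 0 < z by rewrite (le_lt_trans _ zQ).
  move: IH1 IH2; rewrite (max_l (ltW z0)) (min_r (ltW zQ)) => IH1 IH2.
  rewrite mulr1 SE; case: (leP z (Q%:R * h + h)) => zz; apply/andP; split; lra.
have -> : Num.min (Num.max z 0) (Q.+1%:R * h) = Num.min (Num.max z 0) (Q%:R * h).
  rewrite !min_l//; first by rewrite ge_max zQ.
  by rewrite ge_max SE; apply/andP; split; lra.
by rewrite mulr0 addr0 IH1.
Qed.

(** * Probabilities of rays that may have no end point *)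

Section Laws.
Context {R : realType} {d} {Omega : measurableType d} (P : probability Omega R).
Local Notation bm := bounded_measurable.

Lemma bm_ind (C : set R) (f : Omega -> R) : measurable_fun setT f -> measurable C ->
  bm (fun w => \1_C (f w) : R).
Proof.
move=> mf mC; split; last by exists 1 => w; rewrite indicE; case: (_ \in _); rewrite ?normr1 ?normr0.
by apply: (measurableT_comp (f := (\1_C : R -> R))) => //; exact: measurable_indic.
Qed.

Lemma Ex_ind (C : set R) (f : Omega -> R) : measurable_fun setT f -> measurable C ->
  Ex P (fun w => \1_C (f w)) = Pr P [set w | C (f w)].
Proof.
move=> mf mC; rewrite -Ex_indic; last exact: measurable_preim.
by congr Ex; apply/funext => w; rewrite !indicE; congr (_%:R); apply/idP/idP; rewrite !inE.
Qed.

Lemma Ex_ind2 (C D : set R) (f g : Omega -> R) : measurable_fun setT f -> measurable_fun setT g ->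
  measurable C -> measurable D ->
  Ex P (fun w => \1_C (f w) * \1_D (g w)) = Pr P [set w | C (f w) /\ D (g w)].
Proof.
move=> mf mg mC mD; rewrite -Ex_indic; last first.
  by apply: (measurableI [set w | C (f w)] [set w | D (g w)]); exact: measurable_preim.
congr Ex; apply/funext => w; rewrite !indicE -natrM; congr (_%:R).
rewrite mulnb; congr nat_of_bool; apply/idP/idP; rewrite !inE.
  by move=> /andP[]; rewrite !inE.
by move=> -[? ?]; apply/andP; rewrite !inE.
Qed.

(** A down-set is a countable increasing union of closed rays, and continuity from below passes the
    bound to the union. It serves for sets such as [F x < b] when the cdf jumps, so that no quantile
    is attained. *)
Lemma down_set_prob (X : Omega -> R) (A : set R) (c : R) : measurable_fun setT X -> 0 <= c ->
  (forall x y, A y -> x <= y -> A x) ->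
  (forall x, A x -> Pr P [set w | X w <= x] <= c) ->
  Pr P [set w | A (X w)] <= c.
Proof.
move=> mX c0 Adown Ac.
have [A0|/set0P[x0 Ax0]] := eqVneq A set0.
  rewrite (_ : [set w | A (X w)] = set0); first by rewrite /Pr measure0.
  by apply/seteqP; split => w //=; rewrite A0.
(* A cofinal sequence in [A]: constant if [A] has a maximum, [sup A - 1 / (n + 1)] if it is a
   bounded open ray, and [n] if it is the whole line. *)
have [x [xA xmono xcof]] : exists x : nat -> R, [/\ forall n, A (x n),
    {homo x : m n / (m <= n)%N >-> m <= n} & forall y, A y -> exists n, y <= x n].
  have [[s [As sA]]|nomax] := pselect (exists s, A s /\ forall y, A y -> y <= s).
    by exists (fun=> s); split => // y /sA ys; exists 0%N.
  have [Aub|Aub] := pselect (has_ubound A).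
    have supA : has_sup A by split => //; exists x0.
    exists (fun n => sup A - n.+1%:R^-1); split.
    - move=> n; have [|y Ay] := @sup_adherent _ A n.+1%:R^-1 _ supA; first by rewrite invr_gt0.
      by move=> /ltW; exact: Adown.
    - by move=> m n mn; rewrite lerB// lef_pV2 ?posrE// ler_nat.
    - move=> y Ay; have ys : y < sup A.
        rewrite lt_neqAle (ub_le_sup Aub Ay) andbT; apply/eqP => yE; apply: nomax.
        by exists y; split => // z Az; rewrite yE; exact: ub_le_sup.
      have := @ltr_add_invr _ y (sup A) ys => -[k Hk]; exists k; rewrite lerBrDr ltW//.
  exists (fun n => n%:R); split.
  - move=> n; apply: contrapT => nA; apply: Aub; exists n%:R => y Ay.
    rewrite leNgt; apply/negP => ny; apply: nA; exact: (Adown _ _ Ay (ltW ny)).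
  - by move=> m n; rewrite ler_nat.
  - by move=> y _; exists (Num.truncn y).+1; rewrite ltW// truncnS_gt.
pose F n := [set w | X w <= x n].
have mF n : measurable (F n) by exact: measurable_lef.
have mU : measurable (\bigcup_n F n) by exact: bigcup_measurable.
have UE : [set w | A (X w)] = \bigcup_n F n.
  apply/seteqP; split => [w /xcof[n ?]|w [n _]]; first by exists n.
  by apply: Adown; exact: xA.
have Fnd : nondecreasing_seq F.
  by move=> m n mn; apply/subsetPset => w /= /le_trans; apply; exact: xmono.
have cv := nondecreasing_cvg_mu (mu := P) mF mU Fnd.
rewrite UE -lee_fin -Pr_fin// -(cvg_lim _ cv)//.
apply: lime_le; first by apply/cvg_ex; exists (P (\bigcup_n F n)).
by apply: nearW => n; rewrite /= Pr_fin// lee_fin; exact: Ac.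
Qed.

Lemma up_set_prob (X : Omega -> R) (A : set R) (c : R) : measurable_fun setT X -> 0 <= c ->
  (forall x y, A x -> x <= y -> A y) ->
  (forall x, A x -> Pr P [set w | x <= X w] <= c) ->
  Pr P [set w | A (X w)] <= c.
Proof.
move=> mX c0 Aup Ac.
have -> : [set w | A (X w)] = [set w | [set x | A (- x)] (- X w)].
  by apply/seteqP; split => w /=; rewrite opprK.
apply: (down_set_prob (X := fun w => - X w)) => //; first exact: measurable_funN.
  by move=> x y /= Ay xy; apply: (Aup (- y)) => //; rewrite lerN2.
move=> x /Ac; rewrite (_ : [set w | - x <= X w] = [set w | - X w <= x])//.
by apply/seteqP; split => w /=; rewrite lerNl.
Qed.

End Laws.

(** * Variances of averages *)

Definition avg {R : realType} (N : nat) (f : nat -> R) : R := N%:R^-1 * \sum_(i < N) f i.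

Section Averages.
Context {R : realType}.
Implicit Types (f g : nat -> R).

Lemma sum_cst (N : nat) (c : R) : \sum_(i < N) c = N%:R * c.
Proof. by rewrite big_const_ord iter_addr_0 mulr_natl. Qed.

Lemma avg_cst N (c : R) : (0 < N)%N -> avg N (fun=> c) = c.
Proof. by move=> N0; rewrite /avg sum_cst mulrA mulVf ?mul1r// pnatr_eq0 -lt0n. Qed.

Lemma avgD N f g : avg N (fun i => f i + g i) = avg N f + avg N g.
Proof. by rewrite /avg big_split mulrDr. Qed.

Lemma avgZ N c f : avg N (fun i => c * f i) = c * avg N f.
Proof. by rewrite /avg -mulr_sumr mulrCA. Qed.

Lemma avgB N f g : avg N (fun i => f i - g i) = avg N f - avg N g.
Proof. by rewrite /avg sumrB mulrBr. Qed.

Lemma ler_avg N f g : (forall i, (i < N)%N -> f i <= g i) -> avg N f <= avg N g.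
Proof. by move=> fg; rewrite /avg ler_wpM2l// ler_sum// => i _; exact: fg. Qed.

Lemma eq_avg N f g : (forall i, (i < N)%N -> f i = g i) -> avg N f = avg N g.
Proof. by move=> fg; rewrite /avg; congr (_ * _); apply: eq_bigr => i _; exact: fg. Qed.

Lemma avg_sum N (I : finType) (h : I -> nat -> R) :
  avg N (fun i => \sum_l h l i) = \sum_l avg N (h l).
Proof. by rewrite /avg exchange_big mulr_sumr. Qed.

Lemma avg_mul N M f g : avg N f * avg M g = avg N (fun i => avg M (fun j => f i * g j)).
Proof.
rewrite /avg -mulrA; congr (_ * _); rewrite mulr_suml; apply: eq_bigr => i _.
by rewrite -mulr_sumr mulrCA.
Qed.

Lemma avg_norm_le N f : `|avg N f| <= avg N (fun i => `|f i|).
Proof. by rewrite /avg normrM ger0_norm// ler_wpM2l// ler_norm_sum. Qed.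

End Averages.

Section Variance.
Context {R : realType} {d} {Omega : measurableType d} (P : probability Omega R).
Local Notation bm := bounded_measurable.

Lemma bm_avg N (f : nat -> Omega -> R) : (forall i, bm (f i)) ->
  bm (fun w => avg N (fun i => f i w)).
Proof. by move=> bf; apply: bmZ; exact: bm_sum. Qed.

Lemma Ex_avg N (f : nat -> Omega -> R) : (forall i, bm (f i)) ->
  Ex P (fun w => avg N (fun i => f i w)) = avg N (fun i => Ex P (f i)).
Proof. by move=> bf; rewrite ExZ ?Ex_sum//; exact: bm_sum. Qed.

(** Expanding the square gives the average of the products minus [p ^ 2]. Far pairs contribute [a]
    beyond [p ^ 2]; near pairs contribute at most [q], and they form a fraction [rho]. For
    indicators [q] is the probability of the event, so that small cells have small variances. *)
Lemma variance_mean (N : nat) (near : rel nat) (rho q a p : R) (f : nat -> Omega -> R) :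
  (0 < N)%N -> 0 <= a -> 0 <= q ->
  avg N (fun i => avg N (fun j => (near i j)%:R)) <= rho ->
  (forall i, bm (f i)) ->
  (forall i, (i < N)%N -> Ex P (f i) = p) ->
  (forall i j, (i < N)%N -> (j < N)%N -> Ex P (fun w => f i w * f j w) <= q) ->
  (forall i j, (i < N)%N -> (j < N)%N -> ~~ near i j ->
    Ex P (fun w => f i w * f j w) <= p ^+ 2 + a) ->
  Ex P (fun w => (avg N (fun i => f i w) - p) ^+ 2) <= rho * q + a.
Proof.
move=> N0 a0 q0 hnear bf Ef Eff far.
have bff i j : bm (fun w => f i w * f j w) by exact: bmM.
have -> : (fun w => (avg N (fun i => f i w) - p) ^+ 2) =
    (fun w => (avg N (fun i => avg N (fun j => f i w * f j w)) - (p *+ 2) * avg N (fun i => f i w))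
              + p ^+ 2).
  by apply/funext => w; rewrite -avg_mul; ring.
rewrite ExD; [|apply: bmB; [by apply: bm_avg => i; exact: bm_avg|by apply: bmZ; exact: bm_avg]|exact: bm_cst].
rewrite Ex_cst ExB; [|by apply: bm_avg => i; exact: bm_avg|by apply: bmZ; exact: bm_avg].
rewrite ExZ; last exact: bm_avg.
rewrite !Ex_avg//; last by move=> i; exact: bm_avg.
have -> : avg N (fun i => Ex P (f i)) = p by rewrite -[RHS](avg_cst p N0); exact: eq_avg.
have step : avg N (fun i => Ex P (fun w => avg N (fun j => f i w * f j w))) <=
    avg N (fun i => avg N (fun j => q * (near i j)%:R + (p ^+ 2 + a))).
  apply: ler_avg => i iN; rewrite Ex_avg//; apply: ler_avg => j jN.
  case: (boolP (near i j)) => nij; last by rewrite mulr0 add0r; exact: far.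
  by rewrite mulr1 (le_trans (Eff _ _ iN jN))// lerDl addr_ge0// sqr_ge0.
have E2 : avg N (fun i => avg N (fun j => q * (near i j)%:R + (p ^+ 2 + a))) =
    q * avg N (fun i => avg N (fun j => (near i j)%:R)) + (p ^+ 2 + a).
  rewrite -avgZ -[X in _ = _ + X](avg_cst _ N0) -avgD; apply: eq_avg => i iN.
  by rewrite avgD avgZ avg_cst.
rewrite E2 in step.
have : q * avg N (fun i => avg N (fun j => (near i j)%:R)) <= rho * q.
  by rewrite mulrC ler_wpM2r.
move: step; set u := avg _ _; set v := avg _ _; nra.
Qed.

(** Mixing bounds covariances of events only. A function with values in [[0, 1]] is the integral of
    the indicators of its superlevel sets, so its covariances are averages of covariances of events
    and keep the bound [a] without any factor (Hoeffding's covariance formula). *)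
Lemma covariance_layers (f g : Omega -> R) (a : R) :
  measurable_fun setT f -> measurable_fun setT g ->
  (forall w, 0 <= f w <= 1) -> (forall w, 0 <= g w <= 1) ->
  (forall x y, Pr P [set w | x < f w /\ y < g w] <=
     Pr P [set w | x < f w] * Pr P [set w | y < g w] + a) ->
  Ex P (fun w => f w * g w) <= Ex P f * Ex P g + a.
Proof.
move=> mf mg f01 g01 hfg.
have bm01 (h : Omega -> R) : measurable_fun setT h -> (forall w, 0 <= h w <= 1) -> bm h.
  move=> mh h01; split => //; exists 1 => w.
  by have /andP[h0 h1] := h01 w; rewrite ger0_norm.
have bf := bm01 f mf f01; have bg := bm01 g mg g01.
have E01 (h : Omega -> R) : bm h -> (forall w, 0 <= h w <= 1) -> 0 <= Ex P h <= 1.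
  move=> bh h01; rewrite Ex_ge0; last by move=> w; have /andP[] := h01 w.
  rewrite -[X in _ <= X](Ex_cst P 1) Ex_le//; first exact: bm_cst.
  by move=> w; have /andP[] := h01 w.
pose L (Q : nat) (h : Omega -> R) w : R := Q%:R^-1 * \sum_(q < Q) (q%:R * Q%:R^-1 < h w)%R%:R.
have bL Q h : bm h -> bm (L Q h).
  move=> bh; apply: bmZ; apply: bm_sum => i; apply: bm_bool.
  by apply: measurable_gt; exact: bh.1.
have LE Q h w : (0 < Q)%N -> 0 <= h w <= 1 -> h w <= L Q h w <= h w + Q%:R^-1.
  move=> Q0 /andP[h0 h1]; have Qi : 0 < Q%:R^-1 :> R by rewrite invr_gt0 ltr0n.
  have := layer_cake (h w) Q Qi.
  by rewrite mulfV ?pnatr_eq0 -?lt0n// (max_l h0) (min_l h1).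
(* With [e = 1 / Q], rounding up to [Q] layers costs [(x + e) * (y + e) - x * y <= 2 * e + e ^ 2 <=
   3 * e] for means [x], [y] in [[0, 1]]. *)
have key Q : (0 < Q)%N -> Ex P (fun w => f w * g w) <= Ex P f * Ex P g + a + 3 * Q%:R^-1.
  move=> Q0; have Qi : 0 < Q%:R^-1 :> R by rewrite invr_gt0 ltr0n.
  have Qi1 : Q%:R^-1 <= 1 :> R by rewrite invf_le1 ?ler1n// ltr0n.
  apply: (@le_trans _ _ (Ex P (fun w => L Q f w * L Q g w))).
    apply: Ex_le => [||w]; [exact: bmM|by apply: bmM; exact: bL|].
    have /andP[f0 _] := f01 w; have /andP[g0 _] := g01 w.
    have /andP[f2 _] := LE Q f w Q0 (f01 w); have /andP[g2 _] := LE Q g w Q0 (g01 w).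
    exact: ler_pM.
  have ELu h : bm h -> (forall w, 0 <= h w <= 1) -> Ex P (L Q h) <= Ex P h + Q%:R^-1.
    move=> bh h01; rewrite -(Ex_cst P Q%:R^-1) -ExD//; last exact: bm_cst.
    apply: Ex_le => [||w]; [exact: bL|by apply: bmD => //; exact: bm_cst|].
    by have /andP[] := LE Q h w Q0 (h01 w).
  have EL0 h : 0 <= Ex P (L Q h).
    by apply: Ex_ge0 => w; rewrite mulr_ge0// sumr_ge0.
  have : Ex P (fun w => L Q f w * L Q g w) <= Ex P (L Q f) * Ex P (L Q g) + a.
    have ind h x : bm h -> bm (fun w => (x < h w)%R%:R).
      by move=> bh; apply: bm_bool; apply: measurable_gt; exact: bh.1.

    have LA h : L Q h = fun w => avg Q (fun q => (q%:R * Q%:R^-1 < h w)%R%:R) by [].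
    rewrite !LA !Ex_avg; [|by move=> q; exact: ind..].
    under [X in Ex P X]eq_fun do rewrite avg_mul.
    have bi i j : bm (fun w => (i%:R * Q%:R^-1 < f w)%R%:R * (j%:R * Q%:R^-1 < g w)%R%:R : R).
      by apply: bmM; exact: ind.
    rewrite Ex_avg; last by move=> i; exact: bm_avg.
    rewrite avg_mul -[X in _ + X](avg_cst a Q0) -avgD; apply: ler_avg => i iQ.
    rewrite Ex_avg// -[X in _ + X](avg_cst a Q0) -avgD; apply: ler_avg => j jQ.
    rewrite !Ex_bool; [|by apply: measurable_gt..].
    apply: le_trans (hfg _ _); rewrite le_eqVlt; apply/orP; left; apply/eqP.
    under [X in Ex P X]eq_fun do rewrite -natrM mulnb.
    rewrite Ex_bool.
      by congr (Pr P _); apply/seteqP; split => w /=; [move/andP|move=> /andP].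
    rewrite (_ : [set w | _] = [set w | i%:R * Q%:R^-1 < f w] `&` [set w | j%:R * Q%:R^-1 < g w]).
      by apply: measurableI; exact: measurable_gt.
    by apply/seteqP; split => w /=; [move/andP|move=> /andP].
  move=> /le_trans; apply.
  have := ELu f bf f01; have := ELu g bg g01; have := EL0 f; have := EL0 g.
  have /andP[] := E01 f bf f01; have /andP[] := E01 g bg g01.
  move: (Ex P f) (Ex P g) (Ex P (L Q f)) (Ex P (L Q g)) (Q%:R^-1) Qi Qi1 => x y u v e.
  move=> e0 e1 x0 x1 y0 y1 u0 v0 uy vx.
  have : u * v <= (x + e) * (y + e) by apply: ler_pM => //; lra.
  nra.
apply/ler_addgt0Pr => e e0.
pose Q := (Num.truncn (3 / e)).+1.
have Q0 : (0 < Q)%N by [].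
apply: (le_trans (key Q Q0)); rewrite lerD2l.
rewrite ler_pdivrMr ?ltr0n// mulrC -ler_pdivrMr// ltW//.
exact: truncnS_gt.
Qed.

End Variance.

(** * Comparison of two dependent samples *)

Section Cells.
Context {R : realType} {d} {Omega : measurableType d} (P : probability Omega R).
Local Notation bm := bounded_measurable.

Lemma Pr_ler_cdf (X : Omega -> R) (x y : R) : measurable_fun setT X -> x <= y ->
  Pr P [set w | X w <= x] <= Pr P [set w | X w <= y].
Proof. by move=> mX xy; apply: Pr_le; [exact: measurable_lef..|move=> w /= /le_trans; apply]. Qed.

Lemma Pr_ltr_cdf (X : Omega -> R) (x y : R) : measurable_fun setT X -> x < y ->
  Pr P [set w | X w <= x] <= Pr P [set w | X w < y].
Proof.
move=> mX xy; apply: Pr_le; [exact: measurable_lef|exact: measurable_ltf|].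
by move=> w /= /le_lt_trans; apply.
Qed.

Lemma Pr_ltl_cdf (X : Omega -> R) (x y : R) : measurable_fun setT X -> x <= y ->
  Pr P [set w | X w < x] <= Pr P [set w | X w < y].
Proof.
by move=> mX xy; apply: Pr_le; [exact: measurable_ltf..|move=> w /= /lt_le_trans; apply].
Qed.

(** The event is the intersection of a down-set of probability at most [b] and an up-set of
    probability at most [1 - a]. Atoms are allowed: one of mass at least [b - a] cannot satisfy both
    conditions. *)
Lemma quantile_cell_prob (X : Omega -> R) (a b : R) : measurable_fun setT X -> 0 <= a <= b -> a <= 1 ->
  Pr P [set w | a <= Pr P [set v | X v < X w] /\ Pr P [set v | X v <= X w] < b] <= b - a.
Proof.
move=> mX /andP[a0 ab] a1.
pose A := [set x | Pr P [set v | X v <= x] < b]; pose U := [set x | a <= Pr P [set v | X v < x]].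
have Adown x y : A y -> x <= y -> A x.
  by rewrite /A /= => Ay xy; exact: le_lt_trans (Pr_ler_cdf mX xy) Ay.
have Uup x y : U x -> x <= y -> U y.
  by rewrite /U /= => Ux xy; exact: le_trans Ux (Pr_ltl_cdf mX xy).
have mA : measurable A.
  by apply: is_interval_measurable => x y Ax Ay z /andP[_ zy]; exact: Adown Ay zy.
have mU : measurable U.
  by apply: is_interval_measurable => x y Ux Uy z /andP[xz _]; exact: Uup Ux xz.
have mXA := measurable_preim mX mA; have mXU := measurable_preim mX mU.
have PA : Pr P [set w | A (X w)] <= b.
  apply: down_set_prob => //; first exact: le_trans ab.
  by move=> x /ltW.
have PU : Pr P [set w | U (X w)] <= 1 - a.
  apply: up_set_prob => //; first by rewrite subr_ge0.
  move=> x Ux; have -> : [set w | x <= X w] = ~` [set w | X w < x].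
    by apply/seteqP; split => w /=; [rewrite leNgt => /negP|move/negP; rewrite -leNgt].
  by rewrite Pr_setC ?lerD2l ?lerN2//; exact: measurable_ltf.
rewrite (_ : [set w | _] = [set w | A (X w)] `&` [set w | U (X w)]); last first.
  by apply/seteqP; split => w /= [].
(* A point in neither set separates them, so the intersection is empty. If there is none, they cover
   the line, and inclusion-exclusion gives [b + (1 - a) - 1]. *)
have [[x [nA nU]]|AU] := pselect (exists x, ~ A x /\ ~ U x).
  rewrite (_ : _ `&` _ = set0); first by rewrite /Pr measure0 subr_ge0.
  apply/seteqP; split => w //= [Aw Uw].
  have [xw|wx] := leP x (X w); first exact: nA (Adown _ _ Aw xw).
  exact: nU (Uup _ _ Uw (ltW wx)).
have : 1 <= Pr P [set w | A (X w)] + Pr P [set w | U (X w)] - Pr P ([set w | A (X w)] `&` [set w | U (X w)]).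
  rewrite lerBrDr -(Pr_setT P).
  have TE : setT = [set w | A (X w)] `|` [set w | U (X w)].
    apply/seteqP; split => w //= _; apply: contrapT => nAU; apply: AU; exists (X w).
    by split => ?; apply: nAU; [left|right].
  have mI := measurableI _ _ mXA mXU; have mUn := measurableU _ _ mXA mXU.
  rewrite TE -!Ex_indic// -!ExD; [|exact: bm_indic..].
  apply: Ex_le => [||w]; [by apply: bmD; exact: bm_indic..|].
  rewrite !indicE in_setI in_setU; case: (w \in [set w | A (X w)]); case: (w \in [set w | U (X w)]);
  by rewrite //= ?addr0 ?add0r ?lerDl.
lra.
Qed.

End Cells.

(** * Discretization of the kernel [1(x < y)] *)

Section CrossComparison.
Context {R : realType} {d} {Omega : measurableType d} (P : probability Omega R).
Local Notation bm := bounded_measurable.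
Variables (M W : nat -> Omega -> R) (N : nat) (near : rel nat) (rho a : R).
Hypothesis N0 : (0 < N)%N.
Hypothesis a0 : 0 <= a.
Hypothesis mM : forall i, measurable_fun setT (M i).
Hypothesis mW : forall i, measurable_fun setT (W i).
Hypothesis lawM : forall i C, measurable C ->
  Pr P [set w | C (M i w)] = Pr P [set w | C (M 0%N w)].
Hypothesis lawW : forall i C, measurable C ->
  Pr P [set w | C (W i w)] = Pr P [set w | C (W 0%N w)].
Hypothesis hnear : avg N (fun i => avg N (fun j => (near i j)%:R)) <= rho.
Hypothesis farMM : forall i j C D, (i < N)%N -> (j < N)%N -> ~~ near i j ->
  measurable C -> measurable D ->
  Pr P [set w | C (M i w) /\ D (M j w)] <=
  Pr P [set w | C (M 0%N w)] * Pr P [set w | D (M 0%N w)] + a.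
Hypothesis farWW : forall i j C D, (i < N)%N -> (j < N)%N -> ~~ near i j ->
  measurable C -> measurable D ->
  Pr P [set w | C (W i w) /\ D (W j w)] <=
  Pr P [set w | C (W 0%N w)] * Pr P [set w | D (W 0%N w)] + a.
Hypothesis farMW : forall i j C D, (i < N)%N -> (j < N)%N -> ~~ near i j ->
  measurable C -> measurable D ->
  Pr P [set w | C (M i w) /\ D (W j w)] <=
  Pr P [set w | C (M 0%N w)] * Pr P [set w | D (W 0%N w)] + a.

Let f C := Pr P [set w | C (M 0%N w)].
Let g D := Pr P [set w | D (W 0%N w)].
Let FN (C : set R) w : R := avg N (fun i => \1_C (M i w)).
Let GN (D : set R) w : R := avg N (fun i => \1_D (W i w)).

Let indicator_variance (X : nat -> Omega -> R) C :
  (forall i, measurable_fun setT (X i)) -> measurable C ->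
  (forall i, Pr P [set w | C (X i w)] = Pr P [set w | C (X 0%N w)]) ->
  (forall i j, (i < N)%N -> (j < N)%N -> ~~ near i j ->
    Pr P [set w | C (X i w) /\ C (X j w)] <=
    Pr P [set w | C (X 0%N w)] * Pr P [set w | C (X 0%N w)] + a) ->
  Ex P (fun w => (avg N (fun i => \1_C (X i w)) - Pr P [set w | C (X 0%N w)]) ^+ 2)
  <= rho * Pr P [set w | C (X 0%N w)] + a.
Proof.
move=> mX mC lawX farX; apply: (variance_mean (near := near)) => //.
- exact: Pr_ge0.
- by move=> i; exact: bm_ind.
- by move=> i _; rewrite Ex_ind// lawX.
- move=> i j _ _; rewrite Ex_ind2// -(lawX i); apply: Pr_le; [|exact: measurable_preim|by move=> w /= []].
  by apply: (measurableI [set w | C (X i w)] [set w | C (X j w)]); exact: measurable_preim.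
- by move=> i j iN jN nij; rewrite Ex_ind2// expr2; exact: farX.
Qed.

Variables (I : finType) (C D E : I -> set R) (kappa : R).
Hypothesis mC : forall l, measurable (C l).
Hypothesis mD : forall l, measurable (D l).
Hypothesis mE : forall l, measurable (E l).
Hypothesis C1 : forall x, \sum_l (\1_(C l) x : R) = 1.
Hypothesis E1 : forall x, \sum_l (\1_(E l) x : R) <= 1.
Hypothesis sandwich : forall l x y, C l x ->
  (\1_(D l) y : R) <= ((x < y)%R%:R : R) <= \1_(D l) y + \1_(E l) y.
Hypothesis smallE : forall l, Pr P [set w | C l (M 0%N w)] * Pr P [set w | E l (W 0%N w)] <=
  kappa * Pr P [set w | E l (W 0%N w)].

Let bM i S : measurable S -> bm (fun w => \1_S (M i w) : R).
Proof. by move=> mS; exact: bm_ind. Qed.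

Let bW i S : measurable S -> bm (fun w => \1_S (W i w) : R).
Proof. by move=> mS; exact: bm_ind. Qed.

(** Knowing only the cell [C l] of [x], the comparison is decided positively for [y] in [D l],
    negatively for [y] outside [D l] and [E l], and left open on [E l]. *)
Let kernel_sandwich x y :
  \sum_l (\1_(C l) x * \1_(D l) y) <= ((x < y)%R%:R : R) <=
  \sum_l (\1_(C l) x * \1_(D l) y) + \sum_l (\1_(C l) x * \1_(E l) y).
Proof.
have cell l : \1_(C l) x * \1_(D l) y <= \1_(C l) x * ((x < y)%R%:R : R) <=
    \1_(C l) x * \1_(D l) y + \1_(C l) x * \1_(E l) y.
  have [xC|xC] := pselect (C l x).
    by rewrite [\1_(C l) x]indicE mem_set// !mul1r; exact: sandwich.
  by rewrite [\1_(C l) x]indicE memNset// !mul0r addr0 lexx.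
have -> : ((x < y)%R%:R : R) = \sum_l (\1_(C l) x * ((x < y)%R%:R : R)) by rewrite -mulr_suml C1 mul1r.
rewrite -big_split /=.
by apply/andP; split; apply: ler_sum => l _; have /andP[] := cell l.
Qed.

Let G x := Pr P [set w | x < W 0%N w].
Let F y := Pr P [set w | M 0%N w < y].

Let G_sandwich x : \sum_l (\1_(C l) x * g (D l)) <= G x <=
  \sum_l (\1_(C l) x * g (D l)) + \sum_l (\1_(C l) x * g (E l)).
Proof.
have ES (S : I -> set R) : (forall l, measurable (S l)) ->
    \sum_l (\1_(C l) x * g (S l)) = Ex P (fun w => \sum_l (\1_(C l) x * \1_(S l) (W 0%N w))).
  move=> mS; rewrite Ex_sum; last by move=> l; apply: bmZ; exact: bW.
  by apply: eq_bigr => l _; rewrite ExZ ?Ex_ind//; exact: bW.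
have bS (S : I -> set R) : (forall l, measurable (S l)) ->
    bm (fun w => \sum_l (\1_(C l) x * \1_(S l) (W 0%N w)) : R).
  by move=> mS; apply: bm_sum => l; apply: bmZ; exact: bW.
have bk : bm (fun w => (x < W 0%N w)%R%:R : R) by apply: bm_bool; exact: measurable_gt.
have bD := bS _ mD; have bE := bS _ mE.
rewrite !ES// /G -Ex_bool; last exact: measurable_gt.
rewrite -ExD//; apply/andP; split; (apply: Ex_le => //; try exact: bmD) => w;
  by have /andP[] := kernel_sandwich x (W 0%N w).
Qed.

Let F_sandwich y : \sum_l (f (C l) * \1_(D l) y) <= F y <=
  \sum_l (f (C l) * \1_(D l) y) + \sum_l (f (C l) * \1_(E l) y).
Proof.
have ES (S : I -> set R) : (forall l, measurable (S l)) ->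
    \sum_l (f (C l) * \1_(S l) y) = Ex P (fun w => \sum_l (\1_(C l) (M 0%N w) * \1_(S l) y)).
  move=> mS; rewrite Ex_sum; last by move=> l; apply: bmM; [exact: bM|exact: bm_cst].
  apply: eq_bigr => l _; under [X in Ex P X]eq_fun do rewrite mulrC.
  by rewrite ExZ ?Ex_ind 1?mulrC//; exact: bM.
have bS (S : I -> set R) : (forall l, measurable (S l)) ->
    bm (fun w => \sum_l (\1_(C l) (M 0%N w) * \1_(S l) y) : R).
  by move=> mS; apply: bm_sum => l; apply: bmM; [exact: bM|exact: bm_cst].
have bk : bm (fun w => (M 0%N w < y)%R%:R : R) by apply: bm_bool; exact: measurable_ltf.
have bD := bS _ mD; have bE := bS _ mE.
rewrite !ES// /F -Ex_bool; last exact: measurable_ltf.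
rewrite -ExD//; apply/andP; split; (apply: Ex_le => //; try exact: bmD) => w;
  by have /andP[] := kernel_sandwich (M 0%N w) y.
Qed.


Let mG : measurable_fun setT G.
Proof.
apply: nonincreasing_measurable => // x y xy; apply: Pr_le; [exact: measurable_gt..|].
by move=> w /=; exact: le_lt_trans.
Qed.

Let mF : measurable_fun setT F.
Proof. by apply: nondecreasing_measurable => // x y xy; exact: Pr_ltl_cdf. Qed.

Let bG i : bm (fun w => G (M i w)).
Proof.
split; first by apply: measurableT_comp.
by exists 1 => w; rewrite ger0_norm ?Pr_ge0 ?Pr_le1//; exact: measurable_gt.
Qed.

Let bF i : bm (fun w => F (W i w)).
Proof.
split; first by apply: measurableT_comp.
by exists 1 => w; rewrite ger0_norm ?Pr_ge0 ?Pr_le1//; exact: measurable_ltf.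
Qed.

Let bFN S : measurable S -> bm (FN S).
Proof. by move=> mS; apply: bm_avg => i; exact: bM. Qed.

Let bGN S : measurable S -> bm (GN S).
Proof. by move=> mS; apply: bm_avg => i; exact: bW. Qed.

Let ExFN S : measurable S -> Ex P (FN S) = f S.
Proof.
move=> mS; rewrite Ex_avg; last by move=> i; exact: bM.
by rewrite -[RHS](avg_cst _ N0); apply: eq_avg => i iN; rewrite Ex_ind// lawM.
Qed.

Let ExGN S : measurable S -> Ex P (GN S) = g S.
Proof.
move=> mS; rewrite Ex_avg; last by move=> i; exact: bW.
by rewrite -[RHS](avg_cst _ N0); apply: eq_avg => i iN; rewrite Ex_ind// lawW.
Qed.

Hypothesis kappa0 : 0 <= kappa.

Let sum_gE : \sum_l g (E l) <= 1.
Proof.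
rewrite (eq_bigr (fun l => Ex P (fun w => \1_(E l) (W 0%N w)))) => [|l _]; last by rewrite Ex_ind.
rewrite -Ex_sum => [|l]; last exact: bW.
by rewrite -[leRHS](Ex_cst P) Ex_le//; [by apply: bm_sum => l; exact: bW|exact: bm_cst].
Qed.

Let sum_fgE : \sum_l f (C l) * g (E l) <= kappa.
Proof.
apply: (@le_trans _ _ (\sum_l kappa * g (E l))); first by apply: ler_sum => l _; exact: smallE.
by rewrite -mulr_sumr -[leRHS]mulr1 ler_wpM2l.
Qed.

(** [FN (C l) * GN (E l)] summed over the cells is the fraction of undecided pairs. A near pair
    counts for at most 1, since [M i] lies in one cell only; a far pair counts for its value under
    independence, at most [kappa], plus one mixing error per cell. *)
Let ExR : Ex P (fun w => \sum_l FN (C l) w * GN (E l) w) <= kappa + #|I|%:R * a + rho.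
Proof.
have bCE i j l : bm (fun w => \1_(C l) (M i w) * \1_(E l) (W j w) : R).
  by apply: bmM; [exact: bM|exact: bW].
have bS i j : bm (fun w => \sum_l \1_(C l) (M i w) * \1_(E l) (W j w) : R).
  by apply: bm_sum => l.
have -> : (fun w => \sum_l FN (C l) w * GN (E l) w) =
    fun w => avg N (fun i => avg N (fun j => \sum_l \1_(C l) (M i w) * \1_(E l) (W j w))).
  apply/funext => w; under eq_bigr do rewrite avg_mul.
  by rewrite -avg_sum; apply: eq_avg => i _; rewrite -avg_sum.
rewrite Ex_avg; last by move=> i; exact: bm_avg.
apply: (@le_trans _ _ (avg N (fun i => avg N (fun j => (near i j)%:R + (kappa + #|I|%:R * a))))).
  apply: ler_avg => i iN; rewrite Ex_avg//; apply: ler_avg => j jN.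
  have Ia : 0 <= #|I|%:R * a by rewrite mulr_ge0.
  case: (boolP (near i j)) => nij.
    apply: (@le_trans _ _ 1); last by rewrite mulr1n lerDl addr_ge0.
    rewrite -[leRHS](Ex_cst P) Ex_le//; first exact: bm_cst.
    move=> w; rewrite -(C1 (M i w)); apply: ler_sum => l _.
    by rewrite !indicE; do 2 case: (_ \in _); rewrite ?mulr0 ?mul0r ?mulr1.
  rewrite add0r Ex_sum//.
  apply: (@le_trans _ _ (\sum_l (f (C l) * g (E l) + a))).
    by apply: ler_sum => l _; rewrite Ex_ind2//; exact: farMW.
  by rewrite big_split /= lerD// big_const iter_addr_0 mulr_natl.
rewrite (eq_avg (g := fun i => avg N (fun j => (near i j)%:R) + (kappa + #|I|%:R * a))) => [|i iN].
  by rewrite avgD avg_cst// addrC lerD.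
by rewrite avgD avg_cst.
Qed.

(* Discretization turns the degenerate part of the U-statistic into [\sum_l (FN (C l) - f (C l)) *
   (GN (D l) - g (D l))]; AM-GM with weight [lam] reduces it to the variances of [FN] and [GN]. *)
Lemma cross_comparison (lam : R) : 0 < lam ->
  Ex P (fun w => `|avg N (fun i => avg N (fun j => (M i w < W j w)%R%:R)) -
    (avg N (fun i => Pr P [set v | M i w < W 0%N v] + Pr P [set v | M 0%N v < W i w])
     - Ex P (fun w' => Pr P [set v | M 0%N v < W 0%N w']))|) <=
  4 * kappa + #|I|%:R * a + rho + lam * (rho + #|I|%:R * a) + lam^-1 * (#|I|%:R * (rho + a)).
Proof.
move=> lam0; rewrite -/(Ex P (fun w' => F (W 0%N w'))).
set e0 := Ex P (fun w' => F (W 0%N w')).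
have bX l : bm (fun w => FN (C l) w - f (C l)) by apply: bmB; [exact: bFN|exact: bm_cst].
have bY l : bm (fun w => GN (D l) w - g (D l)) by apply: bmB; [exact: bGN|exact: bm_cst].
pose T l w := lam * (FN (C l) w - f (C l)) ^+ 2 + lam^-1 * (GN (D l) w - g (D l)) ^+ 2.
have bT l : bm (T l) by apply: bmD; apply: bmZ; exact: bmX.
pose Rw w := \sum_l FN (C l) w * GN (E l) w.
have bR : bm Rw by apply: bm_sum => l; apply: bmM; [exact: bFN|exact: bGN].
pose A1 w := \sum_l g (E l) * FN (C l) w.
have bA1 : bm A1 by apply: bm_sum => l; apply: bmZ; exact: bFN.
pose A2 w := \sum_l f (C l) * GN (E l) w.
have bA2 : bm A2 by apply: bm_sum => l; apply: bmZ; exact: bGN.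
pose e := \sum_l f (C l) * g (E l).
have he0 : \sum_l f (C l) * g (D l) <= e0 <= \sum_l f (C l) * g (D l) + e.
  have ES (S : I -> set R) : (forall l, measurable (S l)) ->
      \sum_l f (C l) * g (S l) = Ex P (fun w => \sum_l f (C l) * \1_(S l) (W 0%N w)).
    move=> mS; rewrite Ex_sum => [|l]; last by apply: bmZ; exact: bW.
    by apply: eq_bigr => l _; rewrite ExZ ?Ex_ind//; exact: bW.
  have bS (S : I -> set R) : (forall l, measurable (S l)) ->
      bm (fun w => \sum_l f (C l) * \1_(S l) (W 0%N w)).
    by move=> mS; apply: bm_sum => l; apply: bmZ; exact: bW.
  have bD := bS _ mD; have bE := bS _ mE.
  rewrite /e !ES// -ExD//; apply/andP; split; (apply: Ex_le => //; try exact: bmD) => w;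
    by have /andP[] := F_sandwich (W 0%N w).
(* The kernel average, the averages of [G] and of [F], and [e0] are each squeezed between a
   discretized value and that value plus an undecided part. These parts are [Rw], [A1], [A2] and
   [e]; each contributes one [kappa], whence the final [4 * kappa]. *)
have pointwise w : `|avg N (fun i => avg N (fun j => (M i w < W j w)%R%:R)) -
    (avg N (fun i => G (M i w) + F (W i w)) - e0)| <= \sum_l T l w + Rw w + A1 w + A2 w + e.
  set S := avg N (fun i => avg N _).
  have hS : \sum_l FN (C l) w * GN (D l) w <= S <= \sum_l FN (C l) w * GN (D l) w + Rw w.
    have SE (B : I -> set R) : \sum_l FN (C l) w * GN (B l) w =
        avg N (fun i => avg N (fun j => \sum_l \1_(C l) (M i w) * \1_(B l) (W j w))).
      under eq_bigr do rewrite avg_mul.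
      by rewrite -avg_sum; apply: eq_avg => i _; rewrite -avg_sum.
    rewrite /Rw !SE -avgD; apply/andP; split; apply: ler_avg => i _; rewrite -?avgD;
      by apply: ler_avg => j _; have /andP[] := kernel_sandwich (M i w) (W j w).
  have hG : \sum_l g (D l) * FN (C l) w <= avg N (fun i => G (M i w)) <= \sum_l g (D l) * FN (C l) w + A1 w.
    have SE (B : I -> set R) : \sum_l g (B l) * FN (C l) w =
        avg N (fun i => \sum_l \1_(C l) (M i w) * g (B l)).
      under eq_bigr do rewrite -avgZ.
      by rewrite -avg_sum; apply: eq_avg => i _; apply: eq_bigr => l _; rewrite mulrC.
    rewrite /A1 !SE -avgD; apply/andP; split; apply: ler_avg => i _;
      by have /andP[] := G_sandwich (M i w).
  have hF : \sum_l f (C l) * GN (D l) w <= avg N (fun i => F (W i w)) <= \sum_l f (C l) * GN (D l) w + A2 w.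
    have SE (B : I -> set R) : \sum_l f (C l) * GN (B l) w =
        avg N (fun i => \sum_l f (C l) * \1_(B l) (W i w)).
      under eq_bigr do rewrite -avgZ.
      by rewrite -avg_sum.
    rewrite /A2 !SE -avgD; apply/andP; split; apply: ler_avg => i _;
      by have /andP[] := F_sandwich (W i w).
  have hT : `|\sum_l FN (C l) w * GN (D l) w - \sum_l g (D l) * FN (C l) w
      - \sum_l f (C l) * GN (D l) w + \sum_l f (C l) * g (D l)| <= \sum_l T l w.
    rewrite -!sumrB -big_split /=; apply: (le_trans (ler_norm_sum _ _ _)); apply: ler_sum => l _.
    rewrite (_ : _ + _ = (FN (C l) w - f (C l)) * (GN (D l) w - g (D l))); last by ring.
    rewrite /T; move: (FN _ _ - _) (GN _ _ - _) => x y.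
    have lxy : lam * lam^-1 = 1 by rewrite mulfV ?gt_eqF.
    have li : 0 < lam^-1 by rewrite invr_gt0.
    have h1 : 0 <= lam * (x - lam^-1 * y) ^+ 2 by rewrite mulr_ge0 ?sqr_ge0// ltW.
    have h2 : 0 <= lam * (x + lam^-1 * y) ^+ 2 by rewrite mulr_ge0 ?sqr_ge0// ltW.
    have h3 : 0 <= lam * x ^+ 2 + lam^-1 * y ^+ 2.
      by rewrite addr_ge0// mulr_ge0 ?sqr_ge0// ltW.
    have k1 : lam * (x - lam^-1 * y) ^+ 2 = lam * x ^+ 2 + lam^-1 * y ^+ 2 - 2 * (x * y).
      transitivity (lam * x ^+ 2 - 2 * (lam * lam^-1) * (x * y) + (lam * lam^-1) * lam^-1 * y ^+ 2).
        by ring.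
      by rewrite lxy; ring.
    have k2 : lam * (x + lam^-1 * y) ^+ 2 = lam * x ^+ 2 + lam^-1 * y ^+ 2 + 2 * (x * y).
      transitivity (lam * x ^+ 2 + 2 * (lam * lam^-1) * (x * y) + (lam * lam^-1) * lam^-1 * y ^+ 2).
        by ring.
      by rewrite lxy; ring.
    by rewrite ler_norml; apply/andP; split; lra.
  rewrite avgD; move: hS hG hF hT he0 => /andP[? ?] /andP[? ?] /andP[? ?].
  rewrite ler_norml => /andP[? ?] /andP[? ?].
  by rewrite ler_norml; apply/andP; split; lra.
have bS : bm (fun w => avg N (fun i => avg N (fun j => (M i w < W j w)%R%:R)) : R).
  apply: bm_avg => i; apply: bm_avg => j; apply: bm_bool.
  by have /(_ measurableT [set true]) := measurable_fun_ltr (mM i) (mW j); rewrite setTI; apply.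
have bSum : bm (fun w => \sum_l T l w + Rw w + A1 w + A2 w + e).
  by repeat apply: bmD => //; [exact: bm_sum|exact: bm_cst].
apply: (@le_trans _ _ (Ex P (fun w => \sum_l T l w + Rw w + A1 w + A2 w + e))).
  apply: Ex_le => //; apply: bm_norm; apply: bmB => //; apply: bmB; last exact: bm_cst.
  by apply: bm_avg => i; apply: bmD; [exact: bG|exact: bF].
have bsT : bm (fun w => \sum_l T l w) by exact: bm_sum.
have b1 := bmD bsT bR; have b2 := bmD b1 bA1; have b3 := bmD b2 bA2.
rewrite (ExD P b3 (bm_cst e)) (ExD P b2 bA2) (ExD P b1 bA1) (ExD P bsT bR) Ex_cst.
have -> : Ex P A1 = e.
  rewrite Ex_sum => [|l]; last by apply: bmZ; exact: bFN.
  by apply: eq_bigr => l _; rewrite ExZ ?ExFN 1?mulrC//; exact: bFN.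
have -> : Ex P A2 = e.
  rewrite Ex_sum => [|l]; last by apply: bmZ; exact: bGN.
  by apply: eq_bigr => l _; rewrite ExZ ?ExGN//; exact: bGN.
(* The two families behave differently. The masses of the [C l] add up to 1, so their variances
   contribute [rho] once. The [D l] overlap, each mass is bounded by 1 only, and [rho] is paid once
   per cell. The weight [lam] compensates for this. *)
have ET : Ex P (fun w => \sum_l T l w) <= lam * (rho + #|I|%:R * a) + lam^-1 * (#|I|%:R * (rho + a)).
  rewrite Ex_sum//.
  apply: (@le_trans _ _ (\sum_l (lam * (rho * f (C l) + a) + lam^-1 * (rho + a)))).
    apply: ler_sum => l _; rewrite ExD; [|by apply: bmZ; exact: bmX..].
    have li : 0 <= lam^-1 by rewrite invr_ge0 ltW.
    rewrite !ExZ; [|exact: bmX..]; apply: lerD; apply: ler_wpM2l => //; first exact: ltW.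
      by apply: indicator_variance => // [i|i j iN jN nij]; [exact: lawM|exact: farMM].
    apply: (@le_trans _ _ (rho * g (D l) + a)).
      by apply: indicator_variance => // [i|i j iN jN nij]; [exact: lawW|exact: farWW].
    rewrite lerD2r -[leRHS]mulr1 ler_wpM2l//; last by apply: Pr_le1; exact: measurable_preim.
    apply: le_trans hnear; rewrite /avg mulr_ge0// sumr_ge0// => i _.
    by rewrite mulr_ge0// sumr_ge0.
  have sf : \sum_l f (C l) = 1.
    rewrite (eq_bigr (fun l => Ex P (fun w => \1_(C l) (M 0%N w)))) => [|l _]; last by rewrite Ex_ind.
    rewrite -Ex_sum => [|l]; last exact: bM.
    by under [X in Ex P X]eq_fun do rewrite C1; rewrite Ex_cst.
  have scst c : \sum_(l : I) c = #|I|%:R * c :> R by rewrite big_const iter_addr_0 mulr_natl.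
  by rewrite big_split /= -mulr_sumr big_split /= -mulr_sumr sf mulr1 !scst mulrCA.
have := ExR; rewrite -/Rw => hR; have := sum_fgE; rewrite -/e => hE.
by move: ET hR; set t := Ex P _; set u := Ex P Rw; lra.
Qed.

End CrossComparison.

(** * Cells built from the quantiles of the block maximum *)

Section QuantileCells.
Context {R : realType} {d} {Omega : measurableType d} (P : probability Omega R).
Local Notation bm := bounded_measurable.
Variables (M W : nat -> Omega -> R) (N : nat) (near : rel nat) (rho a : R).
Hypothesis N0 : (0 < N)%N.
Hypothesis a0 : 0 <= a.
Hypothesis mM : forall i, measurable_fun setT (M i).
Hypothesis mW : forall i, measurable_fun setT (W i).
Hypothesis lawM : forall i C, measurable C ->
  Pr P [set w | C (M i w)] = Pr P [set w | C (M 0%N w)].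
Hypothesis lawW : forall i C, measurable C ->
  Pr P [set w | C (W i w)] = Pr P [set w | C (W 0%N w)].
Hypothesis hnear : avg N (fun i => avg N (fun j => (near i j)%:R)) <= rho.
Hypothesis farMM : forall i j C D, (i < N)%N -> (j < N)%N -> ~~ near i j ->
  measurable C -> measurable D ->
  Pr P [set w | C (M i w) /\ D (M j w)] <=
  Pr P [set w | C (M 0%N w)] * Pr P [set w | D (M 0%N w)] + a.
Hypothesis farWW : forall i j C D, (i < N)%N -> (j < N)%N -> ~~ near i j ->
  measurable C -> measurable D ->
  Pr P [set w | C (W i w) /\ D (W j w)] <=
  Pr P [set w | C (W 0%N w)] * Pr P [set w | D (W 0%N w)] + a.
Hypothesis farMW : forall i j C D, (i < N)%N -> (j < N)%N -> ~~ near i j ->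
  measurable C -> measurable D ->
  Pr P [set w | C (M i w) /\ D (W j w)] <=
  Pr P [set w | C (M 0%N w)] * Pr P [set w | D (W 0%N w)] + a.

Lemma cross_comparison_quantile (K : nat) (lam : R) : (0 < K)%N -> 0 < lam ->
  Ex P (fun w => `|avg N (fun i => avg N (fun j => (M i w < W j w)%R%:R)) -
    (avg N (fun i => Pr P [set v | M i w < W 0%N v] + Pr P [set v | M 0%N v < W i w])
     - Ex P (fun w' => Pr P [set v | M 0%N v < W 0%N w']))|) <=
  4 * K%:R^-1 + (K.+1 * 2)%:R * a + rho + lam * (rho + (K.+1 * 2)%:R * a)
   + lam^-1 * ((K.+1 * 2)%:R * (rho + a)).
Proof.
move=> K0 lam0.
have KR : 0 < K%:R :> R by rewrite ltr0n.
pose Lt x := Pr P [set v | M 0%N v < x]; pose Le x := Pr P [set v | M 0%N v <= x].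
have Lt0 x : 0 <= K%:R * Lt x by rewrite mulr_ge0 ?Pr_ge0// ltW.
have LtLe x y : x < y -> Le x <= Lt y by exact: Pr_ltr_cdf.
have Ltm x y : x <= y -> Lt x <= Lt y by exact: Pr_ltl_cdf.
have Lem x y : x <= y -> Le x <= Le y by exact: Pr_ler_cdf.
pose I := ('I_K.+1 * bool)%type.
pose t x := Num.truncn (K%:R * Lt x).
have tm x y : x <= y -> (t x <= t y)%N.
  by move=> xy; apply: le_truncn; rewrite ler_pM2l// Ltm.
have tub x : K%:R * Lt x < (t x).+1%:R by exact: truncnS_gt.
have tlb x : (t x)%:R <= K%:R * Lt x by have /andP[] := truncn_itv (Lt0 x).
(* With [t x = l] iff [l / K <= F(x-) < l.+1 / K], the cell [(l, true)] has mass at most [1 / K], while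
   [(l, false)] is at most one point, the one where the cdf jumps past [l.+1 / K]. *)
pose C (p : I) := [set x | t x = p.1 /\ (K%:R * Le x < (t x).+1%:R) = p.2].
pose D (p : I) := [set y | forall x, C p x -> x < y].
(* On a cell with at most one point, lying above the cell is the same as exceeding that point, so
   nothing is left undecided. Large atoms of the law of the maximum fall into such cells. *)
pose E (p : I) := if p.2 then C p else set0.
(* If [x < y] share a cell, the cdf at [x] is at most its left limit at [y], hence below the upper
   level of the cell. The flag is then [true]. *)
have C_convex p x y z : C p x -> C p y -> x <= z -> z <= y -> x < y -> p.2 /\ C p z.
  case: p => l [] [/= tx lx] [/= ty ly] xz zy xy.
    split => //; have tz : t z = l by apply/eqP; rewrite eqn_leq -{1}ty -{1}tx !tm.
    split => //=; rewrite tz -ty; rewrite ty in ly *.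
    by apply: le_lt_trans ly; rewrite ler_pM2l// Lem.
  have h1 : K%:R * Le x <= K%:R * Lt y by rewrite ler_pM2l// LtLe.
  move/negbT: lx; rewrite -leNgt => /le_trans/(_ h1)/le_lt_trans/(_ (tub y)).
  by rewrite tx ty ltxx.
have mC p : measurable (C p).
  apply: is_interval_measurable => x y Cx Cy z /andP[xz zy].
  have [xy|yx] := ltP x y; first by have [] := C_convex p x y z Cx Cy xz zy xy.
  by have -> : z = x by apply: le_anti; rewrite xz (le_trans zy yx).
have mD p : measurable (D p).
  apply: is_interval_measurable => x y Dx Dy z /andP[xz zy] u Cu.
  exact: lt_le_trans (Dx _ Cu) xz.
have mE p : measurable (E p) by rewrite /E; case: ifP.
(* The index [K] does occur, where the left limit of the cdf equals 1. Hence [K.+1] indices, doubled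
   by the flag. *)
have tK x : (t x < K.+1)%N.
  rewrite -(ltr_nat R); apply: le_lt_trans (tlb x) _.
  apply: (@le_lt_trans _ _ K%:R); last by rewrite ltr_nat.
  by rewrite -[leRHS]mulr1 ler_pM2l// Pr_le1//; exact: measurable_ltf.
have C1 x : \sum_p (\1_(C p) x : R) = 1.
  pose p0 : I := (Ordinal (tK x), K%:R * Le x < (t x).+1%:R).
  have CE p : \1_(C p) x = (p == p0)%:R :> R.
    rewrite indicE; congr ((nat_of_bool _)%:R); apply/idP/eqP; last first.
      by move=> ->; rewrite inE.
    rewrite inE; case: p => l b [/= tx lx]; congr pair; last exact: esym.
    exact: val_inj.
  rewrite (bigD1 p0)//= big1 ?addr0 ?CE ?eqxx// => p /negbTE pp0.
  by rewrite CE pp0.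
have E1 x : \sum_p (\1_(E p) x : R) <= 1.
  rewrite -(C1 x); apply: ler_sum => p _; rewrite /E; case: ifP => // _.
  by rewrite !indicE in_set0 ler0n.
have Ki : 0 <= K%:R^-1 :> R by rewrite invr_ge0 ltW.
have := cross_comparison N0 a0 mM mW lawM lawW hnear farMM farWW farMW mC mD mE C1 E1
  (kappa := K%:R^-1) _ _ Ki lam0.
rewrite card_prod card_ord card_bool; apply.
- move=> p x y Cx; apply/andP; split.
    rewrite indicE; have [yD|yD] := pselect (D p y); last by rewrite memNset.
    by rewrite mem_set// (yD _ Cx).
  have [xy|xy] := ltP x y; last by rewrite addr_ge0// indicE.
  rewrite indicE; have [yD|yD] := pselect (D p y).
    by rewrite mem_set// lerDl indicE.
  have [x' Cx' yx'] : exists2 x', C p x' & y <= x'.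
    apply: contrapT => nx; apply: yD => u Cu; rewrite ltNge; apply/negP => yu.
    by apply: nx; exists u.
  have [p2 Cy] := C_convex p x x' y Cx Cx' (ltW xy) yx' (lt_le_trans xy yx').
  by rewrite /E p2 !indicE [y \in C p]mem_set// lerDr.
- move=> p; rewrite /E; case: ifP => p2; last by rewrite /Pr measure0 !mulr0.
  rewrite ler_wpM2r ?Pr_ge0//.
  have pK : (p.1 <= K)%N by rewrite -ltnS.
  have -> : K%:R^-1 = p.1.+1%:R / K%:R - p.1%:R / K%:R :> R by rewrite -mulrBl -natrB// subSnn mul1r.
  apply: le_trans (quantile_cell_prob P (mM 0%N) _ _).
  + apply: Pr_le; [exact: measurable_preim| |].
      apply: (measurable_preim (C := [set x | p.1%:R / K%:R <= Lt x /\ Le x < p.1.+1%:R / K%:R])) => //.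
      apply: is_interval_measurable => x y [x1 x2] [y1 y2] z /andP[xz zy].
      by split; [exact: le_trans x1 (Ltm _ _ xz)|exact: le_lt_trans (Lem _ _ zy) y2].
    move=> w [tx lx]; split; first by rewrite ler_pdivrMr// mulrC -tx tlb.
    by rewrite ltr_pdivlMr// mulrC -tx lx p2.
  + by rewrite divr_ge0//= ler_pM2r ?invr_gt0// ler_nat.
  + by rewrite ler_pdivrMr// mul1r ler_nat.
Qed.

End QuantileCells.

(** * Blocks, stationarity and mixing *)

Definition block_max {R : realType} {T : Type} (V : int -> T -> R) (len p : nat) (w : T) : R :=
  bmax V p.+1%:Z len w.

(* [j]-th largest value in the block, for nonnegative values; [0] if [j] exceeds the length. *)
Definition block_order_stat {R : realType} {T : Type} (V : int -> T -> R) (len j p : nat) (w : T) : R :=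
  \big[Num.max/0]_(u < len)
    (if (j <= \sum_(v < len) (V (p.+1%:Z + u%:Z) w <= V (p.+1%:Z + v%:Z) w)%R)%N
     then V (p.+1%:Z + u%:Z) w else 0).

Section BlockFunctionals.
Context {R : realType}.

(** Turns a count of exceedances into one comparison of two block functionals. If the order
    statistic exceeds [x], at least [j] values lie above it or equal it. Conversely, the smallest
    value exceeding [x] has at least [j] values that are not below it. For [x >= 0] the default [0]
    is never above [x]. *)
Lemma block_order_statP {T : Type} (V : int -> T -> R) len j p w x :
  0 <= x -> (0 < j)%N ->
  (x < block_order_stat V len j p w) = (j <= bcnt V p.+1%:Z len x w)%N.
Proof.
move=> x0 j0; rewrite /block_order_stat /bcnt; set f := fun u : 'I_len => V (p.+1%:Z + u%:Z) w.
apply/idP/idP.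
  move=> xW; have [u xu ju] : exists2 u : 'I_len, x < f u &
      (j <= \sum_(v < len) (f u <= f v)%R)%N.
    move: xW; elim/big_ind: _.
    - by rewrite ltNge x0.
    - by move=> y z IHy IHz; rewrite lt_max => /orP[/IHy|/IHz].
    - move=> u _; case: ifP => [ju xu|_]; last by rewrite ltNge x0.
      by exists u.
  apply: (leq_trans ju); apply: leq_sum => v _.
  have [fuv|//] := leP (f u) (f v).
  by rewrite (lt_le_trans xu fuv).
move=> jx.
have [u0 xu0] : exists u : 'I_len, x < f u.
  apply: contrapT => nu; move: jx; rewrite big1 => [|u _]; first by rewrite leqNgt j0.
  by apply/eqP; rewrite eqb0; apply/negP => xu; apply: nu; exists u.
have [u xu umin] := @arg_minP _ _ _ u0 (fun u => x < f u) f xu0.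
apply: (@lt_le_trans _ _ (f u)) => //.
apply: (@le_trans _ _ (if (j <= \sum_(v < len) (f u <= f v)%R)%N then f u else 0)).
  rewrite (leq_trans jx)//; apply: leq_sum => v _.
  by have [xv|//] := ltP x (f v); rewrite umin.
exact: (le_bigmax _ (fun u => if (j <= \sum_(v < len) (f u <= f v)%R)%N then f u else 0) u).
Qed.

Lemma block_max_ge0 {T : Type} (V : int -> T -> R) len p w :
  (forall s, 0 <= V s w) -> 0 <= block_max V len p w.
Proof. by move=> V0; rewrite /block_max /bmax; elim/big_ind: _ => // x y x0 y0; rewrite le_max x0. Qed.

Lemma block_max_shift {T : Type} (V : int -> T -> R) len p h w :
  block_max V len (p + h) w = block_max (fun s => V (s + h%:Z)) len p w.
Proof.
rewrite /block_max /bmax (_ : (p + h).+1%:Z = p.+1%:Z + h%:Z :> int); last by lia.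
by apply: eq_bigr => u _; rewrite addrAC.
Qed.

Lemma block_order_stat_shift {T : Type} (V : int -> T -> R) len j p h w :
  block_order_stat V len j (p + h) w = block_order_stat (fun s => V (s + h%:Z)) len j p w.
Proof.
rewrite /block_order_stat (_ : (p + h).+1%:Z = p.+1%:Z + h%:Z :> int); last by lia.
apply: eq_bigr => u _; rewrite addrAC; congr (if (_ <= _)%N then _ else _).
by apply: eq_bigr => v _; rewrite [_ + v%:Z]addrAC.
Qed.

Lemma measurable_bigmax {d} {T : measurableType d} (I : Type) (s : seq I) (h0 : T -> R) (h : I -> T -> R) :
  measurable_fun setT h0 -> (forall i, measurable_fun setT (h i)) ->
  measurable_fun setT (fun w => \big[Num.max/h0 w]_(i <- s) h i w).
Proof.
move=> mh0 mh; elim: s => [|i s IH]; first by under eq_fun do rewrite big_nil.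
by under eq_fun do rewrite big_cons; exact: measurable_maxr.
Qed.

Lemma measurable_block_max {d} {T : measurableType d} (V : int -> T -> R) len p :
  (0 < len)%N ->
  (forall u, (u < len)%N -> measurable_fun setT (V (p.+1%:Z + u%:Z))) ->
  measurable_fun setT (block_max V len p).
Proof.
move=> len0 mV; apply: measurable_bigmax; last by move=> u; exact: mV.
by have := mV 0%N len0; rewrite addr0.
Qed.

Lemma measurable_block_order_stat {d} {T : measurableType d} (V : int -> T -> R) len j p :
  (forall u, (u < len)%N -> measurable_fun setT (V (p.+1%:Z + u%:Z))) ->
  measurable_fun setT (block_order_stat V len j p).
Proof.
move=> mV; apply: measurable_bigmax => [|u]; first exact: measurable_cst.
apply: measurable_fun_ifT => //; last by exact: mV.
under eq_fun do rewrite -(ler_nat R) natr_sum.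
apply: measurable_fun_ler; first exact: measurable_cst.
apply: measurable_sum => v.
have /(_ measurableT) mle := measurable_fun_ler (mV u (ltn_ord u)) (mV v (ltn_ord v)).
rewrite (_ : (fun w => _) = \1_[set w | V (p.+1%:Z + u%:Z) w <= V (p.+1%:Z + v%:Z) w]).
  by apply: measurable_indic; have := mle [set true]; rewrite setTI; apply.
by apply/funext => w; rewrite indicE; congr (_%:R); rewrite /in_mem /mem /= /in_set asboolb.
Qed.

End BlockFunctionals.

(** * Invariance of the law of the whole path under shifts *)

Section Stationarity.
Context {R : realType}.

(* A pi-system, so that the finite-dimensional laws determine the law of the whole path. *)
Definition rectangles : set (set (int -> R)) :=
  [set A | exists (k : nat) (t : nat -> int) (B : nat -> set R),
     (forall i, measurable (B i)) /\ A = [set x | forall i, (i < k)%N -> B i (x (t i))]].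

Definition path_space := g_sigma_algebraType rectangles.

Lemma rectanglesI : setI_closed rectangles.
Proof.
move=> _ _ [k [t [B [mB ->]]]] [k' [t' [B' [mB' ->]]]].
exists (k + k')%N, (fun i => if (i < k)%N then t i else t' (i - k)%N),
  (fun i => if (i < k)%N then B i else B' (i - k)%N); split.
  by move=> i; case: ifP.
apply/seteqP; split => x /=.
  move=> [H H'] i ik; case: (ltnP i k) => [|ki]; first exact: H.
  by apply: H'; lia.
move=> H; split => i ik; first by have := H i; rewrite ik; apply; lia.
have kik : (k + i < k)%N = false by lia.
by have := H (k + i)%N; rewrite kik addKn; apply; lia.
Qed.

Lemma measurable_coordinate (s : int) : measurable_fun setT (fun x : path_space => x s : R).
Proof.
move=> _ B mB; rewrite setTI; apply: sub_sigma_algebra.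
exists 1%N, (fun=> s), (fun=> B); split => //.
by apply/seteqP; split => x /=; [move=> ? [|//]|move=> /(_ 0%N); apply].
Qed.

Context {d} {Omega : measurableType d} (P : probability Omega R) (V : int -> Omega -> R).
Hypothesis mV : forall s, measurable_fun setT (V s).
Hypothesis statV : strictly_stationary P V.

Definition shifted_path (h : int) (w : Omega) : path_space := fun s => V (s + h) w.

Lemma measurable_shifted_path h : measurable_fun setT (shifted_path h).
Proof.
apply: (@measurability _ _ _ path_space setT (shifted_path h) rectangles) => // _ [_ [k [t [B [mB ->]]]] <-].
rewrite setTI (_ : _ @^-1` _ = \bigcap_(i in [set i | (i < k)%N]) [set w | B i (V (t i + h) w)]).
  by apply: bigcap_measurableType => i _; exact: measurable_preim.
by apply/seteqP; split => w.
Qed.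

Lemma stationary_law h (A : set path_space) : measurable A ->
  P [set w | A (shifted_path h w)] = P [set w | A (shifted_path 0 w)].
Proof.
have m1 (S : set path_space) h' : measurable S -> measurable [set w | S (shifted_path h' w)].
  by move=> mS; have := measurable_shifted_path h' measurableT mS; rewrite setTI.
apply: (dynkin_induction (T := path_space) (G := rectangles)
  (P := [set A | P [set w | A (shifted_path h w)] = P [set w | A (shifted_path 0 w)]])) => //.
- exact: rectanglesI.
- move=> _ [k [t [B [mB ->]]]] /=; rewrite (statV h k t mB); congr (P _).
  by apply/seteqP; split => w /= H i ik; have := H i ik; rewrite /shifted_path addr0.
- move=> S mS /= SE.
  have E h' : [set w | (~` S) (shifted_path h' w)] = ~` [set w | S (shifted_path h' w)] by [].
  by rewrite !E !probability_setC; [rewrite SE|exact: m1..].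
- move=> F mF tF FE /=.
  have E h' : [set w | (\bigcup_k F k) (shifted_path h' w)] = \bigcup_k [set w | F k (shifted_path h' w)] by [].
  have tI h' : trivIset setT (fun k => [set w | F k (shifted_path h' w)]).
    apply/trivIsetP => i j _ _ ij; apply/seteqP; split => w //= [Fi Fj].
    have /trivIsetP/(_ i j Logic.I Logic.I ij) FIJ := tF.
    have : (F i `&` F j) (shifted_path h' w) by [].
    by rewrite FIJ.
  rewrite !E !measure_bigcup//; try by move=> k _; exact: m1.
  by apply: eq_eseriesr => k _; exact: FE.
Qed.

Lemma stationary_Ex h (phi : path_space -> R) : bounded_measurable phi ->
  Ex P (fun w => phi (shifted_path h w)) = Ex P (fun w => phi (shifted_path 0 w)).
Proof.
move=> bphi.
have E h' : Ex P (fun w => phi (shifted_path h' w)) =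
    fine (\int[pushforward P (shifted_path h')]_x (phi x)%:E)%E.
  rewrite /Ex integral_pushforward//.
  - exact: measurable_shifted_path.
  - by apply/measurable_EFinP; exact: bphi.1.
  - apply: (bm_integrable P (f := fun w => phi (shifted_path h' w))); split.
      by apply: (measurableT_comp (f := phi)); [exact: bphi.1|exact: measurable_shifted_path].
    by have [_ [M phiM]] := bphi; exists M => w.
rewrite !E; congr fine; apply: eq_measure_integral => [| |mh0 mh A mA _].
- exact: measurable_shifted_path.
- exact: measurable_shifted_path.
- exact: stationary_law.
Qed.

End Stationarity.

(** * Truncated series and mixing between separated blocks *)

Section Mixing.
Context {R : realType} {d} {Omega : measurableType d} (P : probability Omega R).
Variable X : int -> Omega -> R.
Hypothesis mX : forall t, measurable_fun setT (X t).

Lemma measurable_Fcdf : measurable_fun setT (Fcdf P X).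
Proof. by apply: nondecreasing_measurable => // x y xy; exact: Pr_ler_cdf. Qed.

Lemma measurable_Uv s : measurable_fun setT (Uv P X s).
Proof. by apply: measurableT_comp; [exact: measurable_Fcdf|exact: mX]. Qed.

Lemma measurable_trunc eps :
  measurable_fun setT (fun u : R => u * (if 1 - eps < u then 1 else 0)).
Proof.
apply: measurable_funM; first exact: measurable_id.
apply: measurable_fun_ifT; [|exact: measurable_cst..].
by apply: measurable_fun_ltr; [exact: measurable_cst|exact: measurable_id].
Qed.

Lemma measurable_Ytr eps s : measurable_fun setT (Ytr P X eps s).
Proof.
exact: (measurableT_comp (measurable_trunc eps) (measurable_Uv s)).
Qed.

Lemma Uv01 s w : 0 <= Uv P X s w <= 1.
Proof. by rewrite Pr_ge0 Pr_le1//; exact: measurable_lef. Qed.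

Lemma Ytr_ge0 eps s w : 0 <= Ytr P X eps s w.
Proof. by rewrite mulr_ge0//; [have /andP[] := Uv01 s w|case: ifP]. Qed.

Lemma sigB_measurable eps I A : sigB P X eps I A -> measurable A.
Proof.
apply: smallest_sub; first exact: sigma_algebra_measurable.
move=> _ [s [B [_ [mB ->]]]]; rewrite -[X in measurable X]setTI.
exact: measurable_Ytr.
Qed.

Definition truncated_events eps (I : set int) : set (set Omega) :=
  [set A | exists s B, I s /\ measurable B /\ A = Ytr P X eps s @^-1` B].

(** The sample space with the smaller sigma-field as its measurable structure. Measurability of a
    block functional with respect to the variables of its block is then an instance of the general
    measurability lemmas. *)
Definition truncated_space eps I := g_sigma_algebraType (truncated_events eps I).

Lemma measurable_Ytr_truncated eps I s : I s ->
  measurable_fun setT (Ytr P X eps s : truncated_space eps I -> R).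
Proof.
by move=> Is _ B mB; rewrite setTI; apply: sub_sigma_algebra; exists s, B.
Qed.

Lemma sigB_preim eps I (f : Omega -> R) (C : set R) : measurable C ->
  measurable_fun setT (f : truncated_space eps I -> R) -> sigB P X eps I [set w | C (f w)].
Proof. by move=> mC mf; have := mf measurableT C mC; rewrite setTI. Qed.

(** A real [sup] dominates the members of a set only if the set is bounded. The bound 1 provides
    this, here and again for the supremum over [k] in [alpha_eps]. *)
Lemma alpha_c_bound (F1 F2 : set (set Omega)) (A B : set Omega) :
  F1 `<=` measurable -> F2 `<=` measurable -> F1 A -> F2 B ->
  `|Pr P (A `&` B) - Pr P A * Pr P B| <= alpha_c P F1 F2 <= 1.
Proof.
move=> mF1 mF2 FA FB.
have ub1 A' B' : F1 A' -> F2 B' -> `|Pr P (A' `&` B') - Pr P A' * Pr P B'| <= 1.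
  move=> /mF1 mA' /mF2 mB'.
  have := Pr_ge0 P (A' `&` B'); have := Pr_le1 P (measurableI _ _ mA' mB').
  have := Pr_ge0 P A'; have := Pr_le1 P mA'; have := Pr_ge0 P B'; have := Pr_le1 P mB'.
  by rewrite ler_norml => *; apply/andP; split; nra.
apply/andP; split.
  apply: ub_le_sup; last by exists A => //; exists B.
  by exists 1 => _ [A' FA' [B' FB'] <-]; exact: ub1.
apply: ge_sup; first by exists `|Pr P (A `&` B) - Pr P A * Pr P B|, A => //; exists B.
by move=> _ [A' FA' [B' FB'] <-]; exact: ub1.
Qed.

Lemma alpha_eps_bound eps (k l : nat) (A B : set Omega) : (1 <= k)%N ->
  sigB P X eps [set s : int | 1 <= s <= k%:Z] A ->
  sigB P X eps [set s : int | (k + l)%:Z <= s] B ->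
  `|Pr P (A `&` B) - Pr P A * Pr P B| <= alpha_eps P X eps l.
Proof.
move=> k1 FA FB.
have mS I : sigB P X eps I `<=` measurable by move=> S; exact: sigB_measurable.
have /andP[h _] := alpha_c_bound (mS _) (mS _) FA FB.
apply: (le_trans h); apply: ub_le_sup; last by exists k.
have T0 I : sigB P X eps I set0 by exact: sigma_algebra0.
exists 1 => _ [k' _ <-].
by have /andP[] := alpha_c_bound (mS _) (mS _) (T0 [set s : int | 1 <= s <= k'%:Z])
  (T0 [set s : int | (k' + l)%:Z <= s]).
Qed.

(** Asking for a free stretch of one block length between the blocks makes the lag equal to [b], for
    which mixing is negligible against [1 / k]. The pairs of blocks that are closer form a fraction
    of order [1 / k] and can be treated trivially. *)
Lemma truncated_blocks_mixing eps (b p q : nat) (f g : Omega -> R) (C D : set R) :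
  (0 < b)%N -> (p + 2 * b <= q)%N ->
  measurable C -> measurable D ->
  measurable_fun setT (f : truncated_space eps [set s : int | p.+1%:Z <= s <= (p + b)%:Z] -> R) ->
  measurable_fun setT (g : truncated_space eps [set s : int | q.+1%:Z <= s <= (q + b)%:Z] -> R) ->
  `|Pr P [set w | C (f w) /\ D (g w)] - Pr P [set w | C (f w)] * Pr P [set w | D (g w)]|
  <= alpha_eps P X eps b.
Proof.
move=> b0 pq mC mD mf mg.
have sub (I J : set int) S : I `<=` J -> sigB P X eps I S -> sigB P X eps J S.
  move=> IJ; apply: sub_sigma_algebra2.
  by move=> _ [s [B [Is [mB ->]]]]; exists s, B; split; [exact: IJ|].
apply: (alpha_eps_bound (k := (p + b)%N)); first by lia.
- apply: sub (sigB_preim mC mf) => s /= /andP[? ?]; apply/andP; split; lia.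
- apply: sub (sigB_preim mD mg) => s /= /andP[? ?]; lia.
Qed.

End Mixing.

(** * Linearization of the estimators *)

Lemma stationary_comp {R : realType} {d} {Omega : measurableType d} (P : probability Omega R)
  (X : int -> Omega -> R) (v : R -> R) : measurable_fun setT v ->
  strictly_stationary P X -> strictly_stationary P (fun s w => v (X s w)).
Proof.
move=> mv statX h k t B mB.
by apply: (statX h k t (fun i => v @^-1` B i)) => i; rewrite -[X in measurable X]setTI; exact: mv.
Qed.

(** The estimators average over admissible pairs, whereas the discretization needs the two indices
    to run freely. With [dl] and [dc] the fractions of admissible and excluded pairs, the difference
    is [dc * (dl^-1 * A) - Ac], and both terms are at most [H * dc]. *)
Lemma subset_pair_average {R : realType} (N : nat) (D : rel nat) (h : nat -> nat -> R) (H : R) :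
  (0 < N)%N -> (forall i j, `|h i j| <= H) ->
  `|((\sum_(i < N) \sum_(j < N | D i j) 1)%N%:R)^-1 * (\sum_(i < N) \sum_(j < N | D i j) h i j)
    - avg N (fun i => avg N (h i))| <= 2 * H * avg N (fun i => avg N (fun j => (~~ D i j)%:R)).
Proof.
move=> N0 hH.
have H0 : 0 <= H by exact: le_trans (normr_ge0 _) (hH 0%N 0%N).
have NR : N%:R != 0 :> R by rewrite pnatr_eq0 -lt0n.
pose A := avg N (fun i => avg N (fun j => (D i j)%:R * h i j)).
pose Ac := avg N (fun i => avg N (fun j => (~~ D i j)%:R * h i j)).
pose dl := avg N (fun i => avg N (fun j => (D i j)%:R : R)).
have sumE (g : nat -> nat -> R) : \sum_(i < N) \sum_(j < N | D i j) g i j =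
    N%:R * N%:R * avg N (fun i => avg N (fun j => (D i j)%:R * g i j)).
  rewrite /avg mulrA mulfK// mulr_sumr; apply: eq_bigr => i _.
  rewrite mulrA mulfV// mul1r big_mkcond /=; apply: eq_bigr => j _.
  by case: (D i j); rewrite ?mul1r ?mul0r.
have -> : (\sum_(i < N) \sum_(j < N | D i j) 1)%N%:R = N%:R * N%:R * dl :> R.
  rewrite natr_sum; under eq_bigr do rewrite natr_sum.
  rewrite (sumE (fun _ _ => 1)); congr (_ * _); apply: eq_avg => i _; apply: eq_avg => j _.
  by rewrite mulr1.
rewrite sumE -/A -[avg N (fun i => avg N (h i))](_ : A + Ac = _); last first.
  rewrite -avgD; apply: eq_avg => i _; rewrite -avgD; apply: eq_avg => j _.
  by case: (D i j); rewrite /= ?mul1r ?mul0r ?addr0 ?add0r.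
set dc := avg N (fun i => avg N (fun j => (~~ D i j)%:R)).
have dd : dl + dc = 1.
  rewrite -[RHS](avg_cst 1 N0) -avgD; apply: eq_avg => i _.
  rewrite -[RHS](avg_cst 1 N0) -avgD; apply: eq_avg => j _.
  by case: (D i j); rewrite /= ?addr0 ?add0r.
have bnd (e : rel nat) : `|avg N (fun i => avg N (fun j => (e i j)%:R * h i j))|
    <= H * avg N (fun i => avg N (fun j => (e i j)%:R)).
  apply: le_trans (avg_norm_le _ _) _; rewrite -avgZ; apply: ler_avg => i _.
  apply: le_trans (avg_norm_le _ _) _; rewrite -avgZ; apply: ler_avg => j _.
  by case: (e i j); rewrite ?mul1r ?mulr1 ?mul0r ?mulr0 ?normr0.
have hA : `|A| <= H * dl by exact: bnd.
have hAc : `|Ac| <= H * dc by exact: (bnd (fun i j => ~~ D i j)).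
have dc0 : 0 <= dc by rewrite /dc /avg mulr_ge0// sumr_ge0// => i _; rewrite mulr_ge0// sumr_ge0.
have dl0 : 0 <= dl by rewrite /dl /avg mulr_ge0// sumr_ge0// => i _; rewrite mulr_ge0// sumr_ge0.
have -> : (N%:R * N%:R * dl)^-1 * (N%:R * N%:R * A) = dl^-1 * A.
  by rewrite [(_ * dl)^-1]invfM mulrACA mulVf ?mulf_neq0// mul1r.
(* Without any admissible pair the inverse of [0] is [0], the first average vanishes, and only [Ac]
   remains. *)
have [dl00|dln0] := eqVneq dl 0.
  rewrite dl00 mulr0 in hA; rewrite dl00 invr0 mul0r.
  move: hA hAc; rewrite normr_le0 => /eqP ->; rewrite !add0r normrN.
  by move=> /le_trans; apply; rewrite ler_wpM2r//; lra.
have dlp : 0 < dl by rewrite lt_def dln0.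
have hA' : `|dl^-1 * A| <= H by rewrite normrM gtr0_norm ?invr_gt0// mulrC ler_pdivrMr.
have -> : dl^-1 * A - (A + Ac) = dc * (dl^-1 * A) - Ac.
  have -> : dc = 1 - dl by lra.
  by rewrite mulrBl mul1r [dl * _]mulrA mulfV// mul1r opprD addrA.
apply: le_trans (ler_normB _ _) _; rewrite -mulrA mulr_natl mulr2n lerD//.
by rewrite normrM ger0_norm// mulrC ler_wpM2r.
Qed.

Section Linearization.
Context {R : realType} {d} {Omega : measurableType d} (P : probability Omega R).
Local Notation bm := bounded_measurable.
Variables (X : int -> Omega -> R) (eps : R) (b m : nat) (c : nat -> R).
Hypothesis mX : forall t, measurable_fun setT (X t).
Hypothesis statX : strictly_stationary P X.
Hypothesis b0 : (0 < b)%N.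

Definition order_stat_sf j x := Pr P [set v | x < block_order_stat (Ytr P X eps) b j 0 v].
Definition block_max_cdf y := Pr P [set v | block_max (Ytr P X eps) b 0 v < y].

(** Uncentered Hajek projection of the kernel [1(M < W)]: its two conditional means over an
    independent copy, evaluated at the maximum and at the order statistic of the same block. The
    series [Y] is a parameter so that the formula can also be read on the path space, where
    stationarity is available. *)
Definition projection_term {T : Type} (Y : int -> T -> R) j p w :=
  order_stat_sf j (block_max Y b p w) + block_max_cdf (block_order_stat Y b j p w).

(** Having exactly [j.+1] exceedances means having at least [j.+1] but not at least [j.+2], hence
    the difference. The coefficients [c] are those of the linear combination under study. *)
Definition projection {T : Type} (Y : int -> T -> R) p w :=
  \sum_(j < m) c j * (projection_term Y j.+1 p w - projection_term Y j.+2 p w).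

Let V := Ytr P X eps.

Lemma stationary_Ytr : strictly_stationary P V.
Proof.
apply: (stationary_comp (v := fun x => Fcdf P X x * (if 1 - eps < Fcdf P X x then 1 else 0))) => //.
exact: (measurableT_comp (measurable_trunc eps) (measurable_Fcdf P mX)).
Qed.

Let mV s : measurable_fun setT (V s). Proof. exact: measurable_Ytr. Qed.

Let mM p : measurable_fun setT (block_max V b p).
Proof. exact: measurable_block_max. Qed.

Let mW j p : measurable_fun setT (block_order_stat V b j p).
Proof. exact: measurable_block_order_stat. Qed.

Lemma measurable_order_stat_sf j : measurable_fun setT (order_stat_sf j).
Proof.
apply: nonincreasing_measurable => // x y xy; apply: Pr_le; [exact: measurable_gt..|].
by move=> w /=; exact: le_lt_trans.
Qed.

Lemma measurable_block_max_cdf : measurable_fun setT block_max_cdf.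
Proof. by apply: nondecreasing_measurable => // x y xy; exact: Pr_ltl_cdf. Qed.

Lemma projection_term_bound {T : Type} (Y : int -> T -> R) j p w :
  0 <= projection_term Y j p w <= 2.
Proof.
rewrite addr_ge0 ?Pr_ge0//= (_ : 2 = 1 + 1 :> R)// lerD// Pr_le1//.
  exact: measurable_gt.
exact: measurable_ltf.
Qed.

(** The summand 1 keeps the bound positive when all coefficients vanish; the variance estimate
    divides by it. *)
Definition coef_bound : R := 2 * \sum_(j < m) `|c j| + 1.
Local Notation B := coef_bound.

Lemma projection_bound {T : Type} (Y : int -> T -> R) p w : `|projection Y p w| <= B.
Proof.
apply: (@le_trans _ _ (\sum_(j < m) 2 * `|c j|)); last by rewrite -mulr_sumr lerDl.
apply: (le_trans (ler_norm_sum _ _ _)); apply: ler_sum => j _.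
rewrite normrM mulrC ler_wpM2r// ler_norml.
have /andP[? ?] := projection_term_bound Y j.+1 p w.
have /andP[? ?] := projection_term_bound Y j.+2 p w.
by apply/andP; split; lra.
Qed.

Lemma measurable_projection_term {d'} {T : measurableType d'} (Y : int -> T -> R) j p :
  (forall u, (u < b)%N -> measurable_fun setT (Y (p.+1%:Z + u%:Z))) ->
  measurable_fun setT (projection_term Y j p).
Proof.
move=> mY; apply: measurable_funD.
  by apply: measurableT_comp; [exact: measurable_order_stat_sf|exact: measurable_block_max].
by apply: measurableT_comp; [exact: measurable_block_max_cdf|exact: measurable_block_order_stat].
Qed.

Lemma measurable_projection {d'} {T : measurableType d'} (Y : int -> T -> R) p :
  (forall u, (u < b)%N -> measurable_fun setT (Y (p.+1%:Z + u%:Z))) ->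
  measurable_fun setT (projection Y p).
Proof.
move=> mY; apply: measurable_sum => j; apply: measurable_funM; first exact: measurable_cst.
by apply: measurable_funB; exact: measurable_projection_term.
Qed.

Lemma bm_projection {d'} {T : measurableType d'} (Y : int -> T -> R) p :
  (forall s, measurable_fun setT (Y s)) -> bm (projection Y p).
Proof.
move=> mY; split; last by exists B; exact: projection_bound.
by apply: measurable_projection => u _.
Qed.

Lemma projection_shift {T : Type} (Y : int -> T -> R) p h w :
  projection Y (p + h) w = projection (fun s => Y (s + h%:Z)) p w.
Proof.
apply: eq_bigr => j _; rewrite /projection_term !block_max_shift.
by rewrite !block_order_stat_shift.
Qed.

Definition projection_mean := Ex P (projection V 0).
Local Notation mu := projection_mean.
Let a := alpha_eps P X eps b.

(** The probability of [M < W] for independent [M] and [W]. Both conditional means in the projection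
    have this expectation, so it has to be subtracted once. *)
Definition comparison_mean j := Ex P (fun w => block_max_cdf (block_order_stat V b j 0 w)).
Definition comparison_constant := \sum_(j < m) c j * (comparison_mean j.+1 - comparison_mean j.+2).
Local Notation eta := comparison_constant.

Lemma alpha_eps_ge0 : 0 <= a.
Proof.
have T0 I : sigB P X eps I set0 by exact: sigma_algebra0.
exact: le_trans (normr_ge0 _) (alpha_eps_bound mX (ltnSn 0) (T0 _) (T0 _)).
Qed.

(** The functional [f] is polymorphic in the sample space: evaluated at the coordinates of the path
    space, it gives one measurable set of paths, whose probability stationarity makes independent of
    the shift. *)
Lemma block_law (f : forall T : Type, (int -> T -> R) -> nat -> T -> R) p (C : set R) :
  (forall d' (T : measurableType d') (Y : int -> T -> R) q,
    (forall s, measurable_fun setT (Y s)) -> measurable_fun setT (@f T Y q)) ->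
  (forall w, @f Omega V p w = @f (int -> R) (fun s x => x s) 0%N (shifted_path V p%:Z w)) ->
  (forall w, @f Omega V 0%N w = @f (int -> R) (fun s x => x s) 0%N (shifted_path V 0 w)) ->
  measurable C ->
  Pr P [set w | C (@f Omega V p w)] = Pr P [set w | C (@f Omega V 0%N w)].
Proof.
move=> mf fp f0 mC.
pose A : set path_space := [set x | C (@f (int -> R) (fun s x => x s) 0%N x)].
have mA : measurable A.
  apply: (measurable_preim (f := @f path_space (fun s x => x s) 0%N)) => //.
  by apply: mf => s; exact: measurable_coordinate.
have := stationary_law mV stationary_Ytr p%:Z mA.
rewrite /Pr => E; congr fine; move: E.
rewrite (_ : [set w | A (shifted_path V p%:Z w)] = [set w | C (@f Omega V p w)]); last first.
  by apply/seteqP; split => w /=; rewrite fp.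
by move=> ->; congr (P _); apply/seteqP; split => w /=; rewrite f0.
Qed.

Lemma block_max_law p C : measurable C ->
  Pr P [set w | C (block_max V b p w)] = Pr P [set w | C (block_max V b 0 w)].
Proof.
apply: (block_law (f := fun T Y q => block_max Y b q)).
- by move=> *; exact: measurable_block_max.
- by move=> w; rewrite -[p in LHS]add0n block_max_shift.
- by move=> w; rewrite -[0%N in LHS]add0n block_max_shift.
Qed.

Lemma block_order_stat_law j p C : measurable C ->
  Pr P [set w | C (block_order_stat V b j p w)] = Pr P [set w | C (block_order_stat V b j 0 w)].
Proof.
apply: (block_law (f := fun T Y q => block_order_stat Y b j q)).
- by move=> *; exact: measurable_block_order_stat.
- by move=> w; rewrite -[p in LHS]add0n block_order_stat_shift.
- by move=> w; rewrite -[0%N in LHS]add0n block_order_stat_shift.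
Qed.

Lemma projection_law p C : measurable C ->
  Pr P [set w | C (projection V p w)] = Pr P [set w | C (projection V 0 w)].
Proof.
apply: (block_law (f := fun T Y q => projection Y q)).
- by move=> *; apply: measurable_projection.
- by move=> w; rewrite -[p in LHS]add0n projection_shift.
- by move=> w; rewrite -[0%N in LHS]add0n projection_shift.
Qed.

Lemma Ex_projection p : Ex P (projection V p) = mu.
Proof.
rewrite /projection_mean.
have bphi : bm (fun x : path_space => projection (fun s x => x s) 0%N x).
  by apply: (@bm_projection _ path_space (fun s x => x s)); exact: measurable_coordinate.
have := stationary_Ex mV stationary_Ytr p%:Z bphi.
rewrite (_ : (fun w => _) = projection V p); last first.
  by apply/funext => w; rewrite -[p in RHS]add0n projection_shift.
move=> ->; congr Ex; apply/funext => w.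
by rewrite -[0%N in RHS]add0n projection_shift.
Qed.

Definition near_blocks (pos : nat -> nat) : rel nat :=
  [rel i j | (pos i < pos j + 2 * b)%N && (pos j < pos i + 2 * b)%N].

Let blk p := [set s : int | p.+1%:Z <= s <= (p + b)%:Z].

Let mVblk p u : (u < b)%N ->
  measurable_fun setT (V (p.+1%:Z + u%:Z) : truncated_space P X eps (blk p) -> R).
Proof. by move=> ub; apply: measurable_Ytr_truncated => /=; apply/andP; split; lia. Qed.

Let far_blocks (pos : nat -> nat) i j (f g : nat -> Omega -> R) (C D : set R) :
  (forall p, measurable_fun setT (f p : truncated_space P X eps (blk p) -> R)) ->
  (forall p, measurable_fun setT (g p : truncated_space P X eps (blk p) -> R)) ->
  (forall p, Pr P [set w | C (f p w)] = Pr P [set w | C (f 0%N w)]) ->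
  (forall p, Pr P [set w | D (g p w)] = Pr P [set w | D (g 0%N w)]) ->
  ~~ near_blocks pos i j -> measurable C -> measurable D ->
  Pr P [set w | C (f (pos i) w) /\ D (g (pos j) w)] <=
  Pr P [set w | C (f 0%N w)] * Pr P [set w | D (g 0%N w)] + a.
Proof.
move=> mf mg lf lg; rewrite /near_blocks /= negb_and -!leqNgt => /orP[] far mC mD.
  have := truncated_blocks_mixing mX b0 far mD mC (mg (pos j)) (mf (pos i)).
  rewrite lf lg (_ : [set w | _ /\ _] = [set w | C (f (pos i) w) /\ D (g (pos j) w)]); last first.
    by apply/seteqP; split => w /= [].
  by rewrite ler_norml => /andP[_]; rewrite -/a [_ * Pr P [set w | C _]]mulrC; lra.
have := truncated_blocks_mixing mX b0 far mC mD (mf (pos i)) (mg (pos j)).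
by rewrite lf lg ler_norml => /andP[_]; rewrite -/a; lra.
Qed.

Variables (N : nat) (pos : nat -> nat) (rho : R).
Hypothesis N0 : (0 < N)%N.
Hypothesis pos0 : pos 0%N = 0%N.
Hypothesis hnear : avg N (fun i => avg N (fun j => (near_blocks pos i j)%:R)) <= rho.

Definition comparison_error (K : nat) (lam : R) : R :=
  4 * K%:R^-1 + (K.+1 * 2)%:R * a + rho + lam * (rho + (K.+1 * 2)%:R * a)
   + lam^-1 * ((K.+1 * 2)%:R * (rho + a)).

Lemma single_linearization j (K : nat) (lam : R) : (0 < K)%N -> 0 < lam ->
  Ex P (fun w => `|avg N (fun i => avg N (fun i' =>
      (block_max V b (pos i) w < block_order_stat V b j (pos i') w)%R%:R)) -
    (avg N (fun i => projection_term V j (pos i) w) - comparison_mean j)|) <= comparison_error K lam.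
Proof.
move=> K0 lam0.
have mMb p : measurable_fun setT (block_max V b p : truncated_space P X eps (blk p) -> R).
  by apply: measurable_block_max => // u; exact: mVblk.
have mWb p : measurable_fun setT (block_order_stat V b j p : truncated_space P X eps (blk p) -> R).
  by apply: measurable_block_order_stat => // u; exact: mVblk.
have := @cross_comparison_quantile _ _ _ P (fun i => block_max V b (pos i))
  (fun i => block_order_stat V b j (pos i)) N (near_blocks pos) rho a N0 alpha_eps_ge0.
rewrite pos0; apply => //.
- by move=> i C mC; rewrite block_max_law.
- by move=> i C mC; rewrite block_order_stat_law.
- move=> i i' C D _ _ nij mC mD.
  exact: (far_blocks mMb mMb (fun p => block_max_law p mC) (fun p => block_max_law p mD) nij mC mD).
- move=> i i' C D _ _ nij mC mD.
  exact: (far_blocks mWb mWb (fun p => block_order_stat_law j p mC)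
    (fun p => block_order_stat_law j p mD) nij mC mD).
- move=> i i' C D _ _ nij mC mD.
  exact: (far_blocks mMb mWb (fun p => block_max_law p mC)
    (fun p => block_order_stat_law j p mD) nij mC mD).
Qed.

Definition block_kernel i i' w : R :=
  \sum_(j < m) c j * (bcnt V (pos i').+1%:Z b (bmax V (pos i).+1%:Z b w) w == j.+1)%:R.

Lemma block_kernelE i i' w : block_kernel i i' w = \sum_(j < m) c j *
  ((block_max V b (pos i) w < block_order_stat V b j.+1 (pos i') w)%R%:R
   - (block_max V b (pos i) w < block_order_stat V b j.+2 (pos i') w)%R%:R).
Proof.
apply: eq_bigr => j _; congr (_ * _).
have M0 : 0 <= block_max V b (pos i) w.
  by apply: block_max_ge0 => s; exact: (Ytr_ge0 P mX).
rewrite !block_order_statP// -/(block_max V b (pos i) w).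
by case: (ltngtP _ j.+1) => _; rewrite ?subrr ?subr0.
Qed.

Lemma block_kernel_bound i i' w : `|block_kernel i i' w| <= B.
Proof.
apply: (@le_trans _ _ (\sum_(j < m) `|c j|)).
  apply: le_trans (ler_norm_sum _ _ _) _; apply: ler_sum => j _.
  by rewrite normrM; case: (_ == _); rewrite ?normr1 ?normr0 ?mulr1 ?mulr0.
have : 0 <= \sum_(j < m) `|c j| by rewrite sumr_ge0.
by rewrite /coef_bound; lra.
Qed.

Lemma bm_block_kernel i i' : bm (block_kernel i i').
Proof.
apply: (bm_ext (fun w => esym (block_kernelE i i' w))).
have bi j : bm (fun w => (block_max V b (pos i) w < block_order_stat V b j (pos i') w)%R%:R : R).
  apply: bm_bool; have /(_ measurableT [set true]) :=
    measurable_fun_ltr (mM (pos i)) (mW j (pos i')).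
  by rewrite setTI; apply.
by apply: bm_sum => j; apply: bmZ; exact: bmB.
Qed.

Lemma linearization (K : nat) (lam : R) : (0 < K)%N -> 0 < lam ->
  Ex P (fun w => `|avg N (fun i => avg N (fun i' => block_kernel i i' w)) -
    (avg N (fun i => projection V (pos i) w) - eta)|) <= B * comparison_error K lam.
Proof.
move=> K0 lam0; have err := fun j => single_linearization j K0 lam0.
pose dlt j w := `|avg N (fun i => avg N (fun i' =>
      (block_max V b (pos i) w < block_order_stat V b j (pos i') w)%R%:R)) -
    (avg N (fun i => projection_term V j (pos i) w) - comparison_mean j)|.
have bi i i' j : bm (fun w => (block_max V b (pos i) w < block_order_stat V b j (pos i') w)%R%:R : R).
  apply: bm_bool; have /(_ measurableT [set true]) :=
    measurable_fun_ltr (mM (pos i)) (mW j (pos i')).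
  by rewrite setTI; apply.
have bterm j p : bm (projection_term V j p).
  split; first exact: measurable_projection_term.
  exists 2 => w; have /andP[? ?] := projection_term_bound V j p w; by rewrite ger0_norm.
have bd j : bm (dlt j).
  apply: bm_norm; apply: bmB; first by apply: bm_avg => i; exact: bm_avg.
  by apply: bmB; [exact: bm_avg|exact: bm_cst].
apply: (@le_trans _ _ (Ex P (fun w => \sum_(j < m) `|c j| * (dlt j.+1 w + dlt j.+2 w)))).
  apply: Ex_le => [||w].
  - apply: bm_norm; apply: bmB.
      by apply: bm_avg => i; apply: bm_avg => i'; exact: bm_block_kernel.
    by apply: bmB; [apply: bm_avg => i; exact: bm_projection|exact: bm_cst].
  - by apply: bm_sum => j; apply: bmZ; exact: bmD.
  have -> : avg N (fun i => avg N (fun i' => block_kernel i i' w)) = \sum_(j < m) c j *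
      (avg N (fun i => avg N (fun i' => (block_max V b (pos i) w < block_order_stat V b j.+1 (pos i') w)%R%:R))
       - avg N (fun i => avg N (fun i' => (block_max V b (pos i) w < block_order_stat V b j.+2 (pos i') w)%R%:R))).
    under eq_bigr do rewrite -avgB -avgZ.
    rewrite -avg_sum; apply: eq_avg => i _; under eq_bigr do rewrite -avgB -avgZ.
    by rewrite -avg_sum; apply: eq_avg => i' _; rewrite block_kernelE.
  have -> : avg N (fun i => projection V (pos i) w) = \sum_(j < m) c j *
      (avg N (fun i => projection_term V j.+1 (pos i) w) - avg N (fun i => projection_term V j.+2 (pos i) w)).
    under eq_bigr do rewrite -avgB -avgZ.
    by rewrite -avg_sum.
  rewrite /comparison_constant -!sumrB; apply: le_trans (ler_norm_sum _ _ _) _; apply: ler_sum => j _.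
  rewrite -!mulrBr normrM ler_wpM2l// /dlt.
  by apply: le_trans (ler_normB _ _); rewrite le_eqVlt; apply/orP; left; apply/eqP; congr (`|_|); rewrite /avg; ring.
rewrite Ex_sum => [|j]; last by apply: bmZ; exact: bmD.
(* Two order statistics per coefficient: this is the factor 2 in [coef_bound]. *)
apply: (@le_trans _ _ (\sum_(j < m) `|c j| * (2 * comparison_error K lam))).
  apply: ler_sum => j _; rewrite ExZ ?ExD//; last exact: bmD.
  by rewrite ler_wpM2l// mulr_natl mulr2n lerD// err.
rewrite -mulr_suml mulrA ler_wpM2r//; last by rewrite /coef_bound; lra.
by apply: le_trans (err 0%N); apply: Ex_ge0.
Qed.

Lemma projection_variance :
  Ex P (fun w => (avg N (fun i => projection V (pos i) w) - mu) ^+ 2) <= 4 * B ^+ 2 * (rho + a).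
Proof.
have B1 : 1 <= B by rewrite /coef_bound lerDr mulr_ge0// sumr_ge0.
have B0 : 0 < B by apply: lt_le_trans B1.
(* Affine rescaling into [[0, 1]], the range in which covariances are controlled by those of events.
   Undoing it multiplies the variance by [(2 * B) ^ 2]. *)
pose u p w := (2 * B)^-1 * (projection V p w + B).
have mub p : measurable_fun setT (u p : truncated_space P X eps (blk p) -> R).
  apply: measurable_funM; first exact: measurable_cst.
  apply: measurable_funD; last exact: measurable_cst.
  by apply: measurable_projection => v; exact: mVblk.
have mu' p : measurable_fun setT (u p).
  apply: measurable_funM; first exact: measurable_cst.
  by apply: measurable_funD; [exact: (bm_projection p mV).1|exact: measurable_cst].
have u01 p w : 0 <= u p w <= 1.
  have := projection_bound V p w; rewrite ler_norml => /andP[? ?].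
  rewrite /u mulrC; apply/andP; split; first by rewrite divr_ge0//; lra.
  by rewrite ler_pdivrMr; lra.
have bu p : bm (u p).
  by split => //; exists 1 => w; have /andP[? ?] := u01 p w; rewrite ger0_norm.
have ulaw p C : measurable C -> Pr P [set w | C (u p w)] = Pr P [set w | C (u 0%N w)].
  move=> mC; apply: (projection_law p (C := [set x | C ((2 * B)^-1 * (x + B))])).
  rewrite -[X in measurable X]setTI; have : measurable_fun setT (fun x : R => (2 * B)^-1 * (x + B)).
    apply: measurable_funM; first exact: measurable_cst.
    by apply: measurable_funD; [exact: measurable_id|exact: measurable_cst].
  by move=> /(_ measurableT C mC).
have Eu p : Ex P (u p) = (2 * B)^-1 * (mu + B).
  rewrite ExZ; last by apply: bmD; [exact: bm_projection|exact: bm_cst].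
  by rewrite ExD ?Ex_cst ?Ex_projection//; [exact: bm_projection|exact: bm_cst].
have mgt (x : R) : measurable [set y : R | x < y].
  by apply: is_interval_measurable => y z /= xy _ t /andP[yt _]; exact: lt_le_trans yt.
have key : Ex P (fun w => (avg N (fun i => u (pos i) w) - (2 * B)^-1 * (mu + B)) ^+ 2) <= rho * 1 + a.
  apply: (variance_mean (near := near_blocks pos) (q := 1)) => //.
  - exact: alpha_eps_ge0.
  - move=> i j _ _; rewrite -[leRHS](Ex_cst P) Ex_le//; [exact: bmM|exact: bm_cst|].
    by move=> w; have /andP[? ?] := u01 (pos i) w; have /andP[? ?] := u01 (pos j) w; rewrite mulr_ile1.
  - move=> i j iN jN nij; rewrite expr2.
    rewrite -{1}(Eu (pos i)) -(Eu (pos j)); apply: covariance_layers => // x y.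
    have lC p := ulaw p _ (mgt x); have lD p := ulaw p _ (mgt y).
    by have := far_blocks mub mub lC lD nij (mgt x) (mgt y); rewrite /= -(lC (pos i)) -(lD (pos j)).
have -> : (fun w => (avg N (fun i => projection V (pos i) w) - mu) ^+ 2) =
    (fun w => (2 * B) ^+ 2 * (avg N (fun i => u (pos i) w) - (2 * B)^-1 * (mu + B)) ^+ 2).
  apply/funext => w; rewrite -exprMn; congr (_ ^+ 2).
  rewrite avgZ avgD avg_cst// mulrBr !mulrA mulfV ?mul1r; last by rewrite gt_eqF// mulr_gt0.
  by ring.
rewrite ExZ; last by apply: bmX; apply: bmB; [exact: bm_avg|exact: bm_cst].
have -> : 4 * B ^+ 2 * (rho + a) = (2 * B) ^+ 2 * (rho * 1 + a) by ring.
by rewrite ler_wpM2l// sqr_ge0.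
Qed.

End Linearization.

(** * From sliding to disjoint blocks *)

Section Counting.
Context {R : realType}.

Lemma window_count (N lo c : nat) : \sum_(j < N) ((lo <= j < lo + c)%N)%:R <= c%:R :> R.
Proof.
elim: c => [|c IH]; first by rewrite big1// => j _; rewrite (_ : (_ && _) = false)//; lia.
have one : \sum_(j < N) (nat_of_ord j == (lo + c)%N)%:R <= 1 :> R.
  case: (ltnP (lo + c) N) => [lt|le].
    rewrite (bigD1 (Ordinal lt))//= eqxx big1 ?addr0// => j jn.
    by case: eqP => // je; case/eqP: jn; exact: val_inj.
  by rewrite big1// => j _; case: eqP => // je; have := ltn_ord j; rewrite je ltnNge le.
rewrite -natr1; apply: le_trans (lerD IH one); rewrite -big_split /=.
apply: ler_sum => j _; rewrite -natrD ler_nat.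
case: (boolP (lo <= j < lo + c.+1)%N) => //= jc.
by case: (boolP (lo <= j < lo + c)%N) => //= jc'; rewrite (_ : (_ == _) = true)//; apply/eqP; lia.
Qed.

Lemma near_fraction (N c : nat) (near : rel nat) (lo : nat -> nat) :
  (forall i j, near i j -> (lo i <= j < lo i + c)%N) ->
  avg N (fun i => avg N (fun j => (near i j)%:R)) <= c%:R / N%:R :> R.
Proof.
move=> nearlo.
have [->|N0] := posnP N; first by rewrite /avg invr0 mul0r mulr0.
rewrite -[leRHS](avg_cst _ N0); apply: ler_avg => i _; rewrite /avg mulrC.
rewrite ler_wpM2r// (le_trans _ (window_count N (lo i) c))//; apply: ler_sum => j _.
by rewrite ler_nat; case: (boolP (near i j)) => // /nearlo ->.
Qed.

Lemma avg_prefix (N N' : nat) (f : nat -> R) (B : R) : (0 < N')%N -> (N' <= N)%N ->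
  (forall i, `|f i| <= B) -> `|avg N f - avg N' f| <= 2 * B * ((N - N')%:R / N%:R).
Proof.
move=> N'0 N'N fB.
have B0 : 0 <= B by exact: le_trans (fB 0%N).
have NR : 0 < N%:R :> R by rewrite ltr0n; lia.
have N'R : 0 < N'%:R :> R by rewrite ltr0n.
have sB (M : nat) (g : nat -> R) : (forall i, `|g i| <= B) -> `|\sum_(i < M) g i| <= M%:R * B.
  move=> gB; apply: le_trans (ler_norm_sum _ _ _) _.
  by rewrite -sum_cst; apply: ler_sum.
have SE : \sum_(i < N) f i = \sum_(i < N') f i + \sum_(i < N - N') f (N' + i)%N.
  rewrite -[in LHS](subnKC N'N) big_split_ord /=.
  by congr (_ + _); apply: eq_bigr.
set dl := (N - N')%:R / N%:R.
have dlE : N%:R^-1 * N'%:R = 1 - dl.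
  by rewrite /dl natrB// mulrBl mulfV ?gt_eqF// [N'%:R / _]mulrC; ring.
have -> : avg N f - avg N' f =
    N%:R^-1 * (\sum_(i < N - N') f (N' + i)%N) - dl * (N'%:R^-1 * \sum_(i < N') f i).
  rewrite /avg SE mulrDr.
  have -> : N%:R^-1 * (\sum_(i < N') f i) = (1 - dl) * (N'%:R^-1 * \sum_(i < N') f i).
    by rewrite -dlE -!mulrA [N'%:R * _]mulrA mulfV ?gt_eqF// mul1r.
  by ring.
have h1 : `|N%:R^-1 * (\sum_(i < N - N') f (N' + i)%N)| <= dl * B.
  rewrite normrM gtr0_norm ?invr_gt0// mulrC ler_pdivrMr// /dl mulrAC divfK ?gt_eqF//.
  exact: (sB _ (fun i => f (N' + i)%N)).
have dl0 : 0 <= dl by rewrite divr_ge0.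
have h2 : `|dl * (N'%:R^-1 * \sum_(i < N') f i)| <= dl * B.
  rewrite normrM ger0_norm// ler_wpM2l// normrM gtr0_norm ?invr_gt0//.
  by rewrite mulrC ler_pdivrMr// mulrC; exact: sB.
by apply: le_trans (ler_normB _ _) _; lra.
Qed.

Lemma avg_interleave (b k : nat) (f : nat -> R) :
  avg (k * b) f = avg b (fun r => avg k (fun j => f (r + j * b)%N)).
Proof.
rewrite /avg -mulr_sumr mulrA -invfM -natrM mulnC; congr (_ * _).
rewrite exchange_big /= mulnC; elim: k => [|k IH]; first by rewrite !big_ord0.
rewrite big_ord_recr /= -IH mulSnr big_split_ord /=; congr (_ + _).
by apply: eq_bigr => r _; rewrite addnC.
Qed.

Lemma pos_part_lipschitz (x y : R) : Num.max x 0 <= Num.max y 0 + `|x - y|.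
Proof.
rewrite ge_max; apply/andP; split; last by rewrite addr_ge0// le_max lexx orbT.
have : y <= Num.max y 0 by rewrite le_max lexx.
have := ler_norm (x - y); lra.
Qed.

Lemma pos_part_avg (N : nat) (f : nat -> R) :
  Num.max (avg N f) 0 <= avg N (fun i => Num.max (f i) 0).
Proof.
rewrite ge_max; apply/andP; split; first by apply: ler_avg => i _; rewrite le_max lexx.
by rewrite /avg mulr_ge0// sumr_ge0// => i _; rewrite le_max lexx orbT.
Qed.

End Counting.

Section SlidingConvexity.
Context {R : realType} {d} {Omega : measurableType d} (P : probability Omega R).
Local Notation bm := bounded_measurable.
Variables (X : int -> Omega -> R) (eps : R) (b m : nat) (c : nat -> R).
Hypothesis mX : forall t, measurable_fun setT (X t).
Hypothesis statX : strictly_stationary P X.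
Hypothesis b0 : (0 < b)%N.

Let V := Ytr P X eps.
Local Notation B := (coef_bound m c).
Let f (p : nat) (w : Omega) := projection P X eps b m c V p w.
Let mV s : measurable_fun setT (V s). Proof. exact: measurable_Ytr. Qed.

(* Up to a boundary term the average over sliding blocks is the average, over the [b] possible shifts,
   of averages over disjoint blocks, which are equal in law; Jensen's inequality concludes. *)
Lemma sliding_convexity (k N : nat) (s mu z : R) :
  0 <= s -> (1 < k)%N -> (k.-1 * b <= N)%N -> (N <= k * b)%N ->
  Ex P (fun w => Num.max (s * (avg N (fun i => f i w) - mu) + z) 0) <=
  Ex P (fun w => Num.max (s * (avg k (fun i => f (i * b)%N w) - mu) + z) 0) + 8 * B * (s / k%:R).
Proof.
move=> s0 k1 N1 N2.
have k'0 : (0 < k.-1)%N by lia.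
have kR : 0 < k%:R :> R by rewrite ltr0n; lia.
have bf p : bm (f p) by apply: bm_projection.
have fB p w : `|f p w| <= B by exact: projection_bound.
have B0 : 0 <= B by rewrite addr_ge0// mulr_ge0// sumr_ge0.
have bg (h : Omega -> R) : bm h -> bm (fun w => Num.max (s * (h w - mu) + z) 0).
  move=> bh; apply: bm_max; last exact: bm_cst.
  by apply: bmD; [apply: bmZ; apply: bmB => //; exact: bm_cst|exact: bm_cst].
have lip (h1 h2 : Omega -> R) e : bm h1 -> bm h2 -> (forall w, `|h1 w - h2 w| <= e) ->
    Ex P (fun w => Num.max (s * (h1 w - mu) + z) 0) <=
    Ex P (fun w => Num.max (s * (h2 w - mu) + z) 0) + s * e.
  move=> bh1 bh2 he; rewrite -(Ex_cst P (s * e)) -ExD; [|exact: bg|exact: bm_cst].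
  apply: Ex_le => [||w]; [exact: bg|by apply: bmD; [exact: bg|exact: bm_cst]|].
  apply: le_trans (pos_part_lipschitz _ (s * (h2 w - mu) + z)) _; rewrite lerD2l.
  rewrite (_ : _ - _ = s * (h1 w - h2 w)); last by ring.
  by rewrite normrM ger0_norm// ler_wpM2l.
(* The number of sliding blocks is between [k.-1 * b] and [k * b]. Keeping the first [k.-1 * b], a
   multiple of [b], drops at most [b] of them, a fraction of at most [2 / k]. Going back from [k.-1]
   to [k] disjoint blocks at the end costs the same. *)
have step1 : Ex P (fun w => Num.max (s * (avg N (fun i => f i w) - mu) + z) 0) <=
    Ex P (fun w => Num.max (s * (avg (k.-1 * b) (fun i => f i w) - mu) + z) 0) + s * (4 * B / k%:R).
  apply: lip => [||w]; [exact: bm_avg..|].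
  have N'0 : (0 < k.-1 * b)%N by rewrite muln_gt0 k'0.
  apply: le_trans (avg_prefix N'0 N1 (fun i => fB i w)) _.
  rewrite (_ : 4 * B / k%:R = 2 * B * (2 / k%:R)); last by ring.
  rewrite ler_wpM2l ?mulr_ge0// ler_pdivlMr// -mulrA [_^-1 * _]mulrC mulrA ler_pdivrMr ?ltr0n; last by lia.
  rewrite -!natrM ler_nat.
  have kE : k = k.-1.+1 by lia.
  move: N1 N2 k'0; rewrite kE /=; move: k.-1 => q; nia.
have step2 : Ex P (fun w => Num.max (s * (avg (k.-1 * b) (fun i => f i w) - mu) + z) 0) <=
    Ex P (fun w => Num.max (s * (avg k.-1 (fun j => f (j * b)%N w) - mu) + z) 0).
  pose g r w := Num.max (s * (avg k.-1 (fun j => f (r + j * b)%N w) - mu) + z) 0.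
  have bgr r : bm (g r) by apply: bg; exact: bm_avg.
  have gE r : Ex P (g r) = Ex P (g 0%N).
    pose phi (x : path_space) := Num.max (s * (avg k.-1 (fun j =>
      projection P X eps b m c (fun s x => x s) (j * b)%N x) - mu) + z) 0.
    have bphi : bm phi.
      apply: bm_max; last exact: bm_cst.
      apply: bmD; last exact: bm_cst.
      apply: bmZ; apply: bmB; last exact: bm_cst.
      apply: bm_avg => j; apply: (@bm_projection R d Omega P X eps b m c mX b0 _ path_space (fun s x => x s)).
      exact: measurable_coordinate.
    have gphi q : g q = fun w => phi (shifted_path V q%:Z w).
      apply/funext => w; rewrite /g /phi; congr (Num.max (s * (_ - _) + _) _).
      by apply: eq_avg => j _; rewrite /f addnC projection_shift.
    have statV : strictly_stationary P V by exact: stationary_Ytr.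
    by rewrite !gphi (stationary_Ex mV statV r%:Z bphi).
  have -> : Ex P (fun w => Num.max (s * (avg k.-1 (fun j => f (j * b)%N w) - mu) + z) 0) =
      avg b (fun r => Ex P (g r)).
    by rewrite -[LHS](avg_cst _ b0); apply: eq_avg => r _; rewrite gE.
  rewrite -Ex_avg//; apply: Ex_le => [||w]; [by apply: bg; exact: bm_avg|exact: bm_avg|].
  apply: le_trans (pos_part_avg _ _).
  rewrite le_eqVlt; apply/orP; left; apply/eqP; congr (Num.max _ 0).
  by rewrite avg_interleave avgD avgZ avgB !avg_cst.
have step3 : Ex P (fun w => Num.max (s * (avg k.-1 (fun j => f (j * b)%N w) - mu) + z) 0) <=
    Ex P (fun w => Num.max (s * (avg k (fun i => f (i * b)%N w) - mu) + z) 0) + s * (4 * B / k%:R).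
  apply: lip => [||w]; [exact: bm_avg..|].
  rewrite distrC; apply: le_trans (avg_prefix k'0 (leq_pred k) (fun i => fB (i * b)%N w)) _.
  rewrite (_ : 4 * B / k%:R = 2 * B * (2 / k%:R)); last by ring.
  rewrite ler_wpM2l ?mulr_ge0// ler_pM2r ?invr_gt0// (ler_nat R _ 2); lia.
have -> : 8 * B * (s / k%:R) = s * (4 * B / k%:R) + s * (4 * B / k%:R) by ring.
by rewrite addrA; apply: (le_trans step1); rewrite lerD2r; exact: le_trans step2 step3.
Qed.

End SlidingConvexity.

(** * Truncation *)

Lemma bmax_attained {R : realType} {T : Type} (Y : int -> T -> R) a len w : (0 < len)%N ->
  exists2 u, (u < len)%N & bmax Y a len w = Y (a + u%:Z) w /\
    forall v, (v < len)%N -> Y (a + v%:Z) w <= Y (a + u%:Z) w.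
Proof.
move=> len0; have [u ulen uE] : exists2 u, (u < len)%N & bmax Y a len w = Y (a + u%:Z) w.
  rewrite /bmax; elim/big_ind: _.
  - by exists 0%N => //; rewrite addr0.
  - move=> x y [u ul ->] [v vl ->]; have [_|_] := leP (Y (a + u%:Z) w) (Y (a + v%:Z) w).
      by exists v.
    by exists u.
  - by move=> u _; exists u.
exists u => //; split => // v vl; rewrite -uE.
exact: (le_bigmax _ (fun u : 'I_len => Y (a + u%:Z) w) (Ordinal vl)).
Qed.

Section Truncation.
Context {R : realType} {d} {Omega : measurableType d} (P : probability Omega R).
Variables (X : int -> Omega -> R) (eps : R).
Hypothesis mX : forall t, measurable_fun setT (X t).
Hypothesis statX : strictly_stationary P X.
Let U := Uv P X.
Let V := Ytr P X eps.
Let F := Fcdf P X.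

Lemma stationary_cdf s x : Pr P [set w | X s w <= x] = F x.
Proof.
have mB : measurable [set y : R | y <= x].
  by apply: is_interval_measurable => y z /= _ zx t /andP[_ tz]; exact: le_trans tz zx.
have S t : [set w | X t w <= x] = [set w | forall i : nat, (i < 1)%N -> [set y | y <= x] (X t w)].
  by apply/seteqP; split => w /= H; [move=> _ _|exact: (H 0%N (ltnSn _))].
have := statX s 1 (fun=> 0) (B := fun=> [set y | y <= x]) (fun=> mB).
by rewrite /= add0r => E; rewrite /F /Fcdf /Pr !S E.
Qed.

Lemma Fcdf_mono x y : x <= y -> F x <= F y.
Proof. by move=> xy; exact: Pr_ler_cdf. Qed.

(** Here [X s] falls into a flat stretch of the cdf starting at [q]. The down-set [F x <= F q] has
    probability at most [F q], which the ray up to [q] already exhausts. *)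
Lemma flat_null s q : P [set w | q < X s w /\ F (X s w) <= F q] = 0%E.
Proof.
pose A := [set x | F x <= F q].
have mA : measurable A.
  apply: is_interval_measurable => x y _ Ay z /andP[_ zy].
  exact: le_trans (Fcdf_mono zy) Ay.
have F0 : 0 <= F q by exact: Pr_ge0.
have PA : Pr P [set w | A (X s w)] <= F q.
  apply: down_set_prob => //.
    by move=> x y Ay xy; exact: le_trans (Fcdf_mono xy) Ay.
  by move=> x; rewrite stationary_cdf.
have mXA := measurable_preim (mX s) mA.
have mq : measurable [set w | q < X s w] by exact: measurable_gt.
rewrite (_ : [set w | _] = [set w | A (X s w)] `\` [set w | X s w <= q]); last first.
  apply/seteqP; split => w /= [h1 h2]; split => //; first by apply/negP; rewrite -ltNge.
  by rewrite ltNge; apply/negP.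
have mle : measurable [set w | X s w <= q] by exact: measurable_lef.
rewrite measureD//; last by have := probability_le1 P mXA => /le_lt_trans; apply; rewrite ltry.
rewrite (_ : _ `&` _ = [set w | X s w <= q]); last first.
  by apply/seteqP; split => w /= [] // h; split => //; exact: Fcdf_mono.
transitivity ((Pr P [set w | A (X s w)])%:E - (Pr P [set w | X s w <= q])%:E)%E.
  by congr (_ - _)%E; exact: Pr_fin.
rewrite -EFinB stationary_cdf; congr EFin; apply/eqP.
rewrite subr_eq0 eq_le PA -(stationary_cdf s); apply: Pr_le => // w /= ?; exact: Fcdf_mono.
Qed.

(** A flat stretch of [F] may turn a strict inequality between values of [X] into a tie for [U]. A
    rational between the two values places this in one of countably many null events. *)
Lemma cdf_order_null : exists N : set Omega, [/\ measurable N, P N = 0%E &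
  forall w, ~ N w -> forall s t, X t w < X s w -> U t w < U s w].
Proof.
pose G (n : nat) : set Omega := if @unpickle (int * rat)%type n is Some (s, q)
  then [set w | ratr q < X s w /\ F (X s w) <= F (ratr q)] else set0.
have mG n : measurable (G n).
  rewrite /G; case: unpickle => [[s q]|]; last exact: measurable0.
  apply: (measurableI [set w | ratr q < X s w] [set w | F (X s w) <= F (ratr q)]).
    exact: measurable_gt.
  by apply: (measurable_lef (f := fun w => F (X s w))); exact: measurable_Uv.
have G0 n : P (G n) = 0%E.
  by rewrite /G; case: unpickle => [[s q]|]; [exact: flat_null|exact: measure0].
exists (\bigcup_n G n); split.
- exact: bigcup_measurable.
- have : P.-negligible (\bigcup_n G n).
    by apply: negligible_bigcup => k; exists (G k); split; [exact: mG|exact: G0|].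
  by apply: measure_negligible; exact: bigcup_measurable.
- move=> w nN s t ts; rewrite ltNge; apply/negP => Ust.
  have [q] := rat_in_itvoo ts; rewrite in_itv /= => /andP[tq qs].
  have GE : G (pickle (s, q)) = [set w | ratr q < X s w /\ F (X s w) <= F (ratr q)].
    by rewrite /G pickleK.
  apply: nN; exists (pickle (s, q)); [exact: Logic.I|rewrite GE; split; [exact: qs|]].
  by apply: le_trans Ust _; exact: Fcdf_mono (ltW tq).
Qed.

(* The event of condition C (iii), whose probability tends to [0]. *)
Definition empty_half_block (b k : nat) (c : R) : set Omega :=
  [set w | exists i : nat, (1 <= i <= 2 * k)%N /\
     forall s : int, (((i.-1 * b)%:R / 2 + 1 : R) <= (s%:~R : R) <= ((i * b)%:R / 2 : R)) ->
       U s w <= c].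

(** For odd [b] half blocks have half-integer end points; doubling leaves inequalities between
    integers. *)
Lemma half_block_range (x y : nat) (s : int) :
  ((x%:R / 2 + 1 : R) <= (s%:~R : R) <= (y%:R / 2 : R)) <-> (x%:Z + 2 <= 2 * s) /\ (2 * s <= y%:Z).
Proof.
have E1 : (x%:Z + 2 <= 2 * s) = (x%:R + 2 <= 2 * s%:~R :> R).
  by rewrite -(ler_int R) intrD intrM.
have E2 : (2 * s <= y%:Z) = (2 * s%:~R <= y%:R :> R) by rewrite -(ler_int R) intrM.
split; first by move=> /andP[h1 h2]; rewrite E1 E2; split; lra.
by move=> [h1 h2]; rewrite E1 in h1; rewrite E2 in h2; apply/andP; split; lra.
Qed.

Lemma measurable_empty_half_block b k c : measurable (empty_half_block b k c).
Proof.
rewrite (_ : empty_half_block b k c = \bigcup_(i in [set i | (1 <= i <= 2 * k)%N])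
  \bigcap_(j in [set j : nat | (((i.-1 * b)%:R / 2 + 1 : R) <= (j%:Z%:~R : R) <= ((i * b)%:R / 2 : R))])
    [set w | U j%:Z w <= c]).
  apply: bigcup_measurable => i _; apply: bigcap_measurableType => j _.
  by apply: measurable_lef; exact: measurable_Uv.
apply/seteqP; split => w /=.
  by move=> [i [ik H]]; exists i => // j jr; exact: H.
move=> [i ik H]; exists i; split => // s sr.
have [s1 s2] := (half_block_range _ _ _).1 sr.
have sE : s = `|s|%N%:Z by lia.
by rewrite sE; apply: H; rewrite /= -sE.
Qed.

(** A block of length [b] contains a whole half block, so outside the bad event its maximum has [U]
    above [c], beyond the truncation level. There [U] and [V] agree, hence so do the positions of
    the maximum and the set of values exceeding it: [F] is monotone, and strict order passes from
    [X] to [U] off a null event. *)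
Lemma truncation_event (b n : nat) (c : R) : (0 < b)%N -> (b <= n)%N -> 0 < 1 - eps -> 1 - eps < c ->
  exists Bad : set Omega, [/\ measurable Bad,
    Pr P Bad <= 2 * Pr P (empty_half_block b (n %/ b) c) &
    forall w, ~ Bad w -> forall p q : nat, (p + b <= n)%N ->
      bcnt X q.+1%:Z b (bmax X p.+1%:Z b w) w = bcnt V q.+1%:Z b (bmax V p.+1%:Z b w) w].
Proof.
move=> b0 bn eps1 epsc; have [N [mN N0 orderN]] := cdf_order_null.
set k := (n %/ b)%N; have k0 : (0 < k)%N by rewrite divn_gt0.
set E1 := empty_half_block b k c; have mE1 : measurable E1 by exact: measurable_empty_half_block.
pose E2' (h : int) := [set w | forall i : nat, (i < b./2)%N -> U (i.+1%:Z + h) w <= c].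
have mC : measurable [set x | F x <= c].
  apply: is_interval_measurable => x y _ /= yc z /andP[_ zy].
  exact: le_trans (Fcdf_mono zy) yc.
have E2E h : P (E2' h) = P (E2' 0).
  rewrite /E2' (statX h b./2 (fun i => i.+1%:Z) (B := fun=> [set x | F x <= c]) (fun=> mC)).
  by congr (P _); apply/seteqP; split => w /= H i ib; have := H i ib; rewrite addr0.
have mE2 h : measurable (E2' h).
  rewrite (_ : E2' h = \bigcap_(i in [set i | (i < b./2)%N]) [set w | U (i.+1%:Z + h) w <= c]).
    by apply: bigcap_measurableType => i _; apply: measurable_lef; exact: measurable_Uv.
  by apply/seteqP; split => w.
(* Sliding blocks starting after [k * b - b / 2] contain no half block of index at most [2 * k]; they
   contain the half block of index [2 * k + 1], which by stationarity is as unlikely to be empty. *)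
set E2 := E2' (k * b)%N%:Z.
have PE2 : Pr P E2 <= Pr P E1.
  rewrite /Pr E2E -/(Pr P _) -/(Pr P _); apply: Pr_le => // w H.
  exists 1%N; split; first by lia.
  move=> s /half_block_range[s1 s2]; have sE : s = (`|s|%N.-1).+1%:Z + 0 by lia.
  by rewrite sE; apply: H; lia.
exists (E1 `|` E2 `|` N); split.
- exact: measurableU (measurableU _ _ mE1 (mE2 _)) mN.
- have h1 := Pr_setU P (measurableU _ _ mE1 (mE2 (k * b)%N%:Z)) mN.
  have h2 := Pr_setU P mE1 (mE2 (k * b)%N%:Z).
  have h3 : Pr P N = 0 by rewrite /Pr N0.
  by apply: le_trans h1 _; rewrite h3; move: h2; rewrite -/E2; lra.
move=> w nBad p q pn.
have nE1 : ~ E1 w by move=> ?; apply: nBad; left; left.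
have nE2 : ~ E2 w by move=> ?; apply: nBad; left; right.
have ord := orderN w (fun Nw => nBad (or_intror Nw)).
have [v vb Uvc] : exists2 v, (v < b)%N & c < U (p.+1%:Z + v%:Z) w.
  have nk : (n < k.+1 * b)%N by rewrite ltn_ceil.
  (* [i] is [2 * p / b] rounded up. Half block number [i.+1] is the first to start after [p], and it
     ends before [p + b]. *)
  have dE := divn_eq (2 * p + b - 1) b; have dlt := ltn_pmod (2 * p + b - 1) b0.
  set i := ((2 * p + b - 1) %/ b)%N in dE.
  have [ik|ki] := leqP i.+1 (2 * k).
    apply: contrapT => nv; apply: nE1; exists i.+1; split; first by lia.
    move=> s /half_block_range[s1 s2]; rewrite leNgt; apply/negP => cU; apply: nv.
    have s3 : p.+1%:Z <= s by lia.
    have s4 : s <= (p + b)%N%:Z by move: s2; rewrite mulSn; lia.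
    exists (`|s - p.+1%:Z|)%N; first by lia.
    by rewrite (_ : p.+1%:Z + _ = s) //; lia.
  apply: contrapT => nv; apply: nE2 => j jb; rewrite leNgt; apply/negP => cU; apply: nv.
  have kb : (2 * k * b <= i * b)%N by rewrite leq_mul2r; apply/orP; right; lia.
  have p1 : (p < k * b)%N by move: nk; rewrite mulSn; lia.
  have p2 : (2 * (k * b) < 2 * p + b)%N by rewrite mulnA; lia.
  exists (k * b + j - p)%N; first by lia.
  by rewrite (_ : p.+1%:Z + _ = j.+1%:Z + (k * b)%N%:Z) //; lia.
have UV s : V s w <= U s w.
  have /andP[U0 _] := Uv01 P mX s w.
  by rewrite /V /Ytr; case: ifP; rewrite ?mulr1 ?mulr0.
have UVeq s : 1 - eps < U s w -> V s w = U s w by move=> h; rewrite /V /Ytr h mulr1.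
have Umono s t : X s w <= X t w -> U s w <= U t w by exact: Fcdf_mono.
have [u ub [uE umax]] := bmax_attained X p.+1%:Z w b0.
have [u' ub' [uE' umax']] := bmax_attained V p.+1%:Z w b0.
set t := p.+1%:Z + u%:Z in uE umax.
have Ut : 1 - eps < U t w by apply: lt_trans epsc (lt_le_trans Uvc (Umono _ _ (umax v vb))).
have VtE := UVeq t Ut.
have -> : bmax V p.+1%:Z b w = V t w.
  rewrite uE'; apply: le_anti; rewrite umax'// andbT VtE.
  by apply: le_trans (UV _) _; apply: Umono; exact: umax.
rewrite uE /bcnt; apply: eq_bigr => x _; congr nat_of_bool.
set s := _ + _; apply/idP/idP.
  move=> /ord Uts; rewrite VtE UVeq//; exact: lt_trans Ut Uts.
move=> Vts; rewrite ltNge; apply/negP => /Umono Ust.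
by have := lt_le_trans Vts (UV s); rewrite VtE ltNge Ust.
Qed.

End Truncation.

(** * Tails of normal laws *)

Section NormalTail.
Context {R : realType}.

Definition normal_tail (v x : R) : R := 1 - normal_cdf v x.

Lemma measurable_ray_le (x : R) : measurable [set y : R | y <= x].
Proof. by apply: is_interval_measurable => y z /= _ zx t /andP[_ tz]; exact: le_trans tz zx. Qed.

Lemma measurable_ray_gt (x : R) : measurable [set y : R | x < y].
Proof. by apply: is_interval_measurable => y z /= xy _ t /andP[yt _]; exact: lt_le_trans xy yt. Qed.

Lemma normal_tailE (v x : R) : 0 < v ->
  normal_tail v x = Pr (normal_prob 0 (Num.sqrt v)) [set y | x < y].
Proof.
move=> v0; rewrite /normal_tail /normal_cdf v0 -/(Pr (normal_prob 0 (Num.sqrt v)) [set y : R | y <= x]).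
rewrite -Pr_setC; last exact: measurable_ray_le.
by congr Pr; apply/seteqP; split => y /=; [move/negP; rewrite -ltNge|rewrite ltNge => /negP].
Qed.

Lemma normal_pdf0E (s x : R) : s != 0 ->
  normal_pdf 0 s x = normal_peak s * expR (- x ^+ 2 / (s ^+ 2 *+ 2)).
Proof. by move=> s0; rewrite normal_pdfE// /normal_fun subr0. Qed.

Lemma normal_prob_interval_gt0 (s a : R) (A : set R) : s != 0 -> measurable A ->
  (forall x, a <= x <= a + 1 -> A x) -> 0 < Pr (normal_prob 0 s) A.
Proof.
move=> s0 mA aA.
pose c := normal_peak s * expR (- (`|a| + 1) ^+ 2 / (s ^+ 2 *+ 2)).
have c0 : 0 < c by rewrite mulr_gt0 ?normal_peak_gt0 ?expR_gt0.
have s2 : 0 < s ^+ 2 *+ 2 by rewrite pmulrn_lgt0// exprn_even_gt0.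
rewrite -lte_fin -Pr_fin//; apply: (@lt_le_trans _ _ c%:E); first by rewrite lte_fin.
pose I : set R := `[a, a + 1]%classic.
have mI : measurable I by exact: measurable_itv.
have mpdf B : measurable_fun B (fun x => (normal_pdf 0 s x)%:E).
  by apply/measurable_EFinP; apply: measurable_funTS; exact: measurable_normal_pdf.
have -> : c%:E = (\int[lebesgue_measure]_(x in I) c%:E)%E.
  have lI : lebesgue_measure I = 1%:E.
    rewrite /I lebesgue_measure_itv /= lte_fin ltrDl ltr01 -EFinD.
    by rewrite addrAC subrr add0r.
  transitivity (c%:E * lebesgue_measure I)%E; first by rewrite lI mule1.
  by rewrite integral_cst.
apply: (@le_trans _ _ (\int[lebesgue_measure]_(x in I) (normal_pdf 0 s x)%:E)%E).
  apply: ge0_le_integral => //.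
  - by move=> x _; rewrite lee_fin ltW.
  - exact: mpdf.
  - move=> x; rewrite /I /= in_itv /= => /andP[ax xa]; rewrite lee_fin normal_pdf0E// /c.
    rewrite ler_wpM2l ?normal_peak_ge0// ler_expR ler_pM2r ?invr_gt0// lerN2.
    rewrite -(real_normK (num_real x)) ler_sqr ?nnegrE ?addr_ge0//.
    by rewrite ler_norml; have := ler_norm a; have := ler_norm (- a); rewrite normrN => *; apply/andP; split; lra.
rewrite /normal_prob; apply: ge0_subset_integral => //.
- exact: mpdf.
- by move=> x _; rewrite lee_fin normal_pdf_ge0.

Qed.

Lemma normal_cdf1_gt0 (v : R) : 0 < normal_cdf v 1.
Proof.
rewrite /normal_cdf; case: ifP => [v0|_]; last by rewrite ler01.
apply: (@normal_prob_interval_gt0 _ 0); [by rewrite sqrtr_eq0 -ltNge|exact: measurable_ray_le|].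
by move=> x /= /andP[_]; rewrite add0r.
Qed.

Lemma normal_tail_gt0 (v x : R) : 0 < v -> 0 < normal_tail v x.
Proof.
move=> v0; rewrite normal_tailE//; apply: (@normal_prob_interval_gt0 _ (x + 1)).
- by rewrite sqrtr_eq0 -ltNge.
- exact: measurable_ray_gt.
- by move=> y /= /andP[xy _]; lra.
Qed.

Lemma normal_tail_nonincreasing (v x y : R) : 0 < v -> x <= y -> normal_tail v y <= normal_tail v x.
Proof.
move=> v0 xy; rewrite !normal_tailE//; apply: Pr_le; [exact: measurable_ray_gt..|].
by move=> z /=; exact: le_lt_trans.
Qed.

(** The ratio of the two densities tends to 0. A factor [1 / 2], valid at every level beyond [t], is
    a gap that survives summation over levels. *)
Lemma normal_tail_half (v1 v2 : R) : 0 <= v1 -> v1 < v2 ->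
  exists2 t, 0 < t & forall x, t <= x -> normal_tail v1 x <= normal_tail v2 x / 2.
Proof.
move=> v1_ge0 v12; have v2_gt0 : 0 < v2 by exact: le_lt_trans v12.
(* The degenerate case is the Dirac mass at 0, which has no tail at positive levels. *)
have [v1_gt0|v1_le0] := ltP 0 v1; last first.
  exists 1 => // x x1; rewrite /normal_tail {1}/normal_cdf ltNge v1_le0 /= (le_trans ler01 x1) subrr.
  by rewrite divr_ge0//; exact/ltW/normal_tail_gt0.
pose r := normal_peak (Num.sqrt v1) / normal_peak (Num.sqrt v2).
have s1 : Num.sqrt v1 != 0 by rewrite sqrtr_eq0 -ltNge.
have s2 : Num.sqrt v2 != 0 by rewrite sqrtr_eq0 -ltNge.
have p1 := normal_peak_gt0 s1; have p2 := normal_peak_gt0 s2.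
have r0 : 0 < r by rewrite divr_gt0.
pose dl := (v1 *+ 2)^-1 - (v2 *+ 2)^-1.
have dl0 : 0 < dl.
  by rewrite subr_gt0 ltf_pV2 ?posrE ?pmulrn_lgt0// ltr_pMn2r.
(* The density ratio is [r * expR (- (dl * y ^+ 2))]. As [expR x >= 1 + x], it is at most [1 / 2]
   once [y >= 1] and [y >= 2 * r / dl]. *)
pose t := 1 + 2 * r / dl.
have q0 : 0 < 2 * r / dl by rewrite divr_gt0// mulr_gt0.
have t0 : 0 < t by rewrite /t; lra.
exists t => // x tx.
have pdf_le y : t <= y -> normal_pdf 0 (Num.sqrt v1) y <= 2^-1 * normal_pdf 0 (Num.sqrt v2) y.
  move=> ty; rewrite !normal_pdf0E// !sqr_sqrtr// ?(ltW v2_gt0)//.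
  set e1 := expR _; set e2 := expR _.
  have ee : e2 = e1 * expR (dl * y ^+ 2) by rewrite /e1 /e2 -expRD /dl; congr expR; ring.
  have e10 : 0 < e1 by exact: expR_gt0.
  have h : 2 * r <= expR (dl * y ^+ 2).
    apply: le_trans (expR_ge1Dx _).
    have -> : 2 * r = dl * (2 * r / dl) by rewrite [RHS]mulrC divfK// gt_eqF.
    apply: (@le_trans _ _ (dl * y ^+ 2)); last by rewrite lerDr.
    rewrite ler_pM2l//; move: ty; rewrite /t; nra.
  have -> : normal_peak (Num.sqrt v1) = r * normal_peak (Num.sqrt v2) by rewrite /r divfK// gt_eqF.
  rewrite ee; set p := normal_peak _ in p2 *.
  have : 0 <= p * e1 * (expR (dl * y ^+ 2) - 2 * r) by rewrite !mulr_ge0 ?subr_ge0// ltW.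
  lra.
have mS := measurable_ray_gt x.
have mpdf s (B : set R) : measurable_fun B (fun x => (normal_pdf 0 s x)%:E).
  by apply/measurable_EFinP; apply: measurable_funTS; exact: measurable_normal_pdf.
have PrE s : (Pr (normal_prob 0 s) [set y : R | x < y])%:E =
    (\int[lebesgue_measure]_(y in [set y : R | (x < y)%R]) (normal_pdf 0 s y)%:E)%E.
  exact/esym/(Pr_fin (normal_prob 0 s) mS).
have scale : (\int[lebesgue_measure]_(y in [set y : R | (x < y)%R])
    ((2^-1)%:E * (normal_pdf 0 (Num.sqrt v2) y)%:E))%E =
    ((2^-1)%:E * \int[lebesgue_measure]_(y in [set y : R | (x < y)%R]) (normal_pdf 0 (Num.sqrt v2) y)%:E)%E.
  apply: ge0_integralZl_EFin; [exact: mS| |exact: mpdf|by rewrite invr_ge0].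
  by move=> y _; rewrite lee_fin normal_pdf_ge0.
suff key (r1 r2 : R) :
    r1%:E = (\int[lebesgue_measure]_(y in [set y : R | (x < y)%R]) (normal_pdf 0 (Num.sqrt v1) y)%:E)%E ->
    r2%:E = (\int[lebesgue_measure]_(y in [set y : R | (x < y)%R]) (normal_pdf 0 (Num.sqrt v2) y)%:E)%E ->
    r1 <= r2 / 2.
  rewrite (normal_tailE x v1_gt0) (normal_tailE x v2_gt0); exact: key (PrE _) (PrE _).
move=> r1E r2E; rewrite mulrC -lee_fin EFinM r1E r2E -scale.
apply: ge0_le_integral; [exact: mS| |exact: mpdf|by apply: measurable_funeM; exact: mpdf|].
  by move=> y _; rewrite lee_fin normal_pdf_ge0.
by move=> y /= xy; rewrite -EFinM lee_fin pdf_le// (le_trans tx)// ltW.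
Qed.

End NormalTail.

(** * Comparison of normal limits *)

Section NormalLimitComparison.
Context {R : realType} {d} {Omega : measurableType d} (P : probability Omega R).
Local Notation bm := bounded_measurable.

(** Capping at [H] loses, up to the distance of [x] and [y], at most [u - (H - A)]. For [dl > 0] one
    has [u - dl <= u ^ 2 / (4 * dl)], since [(u - 2 * dl) ^ 2 >= 0]; this trades the loss for a
    second moment divided by the distance of the cap. *)
Lemma tail_split (x y A H a u : R) : a <= A -> A < H -> 0 <= H -> x = u + a ->
  Num.max x 0 <= Num.min (Num.max y 0) H + `|y - x| + u ^+ 2 / (4 * (H - A)).
Proof.
move=> aA AH H0 xE; have HA : 0 < H - A by rewrite subr_gt0.
have HA4 : 0 < 4 * (H - A) by rewrite mulr_gt0.
have u4 : u - (H - A) <= u ^+ 2 / (4 * (H - A)).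
  rewrite ler_pdivlMr//; have := sqr_ge0 (u - 2 * (H - A)); nra.
have u0 : 0 <= u ^+ 2 / (4 * (H - A)) by rewrite divr_ge0 ?sqr_ge0// ltW.
move: u4 u0; set q := u ^+ 2 / _ => u4 u0.
have nxy := ler_norm (x - y); rewrite distrC in nxy.
have n0 := normr_ge0 (y - x).
have y1 : y <= Num.max y 0 by rewrite le_max lexx.
have y2 : 0 <= Num.max y 0 by rewrite le_max lexx orbT.
by rewrite ge_max; case: (leP (Num.max y 0) H) => yH; apply/andP; split; lra.
Qed.

Lemma layer_cake_Ex (Y : Omega -> R) (t h : R) (M : nat) : bm Y -> 0 < h ->
  Ex P (fun w => Num.min (Num.max (Y w - t) 0) (M%:R * h))
    <= h * \sum_(q < M) Pr P [set w | t + q%:R * h < Y w]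
  <= Ex P (fun w => Num.max (Y w - t) 0) + h.
Proof.
move=> bY h0.
have bmax : bm (fun w => Num.max (Y w - t) 0).
  by apply: bm_max; [apply: bmB => //; exact: bm_cst|exact: bm_cst].
have bmin : bm (fun w => Num.min (Num.max (Y w - t) 0) (M%:R * h)).
  by apply: bm_min => //; exact: bm_cst.
have mq x : measurable [set w | x < Y w] by apply: measurable_gt; exact: bY.1.
have bi (q : nat) : bm (fun w => (t + q%:R * h < Y w)%R%:R : R) by exact: bm_bool.
have -> : h * \sum_(q < M) Pr P [set w | t + q%:R * h < Y w] =
    Ex P (fun w => h * \sum_(q < M) (t + q%:R * h < Y w)%R%:R).
  rewrite ExZ; last by apply: bm_sum => q.
  rewrite Ex_sum => [|q]; last exact: bi.
  by congr (_ * _); apply: eq_bigr => q _; rewrite Ex_bool.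
have bS : bm (fun w => h * \sum_(q < M) (t + q%:R * h < Y w)%R%:R : R).
  by apply: bmZ; apply: bm_sum => q.
have lc w := layer_cake (Y w - t) M h0.
have SE w : \sum_(q < M) (t + q%:R * h < Y w)%R%:R = \sum_(q < M) (q%:R * h < Y w - t)%R%:R :> R.
  by apply: eq_bigr => q _; rewrite ltrBrDl.
apply/andP; split.
  by apply: Ex_le => // w; rewrite SE; have /andP[] := lc w.
rewrite -[X in _ + X](Ex_cst P h) -ExD//; last exact: bm_cst.
apply: Ex_le => // [|w]; first by apply: bmD => //; exact: bm_cst.
rewrite SE; have /andP[_ /le_trans] := lc w; apply.
by rewrite lerD2r ge_min lexx.
Qed.

Lemma Pr_gt (Y : Omega -> R) x : bm Y -> Pr P [set w | x < Y w] = 1 - Pr P [set w | Y w <= x].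
Proof.
move=> bY; rewrite -Pr_setC; last by apply: measurable_lef; exact: bY.1.
by congr Pr; apply/seteqP; split => w /=; [rewrite ltNge => /negP|move/negP; rewrite -ltNge].
Qed.

(** On the event [Y <= 1], of probability at least [p], a large shift must be compensated by the
    approximation error or by [T]: [a - 1] is at most their absolute values, and [1 + T ^ 2]
    dominates that of [T]. Expectations then bound [(a - 1) * p] by [2 + C]. *)
Lemma shift_bound (Y T : Omega -> R) (a C p e : R) : bm Y -> bm T -> 0 < p -> e <= 1 ->
  Ex P (fun w => `|Y w - (T w + a)|) <= e -> Ex P (fun w => T w ^+ 2) <= C ->
  p <= Pr P [set w | Y w <= 1] -> a <= 1 + (2 + C) / p.
Proof.
move=> bY bT p0 e1 he hC hp; rewrite leNgt; apply/negP => aA.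
have C0 : 0 <= C by apply: le_trans hC; apply: Ex_ge0 => w; exact: sqr_ge0.
have a1 : 0 < a - 1 by rewrite subr_gt0 (le_lt_trans _ aA)// lerDl divr_ge0 ?addr_ge0// ltW.
have bdiff : bm (fun w => Y w - (T w + a)) by apply: bmB => //; apply: bmD => //; exact: bm_cst.
have bf : bm (fun w => `|Y w - (T w + a)| + (1 + T w ^+ 2)).
  by apply: bmD; [exact: bm_norm|apply: bmD; [exact: bm_cst|exact: bmX]].
have mY : measurable [set w | Y w <= 1] by apply: measurable_lef; exact: bY.1.
have : (a - 1) * Pr P [set w | Y w <= 1] <= 2 + C.
  rewrite -Ex_indic// -ExZ; last exact: bm_indic.
  apply: (@le_trans _ _ (Ex P (fun w => `|Y w - (T w + a)| + (1 + T w ^+ 2)))).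
    apply: Ex_le => [||w]; [by apply: bmZ; exact: bm_indic|exact: bf|].
    rewrite indicE; have [Y1|/negP Y1] := boolP (w \in [set w | Y w <= 1]).
      rewrite inE /= in Y1; rewrite mulr1.
      have := ler_norm (- (Y w - (T w + a))); rewrite normrN => h.
      have := sqr_ge0 (T w + 1); have := sqr_ge0 (T w); nra.
    by rewrite mulr0 !addr_ge0// sqr_ge0.
  rewrite ExD; [|exact: bm_norm|by apply: bmD; [exact: bm_cst|exact: bmX]].
  rewrite ExD; [|exact: bm_cst|exact: bmX].
  by rewrite Ex_cst; lra.
have : (a - 1) * p <= (a - 1) * Pr P [set w | Y w <= 1] by rewrite ler_pM2l.
move=> h1 h2; have : (2 + C) / p < a - 1 by lra.
by rewrite ltr_pdivrMr//; lra.
Qed.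

(* Convergence in law does not control moments of [Ys], but the functions [Num.max (_ - t) 0] grow
   linearly, so the second moments of [Td] suffice to pass to the limit on the disjoint side, and a
   lower bound is all that is needed on the sliding side. The shift [a] is bounded by tightness. *)
Lemma normal_limit_comparison (Yd Ys : nat -> Omega -> R) (v1 v2 C : R) : 0 <= v1 -> 0 <= C ->
  cvg_law_normal P Yd v1 -> cvg_law_normal P Ys v2 ->
  (forall e : R, 0 < e -> \forall n \near \oo, exists (Yd' Ys' Td Ts : Omega -> R) (a : R),
    [/\ [/\ bm Yd', bm Ys', bm Td & bm Ts],
        (forall x, `|Pr P [set w | Yd n w <= x] - Pr P [set w | Yd' w <= x]| <= e) /\
        (forall x, `|Pr P [set w | Ys n w <= x] - Pr P [set w | Ys' w <= x]| <= e),
        Ex P (fun w => `|Yd' w - (Td w + a)|) <= e /\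
        Ex P (fun w => `|Ys' w - (Ts w + a)|) <= e,
        Ex P (fun w => Td w ^+ 2) <= C
      & forall z, Ex P (fun w => Num.max (Ts w + z) 0) <= Ex P (fun w => Num.max (Td w + z) 0) + e]) ->
  v2 <= v1.
Proof.
move=> v10 C0 cvd cvs H; rewrite leNgt; apply/negP => v12.
have v20 : 0 < v2 by exact: le_lt_trans v12.
have [t t0 half] := normal_tail_half v10 v12.
(* Tails beyond [t] of the larger variance integrate to at least the tail at [t + 1], that is
   [2 * tau]. Those of the smaller variance give at most half as much, so the gap to be contradicted
   is at least [tau]. *)
pose tau := normal_tail v2 (t + 1) / 2.
have tau0 : 0 < tau by rewrite divr_gt0// normal_tail_gt0.
pose p := normal_cdf v1 1; have p0 : 0 < p := normal_cdf1_gt0 v1.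
(* The event [Yd' <= 1] has probability at least [p - p / 4 - e >= p / 4], which bounds the shift by
   [A]. *)
pose A := 1 + (2 + C) / (p / 4).
(* [Q] is both the height of the cap and the inverse of the step, hence [M = Q * Q] levels. It is
   large enough for [h] and for the second moment term [C / (4 * (Q - A))] to be small against
   [tau]. *)
pose Q := (Num.truncn (A + (1 + C) * (4 / tau))).+1.
have QA : A + (1 + C) * (4 / tau) < Q%:R by exact: truncnS_gt.
have A1 : 1 <= A by rewrite /A lerDl divr_ge0 ?addr_ge0// ltW// divr_gt0.
have Q0 : 0 < Q%:R :> R by rewrite ltr0n.
pose h : R := Q%:R^-1; have h0 : 0 < h by rewrite invr_gt0.
pose M := (Q * Q)%N.
have Mh : M%:R * h = Q%:R by rewrite natrM /h mulfK// gt_eqF.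
pose dl := tau / (32 * Q%:R).
have dl0 : 0 < dl by rewrite divr_gt0// mulr_gt0.
pose e := Num.min dl (Num.min (p / 4) 1).
have e0 : 0 < e by rewrite !lt_min dl0 divr_gt0//=.
have eQ : e <= dl by rewrite ge_min lexx.
have ep : e <= p / 4 by rewrite !ge_min lexx !orbT.
have e1 : e <= 1 by rewrite !ge_min lexx !orbT.
pose x (q : nat) := t + q%:R * h.
have x0 q : 0 < x q by rewrite ltr_pwDl// mulr_ge0// ltW.
have near_cdf (Y : nat -> Omega -> R) v y r : cvg_law_normal P Y v -> 0 < r -> 0 < y ->
    \forall n \near \oo, `|Pr P [set w | Y n w <= y] - normal_cdf v y| <= r.
  move=> cv r0 y0; have := cv y (or_intror (lt0r_neq0 y0)).
  move=> /cvgrPdist_le/(_ r r0); apply: filterS => n; by rewrite distrC.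
have hd : \forall n \near \oo, forall q : 'I_M,
    `|Pr P [set w | Yd n w <= x q] - normal_cdf v1 (x q)| <= dl.
  by apply: filter_forall => q; exact: near_cdf.
have hs : \forall n \near \oo, forall q : 'I_M,
    `|Pr P [set w | Ys n w <= x q] - normal_cdf v2 (x q)| <= dl.
  by apply: filter_forall => q; exact: near_cdf.
have h1 := near_cdf Yd v1 1 (p / 4) cvd (divr_gt0 p0 (ltr0n _ 4)) ltr01.
have [n [[[nd ns] n1]]] := filter_ex (filterI (filterI (filterI hd hs) h1) (H e e0)).
move=> [Yd' [Ys' [Td [Ts [a [[bYd bYs bTd bTs] [dY dS] [dT dTs] hC conv]]]]]].
have aA : a <= A.
  apply: (shift_bound bYd bTd (divr_gt0 p0 (ltr0n _ 4)) e1 dT hC).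
  have := dY 1; move: n1; rewrite !ler_norml -/p => /andP[? ?] /andP[? ?]; lra.
pose Ssum := h * \sum_(q < M) Pr P [set w | t + q%:R * h < Ys' w].
pose Dsum := h * \sum_(q < M) Pr P [set w | t + q%:R * h < Yd' w].
pose S2 := h * \sum_(q < M) normal_tail v2 (x q).
pose S1 := h * \sum_(q < M) normal_tail v1 (x q).
have sumM c : h * \sum_(q < M) c = Q%:R * c :> R by rewrite sum_cst mulrA [h * _]mulrC Mh.
have hS2 : S2 <= Ssum + Q%:R * (2 * dl).
  rewrite -sumM /S2 /Ssum -mulrDr ler_wpM2l ?(ltW h0)// -big_split /=; apply: ler_sum => q _.
  rewrite Pr_gt// /normal_tail -/(x q).
  by have := dS (x q); have := ns q; rewrite !ler_norml => /andP[? ?] /andP[? ?]; lra.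
have hS1 : Dsum <= S1 + Q%:R * (2 * dl).
  rewrite -sumM /S1 /Dsum -mulrDr ler_wpM2l ?(ltW h0)// -big_split /=; apply: ler_sum => q _.
  rewrite Pr_gt// /normal_tail -/(x q).
  by have := dY (x q); have := nd q; rewrite !ler_norml => /andP[? ?] /andP[? ?]; lra.
have hS12 : S1 <= S2 / 2.
  rewrite /S1 /S2 -mulrA ler_wpM2l ?(ltW h0)// mulr_suml; apply: ler_sum => q _.
  by apply: half; rewrite /x lerDl mulr_ge0// ltW.
have hS20 : 2 * tau <= S2.
  rewrite /tau mulrC divfK//.
  have -> : normal_tail v2 (t + 1) = h * (Q%:R * normal_tail v2 (t + 1)).
    by rewrite mulrA mulVf ?mul1r// gt_eqF.
  rewrite /S2 ler_wpM2l ?(ltW h0)// -sum_cst.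
  have QM : (Q <= M)%N by rewrite leq_pmull.
  rewrite -[M](subnKC QM) big_split_ord /= -[leLHS]addr0 lerD//; last first.
    by apply: sumr_ge0 => q _; exact/ltW/normal_tail_gt0.
  apply: ler_sum => q _; apply: normal_tail_nonincreasing => //.
  by rewrite /x lerD2l /h ler_pdivrMr// mul1r ler_nat ltnW.
have bxT (T : Omega -> R) z : bm T -> bm (fun w => Num.max (T w + z) 0).
  by move=> bT; apply: bm_max; [apply: bmD => //; exact: bm_cst|exact: bm_cst].
have bdf (Y T : Omega -> R) : bm Y -> bm T -> bm (fun w => `|Y w - (T w + a)|).
  by move=> bY bT; apply: bm_norm; apply: bmB => //; apply: bmD => //; exact: bm_cst.
have step1 : Ex P (fun w => Num.max (Ys' w - t) 0) <= Ex P (fun w => Num.max (Ts w + (a - t)) 0) + e.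
  apply: (@le_trans _ _ (Ex P (fun w => Num.max (Ts w + (a - t)) 0 + `|Ys' w - (Ts w + a)|))).
    apply: Ex_le => [||w]; [exact: bxT|by apply: bmD; [exact: bxT|exact: bdf]|].
    rewrite (_ : Ys' w - (Ts w + a) = Ys' w - t - (Ts w + (a - t))); last by ring.
    exact: pos_part_lipschitz.
  by rewrite ExD; [rewrite lerD2l|exact: bxT|exact: bdf].
have step2 := conv (a - t).
have AQ : A < Q%:R.
  apply: lt_trans QA; rewrite ltrDl; apply: mulr_gt0; last exact: divr_gt0.
  exact: ltr_pwDl.
have step3 : Ex P (fun w => Num.max (Td w + (a - t)) 0) <=
    Ex P (fun w => Num.min (Num.max (Yd' w - t) 0) (M%:R * h)) + e + C / (4 * (Q%:R - A)).
  have b1 : bm (fun w => Num.min (Num.max (Yd' w - t) 0) (M%:R * h)).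
    by apply: bm_min; [exact: bxT|exact: bm_cst].
  have b2 := bdf _ _ bYd bTd.
  have b3 : bm (fun w => (4 * (Q%:R - A))^-1 * Td w ^+ 2) by apply: bmZ; exact: bmX.
  apply: (@le_trans _ _ (Ex P (fun w => Num.min (Num.max (Yd' w - t) 0) (M%:R * h)
      + `|Yd' w - (Td w + a)| + (4 * (Q%:R - A))^-1 * Td w ^+ 2))).
    apply: Ex_le => [||w]; [exact: bxT|by apply: bmD => //; exact: bmD|].
    have := @tail_split (Td w + (a - t)) (Yd' w - t) A (M%:R * h) (a - t) (Td w).
    rewrite Mh [_^-1 * _]mulrC (_ : _ - t - _ = Yd' w - (Td w + a)); last by ring.
    by apply => //; lra.
  rewrite (ExD P (bmD b1 b2) b3) (ExD P b1 b2) ExZ; last exact: bmX.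
  rewrite !lerD// mulrC ler_wpM2r// invr_ge0 mulr_ge0// subr_ge0 ltW//.
have /andP[_ lcS] := layer_cake_Ex t M bYs h0.
have /andP[lcD _] := layer_cake_Ex t M bYd h0.
rewrite -/Ssum in lcS; rewrite -/Dsum in lcD.
(* The pointwise errors [2 * dl] of both schemes are summed over a range of length [Q], and each of
   three comparisons costs [e]. The four terms are at most [tau / 8], [tau / 4], [3 * tau / 32] and
   [tau / 16], together [17 * tau / 32 < tau]. *)
have final : tau <= 4 * (Q%:R * dl) + h + 3 * e + C / (4 * (Q%:R - A)) by lra.
have Qdl : Q%:R * dl = tau / 32.
  by rewrite /dl invfM mulrCA [Q%:R * _]mulrCA mulfV ?mulr1// gt_eqF.
have QAC : (1 + C) * 4 < (Q%:R - A) * tau.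
  by rewrite -ltr_pdivrMr// -mulrA ltrBrDl.
have hC' : C / (4 * (Q%:R - A)) <= tau / 16.
  rewrite ler_pdivrMr ?mulr_gt0 ?subr_gt0//; nra.
have hh : h <= tau / 4.
  rewrite /h -[leLHS]mul1r ler_pdivrMr//; nra.
have Q1 : 1 <= Q%:R :> R by rewrite ler1n.
have dlt : dl <= tau / 32.
  by rewrite -Qdl -[leLHS]mul1r ler_wpM2r// ltW.
lra.
Qed.

End NormalLimitComparison.

(** * The block estimators *)

(** One formula covers both schemes, through [pos] and the relation of admissible pairs in
    [pair_estimator], and both the raw and the truncated series, through [Y]. *)
Definition pair_kernel {R : realType} {T : Type} (Y : int -> T -> R) (b m : nat) (c : nat -> R)
  (pos : nat -> nat) (i i' : nat) (w : T) : R :=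
  \sum_(j < m) c j * (bcnt Y (pos i').+1%:Z b (bmax Y (pos i).+1%:Z b w) w == j.+1)%:R.

Definition pair_estimator {R : realType} {T : Type} (Y : int -> T -> R) (b m : nat) (c : nat -> R)
  (pos : nat -> nat) (N : nat) (D : rel nat) (w : T) : R :=
  ((\sum_(i < N) \sum_(j < N | D i j) 1)%N%:R)^-1 *
  \sum_(i < N) \sum_(j < N | D i j) pair_kernel Y b m c pos i j w.

Section Estimators.
Context {R : realType} {d} {Omega : measurableType d} (P : probability Omega R).
Local Notation bm := bounded_measurable.

Lemma bm_pair_estimator (Y : int -> Omega -> R) b m c pos N D :
  (0 < b)%N -> (forall s, measurable_fun setT (Y s)) -> bm (pair_estimator Y b m c pos N D).
Proof.
move=> b0 mY; apply: bmZ; apply: bm_sum => i; apply: bm_sum => j; apply: bm_sum => l; apply: bmZ.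
pose M w := bmax Y (pos i).+1%:Z b w.
have mM : measurable_fun setT M by exact: (measurable_block_max (V := Y) b0 (p := pos i)).
have mcnt : measurable_fun setT (fun w => (bcnt Y (pos j).+1%:Z b (M w) w)%:R : R).
  rewrite /bcnt; under eq_fun do rewrite natr_sum.
  apply: measurable_sum => u; apply: (bm_bool _).1.
  have /(_ measurableT [set true]) := measurable_fun_ltr mM (mY ((pos j).+1%:Z + u%:Z)).
  by rewrite setTI; apply.
apply: bm_bool.
have /(_ measurableT [set true]) := measurable_fun_eqr mcnt (measurable_cst (l.+1%:R : R)).
rewrite setTI => /(_ Logic.I); congr measurable.
by apply/seteqP; split => w /=; rewrite eqr_nat.
Qed.

Lemma Pr_diff (Y Y' : Omega -> R) (A : set Omega) x : measurable_fun setT Y -> measurable_fun setT Y' ->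
  measurable A -> (forall w, ~ A w -> Y w = Y' w) ->
  `|Pr P [set w | Y w <= x] - Pr P [set w | Y' w <= x]| <= Pr P A.
Proof.
move=> mY mY' mA YY'.
have half (f g : Omega -> R) : measurable_fun setT f -> measurable_fun setT g ->
    (forall w, ~ A w -> f w = g w) -> Pr P [set w | f w <= x] <= Pr P [set w | g w <= x] + Pr P A.
  move=> mf mg fg; have mB := measurable_lef x mg.
  apply: le_trans (Pr_setU P mB mA); apply: Pr_le; [exact: measurable_lef|exact: measurableU|].
  move=> w /= fx; have [Aw|nA] := pselect (A w); first by right.
  by left; rewrite /= -fg.
have h1 := half _ _ mY mY' YY'.
have h2 := half _ _ mY' mY (fun w nA => esym (YY' w nA)).
by rewrite ler_norml; apply/andP; split; lra.
Qed.

Variables (X : int -> Omega -> R) (eps : R) (b m : nat) (c : nat -> R).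
Hypothesis mX : forall t, measurable_fun setT (X t).
Hypothesis statX : strictly_stationary P X.
Hypothesis b0 : (0 < b)%N.
Let V := Ytr P X eps.
Local Notation B := (coef_bound m c).
Local Notation mu := (projection_mean P X eps b m c).
Local Notation eta := (comparison_constant P X eps b m c).
Local Notation proj := (projection P X eps b m c V).

(** The shift [s * (mu - eta - pstar)] involves neither [pos] nor [D]: it is the same for both block
    schemes and cancels in their comparison. *)
Lemma estimator_error (N K : nat) (pos : nat -> nat) (D : rel nat) (rho lam s pstar : R) :
  (0 < N)%N -> pos 0%N = 0%N -> (0 < K)%N -> 0 < lam -> 0 <= s ->
  avg N (fun i => avg N (fun j => (near_blocks b pos i j)%:R)) <= rho ->
  (forall i j, ~~ D i j -> near_blocks b pos i j) ->
  Ex P (fun w => `|s * (pair_estimator V b m c pos N D w - pstar) -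
    (s * (avg N (fun i => proj (pos i) w) - mu) + s * (mu - eta - pstar))|)
  <= s * (B * (2 * rho + comparison_error P X eps b rho K lam)).
Proof.
move=> N0 pos0 K0 lam0 s0 hnear Dnear.
have B0 : 0 <= B by rewrite /coef_bound addr_ge0// mulr_ge0// sumr_ge0.
have mV t : measurable_fun setT (V t) by exact: measurable_Ytr.
have bE : bm (pair_estimator V b m c pos N D) by exact: bm_pair_estimator.
have bA : bm (fun w => avg N (fun i => avg N (fun j => block_kernel P X eps b m c pos i j w))).
  by apply: bm_avg => i; apply: bm_avg => j; exact: bm_block_kernel.
have bP : bm (fun w => avg N (fun i => proj (pos i) w) - eta).
  by apply: bmB; [apply: bm_avg => i; exact: bm_projection|exact: bm_cst].
have step : Ex P (fun w => `|pair_estimator V b m c pos N D w - (avg N (fun i => proj (pos i) w) - eta)|)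
    <= B * (2 * rho + comparison_error P X eps b rho K lam).
  apply: le_trans (Ex_norm_triangle P bE bA bP) _; rewrite mulrDr lerD//; last exact: linearization.
  rewrite -[leRHS](Ex_cst P); apply: Ex_le => [||w]; [by apply: bm_norm; exact: bmB|exact: bm_cst|].
  have kB i j : `|block_kernel P X eps b m c pos i j w| <= B by exact: block_kernel_bound.
  have := subset_pair_average D N0 kB => /le_trans; apply.
  rewrite -mulrA [leRHS]mulrCA ler_wpM2l// ler_wpM2l//; apply: le_trans hnear.
  apply: ler_avg => i _; apply: ler_avg => j _; rewrite ler_nat.
  by case: (boolP (D i j)) => //= /Dnear ->.
rewrite (_ : (fun w => _) = fun w =>
    s * `|pair_estimator V b m c pos N D w - (avg N (fun i => proj (pos i) w) - eta)|); last first.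
  by apply/funext => w; rewrite -[X in X * `|_|](ger0_norm s0) -normrM; congr (`|_|); ring.
by rewrite ExZ ?ler_wpM2l//; apply: bm_norm; exact: bmB.
Qed.

End Estimators.

(** * Choice of the grid and of the weight, and linear combinations *)

Section ErrorAsymptotics.
Context {R : realType} {d} {Omega : measurableType d} (P : probability Omega R).
Variables (X : int -> Omega -> R) (eps : R).

(* Here [s = sqrt k]. With [rho = 8 / k], [a <= dl / k], grid size [K ~ L * sqrt k] and weight
   [lam = L ^ 2], every term of the error is [O(1 / L)] or vanishes as [k] grows for fixed [L]. *)
Lemma comparison_error_bound (b L : nat) (s a dl : R) :
  alpha_eps P X eps b = a -> 0 <= a -> (0 < L)%N -> 1 <= s -> a * s ^+ 2 <= dl -> dl <= 1 ->
  s * (2 * (8 / s ^+ 2) + comparison_error P X eps b (8 / s ^+ 2) (L * (Num.truncn s).+1) (L%:R ^+ 2))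
  <= 58 / L%:R + 12 * L%:R ^+ 3 * dl + (24 + 8 * L%:R ^+ 2) / s.
Proof.
move=> aE a0 L0 s1 adl dl1; rewrite /comparison_error aE.
have s0 : 0 < s by exact: lt_le_trans s1.
have sn0 : s != 0 by rewrite gt_eqF.
have L1 : 1 <= L%:R :> R by rewrite ler1n.
have Lp : 0 < L%:R :> R by exact: lt_le_trans L1.
have Ln0 : L%:R != 0 :> R by rewrite gt_eqF.
set r := (Num.truncn s).+1.
have rs : s <= r%:R by rewrite ltW// truncnS_gt.
have r2s : r%:R <= 2 * s.
  have rE : r%:R = (Num.truncn s)%:R + 1 :> R by rewrite natr1.
  by rewrite rE; have /andP[h _] := truncn_itv (ltW s0); lra.
have K1 : L%:R * s <= (L * r)%:R by rewrite natrM ler_wpM2l// ltW.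
(* [2 * (L * r + 1) <= 4 * L * s + 2], and [1 <= L * s]. *)
have K2 : ((L * r).+1 * 2)%:R <= 6 * L%:R * s.
  rewrite natrM -natr1 natrM; nra.
have Kp : 0 < (L * r)%:R :> R by apply: lt_le_trans K1; exact: mulr_gt0.
set K := (L * r)%:R in K1 Kp *; set K' := ((L * r).+1 * 2)%:R in K2 *.
have K'0 : 0 <= K' by rewrite /K'.
have dl0 : 0 <= dl by apply: le_trans adl; rewrite mulr_ge0// sqr_ge0.
have t1 : s * (4 * K^-1) <= 4 / L%:R.
  rewrite mulrCA ler_wpM2l// ler_pdivrMr// mulrC ler_pdivlMr// mulrC//.
have t2 : s * (K' * a) <= 6 * L%:R * dl.
  apply: (@le_trans _ _ (s * (6 * L%:R * s * a))); first by rewrite ler_wpM2l ?(ltW s0)// ler_wpM2r.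
  rewrite (_ : s * _ = 6 * L%:R * (a * s ^+ 2)); last by ring.
  by rewrite ler_wpM2l// mulr_ge0// ltW.
have t3 : s * (8 / s ^+ 2) = 8 / s by field.
have L23 : L%:R <= L%:R ^+ 3 :> R.
  by rewrite -{1}[L%:R]expr1; apply: ler_weXn2l.
(* [54 = 6 * 9]: the 6 comes from the number of cells, and 9 bounds [8 + a * s ^ 2]. Adding the 4 of
   [t1] gives 58. *)
have t4 : s * ((L%:R ^+ 2)^-1 * (K' * (8 / s ^+ 2 + a))) <= 54 / L%:R.
  apply: (@le_trans _ _ (s * ((L%:R ^+ 2)^-1 * (6 * L%:R * s * (8 / s ^+ 2 + a))))).
    rewrite ler_wpM2l ?(ltW s0)// ler_wpM2l ?invr_ge0 ?sqr_ge0// ler_wpM2r// addr_ge0//.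
    by rewrite divr_ge0// sqr_ge0.
  rewrite (_ : s * _ = 6 / L%:R * (8 + a * s ^+ 2)); last by field; rewrite sn0 Ln0.
  rewrite (_ : 54 / L%:R = 6 / L%:R * 9); last by field.
  by rewrite ler_wpM2l ?divr_ge0// ?(ltW Lp)//; lra.
have t5 : s * (L%:R ^+ 2 * (K' * a)) <= 6 * L%:R ^+ 3 * dl.
  rewrite (_ : s * _ = L%:R ^+ 2 * (s * (K' * a))); last by ring.
  rewrite (_ : 6 * _ * _ = L%:R ^+ 2 * (6 * L%:R * dl)); last by ring.
  by rewrite ler_wpM2l// sqr_ge0.
have t6 : 6 * L%:R * dl <= 6 * L%:R ^+ 3 * dl by rewrite ler_wpM2r// ler_wpM2l.
have -> : s * (2 * (8 / s ^+ 2) + (4 * K^-1 + K' * a + 8 / s ^+ 2 + L%:R ^+ 2 * (8 / s ^+ 2 + K' * a)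
    + (L%:R ^+ 2)^-1 * (K' * (8 / s ^+ 2 + a)))) =
  (3 + L%:R ^+ 2) * (s * (8 / s ^+ 2)) + s * (4 * K^-1) + s * (K' * a) + s * (L%:R ^+ 2 * (K' * a))
  + s * ((L%:R ^+ 2)^-1 * (K' * (8 / s ^+ 2 + a))) by ring.
rewrite t3 (_ : (3 + L%:R ^+ 2) * (8 / s) = (24 + 8 * L%:R ^+ 2) / s); last by ring.
rewrite (_ : 58 / L%:R = 4 / L%:R + 54 / L%:R); last by ring.
lra.
Qed.

End ErrorAsymptotics.

Section QuadraticForms.
Context {R : realType} {d} {Omega : measurableType d}.
Variables (X : int -> Omega -> R) (b : nat -> nat) (theta : R) (pi : nat -> R) (m : nat).
Variable c : 'cV[R]_m.

Definition coef_fun (j : nat) : R := if insub j is Some i then c i 0 else 0.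

Lemma coef_funE (i : 'I_m) : coef_fun i = c i 0.
Proof. by rewrite /coef_fun valK. Qed.

Definition centering : R := \sum_(j < m) coef_fun j * pbar theta pi j.+1.

Lemma pair_estimatorE (Y : int -> Omega -> R) len pos N D w :
  pair_estimator Y len m coef_fun pos N D w = \sum_(j < m) coef_fun j *
    (((\sum_(i < N) \sum_(i' < N | D i i') 1)%N%:R)^-1 * \sum_(i < N) \sum_(i' < N | D i i')
    (bcnt Y (pos i').+1%:Z len (bmax Y (pos i).+1%:Z len w) w == j.+1)%:R).
Proof.
under [RHS]eq_bigr do rewrite mulrCA mulr_sumr.
rewrite -mulr_sumr /pair_estimator; congr (_ * _); rewrite [RHS]exchange_big /=.
apply: eq_bigr => i _; under [RHS]eq_bigr do rewrite mulr_sumr.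
by rewrite [RHS]exchange_big.
Qed.

Lemma linear_s_db n w : (c^T *m s_db X b theta pi m n w) 0 0 =
  Num.sqrt (kn b n)%:R * (pair_estimator X (b n) m coef_fun (fun i => i * b n)%N (kn b n)
    [rel i j | j != i] w - centering).
Proof.
rewrite mxE pair_estimatorE /centering -sumrB mulr_sumr; apply: eq_bigr => j _.
rewrite !mxE -coef_funE -mulrBr mulrCA; congr (_ * (_ * (_ - _))).
rewrite /phat_db; congr (_^-1 * _).
congr (_%:R); rewrite -[LHS]/(kn b n * (kn b n).-1)%N.
transitivity (\sum_(i < kn b n) (kn b n).-1)%N; first by rewrite sum_nat_const card_ord.
apply: eq_bigr => i _; rewrite sum1_card.
have := cardC1 i; rewrite card_ord => <-; apply: eq_card => i'.
by rewrite !inE.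
Qed.

Lemma linear_s_sb n w : (c^T *m s_sb X b theta pi m n w) 0 0 =
  Num.sqrt (kn b n)%:R * (pair_estimator X (b n) m coef_fun id (n - b n).+1 (sb_disj b n) w - centering).
Proof.
rewrite mxE pair_estimatorE /centering -sumrB mulr_sumr; apply: eq_bigr => j _.
by rewrite !mxE -coef_funE -mulrBr mulrCA.
Qed.

End QuadraticForms.

Lemma block_count_bounds (n b : nat) : (0 < b)%N -> (2 <= n %/ b)%N ->
  [/\ (b <= n)%N, (n %/ b * b <= n)%N, ((n %/ b).-1 * b <= (n - b).+1)%N
    & ((n - b).+1 <= n %/ b * b)%N].
Proof.
move=> b0 k2; have bn : (b <= n)%N.
  by rewrite leqNgt; apply/negP => nb; rewrite divn_small in k2.
have kbn := leq_trunc_div n b; have nkb : (n < (n %/ b).+1 * b)%N by rewrite ltn_ceil.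
move: k2 kbn nkb; case: (n %/ b)%N => [//|k] _; rewrite !mulSn /= => h1 h2.
by split => //; lia.
Qed.

(** Only a block and its two neighbours are near, a fraction of [3 / k]; [8 / k] is the value shared
    with the sliding scheme. *)
Lemma near_disjoint_fraction {R : realType} (b k : nat) : (0 < b)%N ->
  avg k (fun i => avg k (fun j => (near_blocks b (fun i => i * b)%N i j)%:R)) <= 8 / k%:R :> R.
Proof.
move=> b0; apply: (@le_trans _ _ (3 / k%:R)).
  by apply: (@near_fraction R k 3 _ predn) => i j /andP[]; rewrite -!mulnDl !ltn_pmul2r//; lia.
by rewrite ler_wpM2r ?invr_ge0// (ler_nat R 3 8).
Qed.

(** Fewer than [4 * b] starting points are within two block lengths of a given one, and
    [N >= k.-1 * b >= k * b / 2]. This is the origin of the constant 8. *)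
Lemma near_sliding_fraction {R : realType} (b k N : nat) : (2 <= k)%N -> (0 < N)%N -> (k.-1 * b <= N)%N ->
  avg N (fun i => avg N (fun j => (near_blocks b id i j)%:R)) <= 8 / k%:R :> R.
Proof.
move=> k2 N0 N1; apply: (@le_trans _ _ ((4 * b)%:R / N%:R)).
  by apply: (@near_fraction R N (4 * b) _ (fun i => (i.+1 - 2 * b)%N)) => i j /andP[] /=; lia.
rewrite ler_pdivrMr ?ltr0n// mulrAC ler_pdivlMr ?ltr0n; last by lia.
rewrite -!natrM ler_nat; move: k2 N1; case: k => [//|k] /=; nia.
Qed.

Lemma sliding_near (b : nat -> nat) n i j : ~~ sb_disj b n i j -> near_blocks (b n) id i j.
Proof. by rewrite /sb_disj /near_blocks /=; lia. Qed.

Lemma disjoint_near (b : nat) i j : (0 < b)%N -> ~~ (j != i) -> near_blocks b (fun i => i * b)%N i j.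
Proof. by rewrite negbK => b0 /eqP ->; rewrite /near_blocks /=; lia. Qed.

(** * Growth of the number of blocks *)

Section BlockAsymptotics.
Context {R : realType} {d} {Omega : measurableType d} (P : probability Omega R).
Variables (X : int -> Omega -> R) (b : nat -> nat).
Hypothesis b_large : ((b n)%:R : R) @[n --> \oo] --> +oo%R.
Hypothesis b_small : ((b n)%:R / n%:R : R) @[n --> \oo] --> (0:R).

Lemma near_b_gt0 : \forall n \near \oo, (0 < b n)%N.
Proof.
have : \forall n \near \oo, 1 <= (b n)%:R :> R by exact: (cvgryPge _).1 b_large 1.
by apply: filterS => n; rewrite ler1n.
Qed.

Lemma near_kn_ge (K : nat) : \forall n \near \oo, (K <= kn b n)%N.
Proof.
have K0 : 0 < K.+1%:R^-1 :> R by rewrite invr_gt0.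
have h : \forall n \near \oo, `|(b n)%:R / n%:R| <= K.+1%:R^-1 :> R.
  exact: (cvgr0Pnorm_le _).1 b_small _ K0.
have n_gt0 : \forall n \near \oo, (0 < n)%N by exact: nbhs_infty_gt.
apply: filterS (filterI (filterI h near_b_gt0) n_gt0) => n [[+ bn] n0].
rewrite ger0_norm ?divr_ge0// ler_pdivrMr ?ltr0n// mulrC ler_pdivlMr ?ltr0n//.
rewrite -natrM ler_nat => h1; rewrite /kn leq_divRL//.
by apply: leq_trans h1; rewrite mulnC leq_mul2l leqnSn orbT.
Qed.

Lemma near_sqrt_kn_ge (S : R) : \forall n \near \oo, S <= Num.sqrt (kn b n)%:R.
Proof.
apply: filterS (near_kn_ge (Num.truncn (S ^+ 2)).+1) => n kn_ge.
have [S0|S0] := leP S 0; first exact: le_trans S0 (sqrtr_ge0 _).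
rewrite -[X in X <= _](ger0_norm (ltW S0)) -sqrtr_sqr.
apply: ler_wsqrtr; apply: (@le_trans _ _ (Num.truncn (S ^+ 2)).+1%:R); last by rewrite ler_nat.
exact/ltW/truncnS_gt.
Qed.

(** The polynomial mixing rate at lag [b n] gives [k_n * alpha(b_n) <= C * k_n / b_n ^ etaC], which
    vanishes by the growth condition on the blocks. *)
Lemma near_kn_alpha (eps etaC C dl : R) : 0 < C -> 0 < dl ->
  (forall l : nat, (1 <= l)%N -> alpha_eps P X eps l <= C * powR l%:R (- etaC)) ->
  (kn b n)%:R / powR (b n)%:R etaC @[n --> \oo] --> (0:R) ->
  \forall n \near \oo, alpha_eps P X eps (b n) * (kn b n)%:R <= dl.
Proof.
move=> C0 dl0 hal hk.
have h : \forall n \near \oo, `|(kn b n)%:R / powR (b n)%:R etaC| <= dl / C.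
  exact: (cvgr0Pnorm_le _).1 hk _ (divr_gt0 dl0 C0).
apply: filterS (filterI h near_b_gt0) => n [+ bn].
rewrite ger0_norm ?divr_ge0 ?powR_ge0// => h1.
apply: (@le_trans _ _ (C * powR (b n)%:R (- etaC) * (kn b n)%:R)); first by rewrite ler_wpM2r// hal.
move: h1; rewrite ler_pdivlMr// powRN => h1.
by apply: le_trans h1; rewrite le_eqVlt; apply/orP; left; apply/eqP; ring.
Qed.

End BlockAsymptotics.

(** * Comparison of the two limits in every direction *)

Section SlidingVersusDisjoint.
Context {R : realType} {d} {Omega : measurableType d} (P : probability Omega R).
Variables (X : int -> Omega -> R) (theta : R) (pi : nat -> R) (pi2 : R -> nat -> nat -> R) (b : nat -> nat).
Hypothesis mX : forall t : int, measurable_fun setT (X t).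
Hypothesis statX : strictly_stationary P X.
Hypothesis b_large : ((b n)%:R : R) @[n --> \oo] --> +oo%R.
Hypothesis b_small : ((b n)%:R / n%:R : R) @[n --> \oo] --> (0:R).
Hypothesis condC : conditionC P X theta pi pi2 b.

Lemma quadratic_form_le (m : nat) (Sdb Ssb : 'M[R]_m) (c : 'cV[R]_m) :
  cov_matrix Sdb ->
  cvg_law_mnormal P (s_db X b theta pi m) Sdb ->
  cvg_law_mnormal P (s_sb X b theta pi m) Ssb ->
  (c^T *m Ssb *m c) 0 0 <= (c^T *m Sdb *m c) 0 0.
Proof.
move=> [_ psd] cvd cvs.
have [_ [eps [etaC [C [[/andP[eps0 eps1] _ C0] hal [_ hk] _ [c0 [epsc hE1]]]]]] _] := condC.
set cc := coef_fun c; pose B := coef_bound m cc.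
have B0 : 0 < B by rewrite /B /coef_bound ltr_wpDl// mulr_ge0// sumr_ge0.
(* [36 = 4 * 9]: the variance of the linear part times [k] is at most [4 * B ^ 2 * (8 + alpha * k)],
   and eventually [alpha * k <= 1]. *)
apply: (normal_limit_comparison (C := 36 * B ^+ 2) _ _ (cvd c) (cvs c)) => //.
  by rewrite mulr_ge0// sqr_ge0.
move=> e e0.
(* [L], then [dl], then the lower bound [S] for [sqrt k] make each of the three terms of the
   linearization error, times [B], at most [e / 4]; [dl] and [S] depend on [L], hence this order.
   The part [pb] of [S] takes care of the boundary term [8 * B / sqrt k] of the convexity step. *)
pose L := (Num.truncn (58 * B * 4 / e)).+1.
have L0 : (0 < L)%N by [].
have Lp : 0 < L%:R :> R by rewrite ltr0n.
have LB : 58 * B * 4 / e < L%:R by exact: truncnS_gt.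
pose dl := Num.min 1 (e / (48 * B * L%:R ^+ 3)).
have BL3 : 0 < 48 * B * L%:R ^+ 3 by rewrite !mulr_gt0// exprn_gt0.
have dl0 : 0 < dl by rewrite lt_min ltr01 divr_gt0.
have dl1 : dl <= 1 by rewrite ge_min lexx.
have dlB : dl * (48 * B * L%:R ^+ 3) <= e by rewrite -ler_pdivlMr// ge_min lexx orbT.
pose pa := (24 + 8 * L%:R ^+ 2) * B * 4 / e; pose pb := 8 * B / e; pose S := 1 + pa + pb.
have pa0 : 0 <= pa.
  have c1 : 0 <= 24 + 8 * L%:R ^+ 2 :> R by rewrite addr_ge0// mulr_ge0// sqr_ge0.
  by rewrite divr_ge0 ?(ltW e0)// mulr_ge0// mulr_ge0// ltW.
have pb0 : 0 <= pb by rewrite divr_ge0 ?(ltW e0)// mulr_ge0// ltW.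
(* Half of [e], because the bad event of the truncation has at most twice this probability. *)
have hPE : \forall n \near \oo, `|Pr P (empty_half_block P X (b n) (kn b n) c0)| <= e / 2.
  exact: (cvgr0Pnorm_le _).1 hE1 _ (divr_gt0 e0 (ltr0n _ 2)).
have near1 : \forall n \near \oo, (0 < b n)%N := near_b_gt0 b_large.
have near2 : \forall n \near \oo, (2 <= kn b n)%N := near_kn_ge b_large b_small 2.
have near3 : \forall n \near \oo, S <= Num.sqrt (kn b n)%:R := near_sqrt_kn_ge b_large b_small S.
have near4 : \forall n \near \oo, alpha_eps P X eps (b n) * (kn b n)%:R <= dl.
  exact: (near_kn_alpha (C := C) b_large C0 dl0 hal hk).
near=> n.
have b0 : (0 < b n)%N by near: n.
have k2 : (2 <= kn b n)%N by near: n.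
have sS : S <= Num.sqrt (kn b n)%:R by near: n.
have akdl : alpha_eps P X eps (b n) * (kn b n)%:R <= dl by near: n.
have PE1 : `|Pr P (empty_half_block P X (b n) (kn b n) c0)| <= e / 2 by near: n.
set k := kn b n in k2 sS akdl *; set s := Num.sqrt k%:R in sS *.
have k0 : (0 < k)%N by exact: leq_trans k2.
have kR : 0 < k%:R :> R by rewrite ltr0n.
have s2 : s ^+ 2 = k%:R by rewrite sqr_sqrtr// ltW.
have s1 : 1 <= s by apply: le_trans sS; rewrite /S -addrA lerDl addr_ge0.
have s0 : 0 < s by exact: lt_le_trans s1.
pose N := (n - b n).+1.
have [bn kbn N1 N2] := block_count_bounds b0 k2.
have eps10 : 0 < 1 - eps by rewrite subr_gt0.
have [Bad [mBad PBad2 HBad]] := truncation_event mX statX b0 bn eps10 epsc.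
have PBad : Pr P Bad <= e.
  apply: (le_trans PBad2).
  have : Pr P (empty_half_block P X (b n) k c0) <= e / 2.
    by apply: le_trans PE1; exact: ler_norm.
  by rewrite -/k; lra.
pose V := Ytr P X eps.
have mV t : measurable_fun setT (V t) by exact: measurable_Ytr.
pose proj := projection P X eps (b n) m cc V.
pose mu := projection_mean P X eps (b n) m cc.
pose al := s * (mu - comparison_constant P X eps (b n) m cc - centering theta pi c).
pose posd := fun i => (i * b n)%N.
pose Dd : rel nat := [rel i j | j != i].
have nearD : avg k (fun i => avg k (fun j => (near_blocks (b n) posd i j)%:R)) <= 8 / s ^+ 2 :> R.
  by rewrite s2; exact: near_disjoint_fraction.
have nearS : avg N (fun i => avg N (fun j => (near_blocks (b n) id i j)%:R)) <= 8 / s ^+ 2 :> R.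
  by rewrite s2; exact: near_sliding_fraction.
have cerr : s * (B * (2 * (8 / s ^+ 2) + comparison_error P X eps (b n) (8 / s ^+ 2)
    (L * (Num.truncn s).+1) (L%:R ^+ 2))) <= e.
  have a0 : 0 <= alpha_eps P X eps (b n) by exact: alpha_eps_ge0.
  have akdl' : alpha_eps P X eps (b n) * s ^+ 2 <= dl by rewrite s2.
  have hb := comparison_error_bound (erefl (alpha_eps P X eps (b n))) a0 L0 s1 akdl' dl1.
  rewrite mulrCA.
  apply: (@le_trans _ _ (B * (58 / L%:R + 12 * L%:R ^+ 3 * dl + (24 + 8 * L%:R ^+ 2) / s))).
    by rewrite ler_wpM2l// ltW.
  have e1 : B * (58 / L%:R) <= e / 4.
    rewrite mulrA ler_pdivrMr//; move: LB; rewrite ltr_pdivrMr//; lra.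
  have e2 : B * (12 * L%:R ^+ 3 * dl) <= e / 4 by lra.
  have e3 : B * ((24 + 8 * L%:R ^+ 2) / s) <= e / 4.
    rewrite mulrA ler_pdivrMr//.
    have : (24 + 8 * L%:R ^+ 2) * B * 4 / e <= s.
      by apply: le_trans sS; rewrite /S -/pa; lra.
    by rewrite ler_pdivrMr//; lra.
  by rewrite !mulrDr; lra.
have Lr0 : (0 < L * (Num.truncn s).+1)%N by rewrite muln_gt0.
have L2 : 0 < L%:R ^+ 2 :> R by rewrite exprn_gt0.
exists (fun w => s * (pair_estimator V (b n) m cc posd k Dd w - centering theta pi c)).
exists (fun w => s * (pair_estimator V (b n) m cc id N (sb_disj b n) w - centering theta pi c)).
exists (fun w => s * (avg k (fun i => proj (posd i) w) - mu)).
exists (fun w => s * (avg N (fun i => proj i w) - mu)).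
exists al.
have baff (f : Omega -> R) x : bounded_measurable f -> bounded_measurable (fun w => s * (f w - x)).
  by move=> bf; apply: bmZ; apply: bmB => //; exact: bm_cst.
have bproj p : bounded_measurable (proj p) by exact: bm_projection.
split.
- by split; apply: baff; [exact: bm_pair_estimator..|exact: bm_avg|exact: bm_avg].
- have same pos M D w : ~ Bad w -> (forall i, (i < M)%N -> (pos i + b n <= n)%N) ->
      pair_estimator X (b n) m cc pos M D w = pair_estimator V (b n) m cc pos M D w.
    move=> nBad hpos; congr (_ * _); apply: eq_bigr => i _; apply: eq_bigr => j _.
    by apply: eq_bigr => l _; rewrite HBad// hpos.
  split=> x; apply: le_trans PBad; apply: Pr_diff => //.
  + under eq_fun do rewrite linear_s_db.
    by apply: (baff _ _ _).1; exact: bm_pair_estimator.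
  + by apply: (baff _ _ _).1; exact: bm_pair_estimator.
  + move=> w nBad; rewrite linear_s_db same// => i ik; rewrite /posd.
    by apply: leq_trans kbn; rewrite -mulSnr leq_mul2r ik orbT.
  + under eq_fun do rewrite linear_s_sb.
    by apply: (baff _ _ _).1; exact: bm_pair_estimator.
  + by apply: (baff _ _ _).1; exact: bm_pair_estimator.
  + by move=> w nBad; rewrite linear_s_sb same// => i; rewrite ltnS leq_subRL// addnC.
- split; apply: (le_trans _ cerr).
    apply: estimator_error => //; first exact: ltW.
    by move=> i j; exact: disjoint_near.
  apply: estimator_error => //; first exact: ltW.
  by move=> i j; exact: sliding_near.
- have hv := projection_variance eps m cc mX statX b0 k0 nearD.
  under [X in Ex P X]eq_fun do rewrite exprMn.
  rewrite ExZ; last by apply: bmX; apply: bmB; [exact: bm_avg|exact: bm_cst].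
  rewrite s2; apply: (@le_trans _ _ (k%:R * (4 * B ^+ 2 * (8 / s ^+ 2 + alpha_eps P X eps (b n))))).
    by rewrite ler_wpM2l// ltW.
  rewrite s2 (_ : _ * _ = 4 * B ^+ 2 * (8 + alpha_eps P X eps (b n) * k%:R)); last by field; rewrite gt_eqF.
  rewrite (_ : 36 * B ^+ 2 = 4 * B ^+ 2 * 9); last by ring.
  apply: ler_wpM2l; first by rewrite mulr_ge0// sqr_ge0.
  by rewrite (natrD R 8 1) lerD2l (le_trans akdl).
- move=> z; have := sliding_convexity eps m cc mX statX b0 mu z (ltW s0) k2 N1 N2.
  move=> /le_trans; apply; rewrite lerD2l -s2.
  rewrite (_ : 8 * coef_bound m cc * (s / s ^+ 2) = 8 * B / s); last by rewrite /B; field; rewrite gt_eqF.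
  rewrite ler_pdivrMr//; have : 8 * B / e <= s.
    by apply: le_trans sS; rewrite /S -/pb; lra.
  by rewrite ler_pdivrMr// => h; rewrite [e * s]mulrC.
Unshelve. all: by end_near.
Qed.

End SlidingVersusDisjoint.

(** Invariance of the Loewner order under congruence carries the comparison over from the limits of
    the [s] vectors to those of the [v] vectors. *)
Lemma quadratic_form_conj {R : realType} (m : nat) (A S : 'M[R]_m) (x : 'cV[R]_m) :
  x^T *m (A *m S *m A^T) *m x = (A^T *m x)^T *m S *m (A^T *m x).
Proof. by rewrite trmx_mul trmxK !mulmxA. Qed.

Lemma quadratic_form_delta {R : realType} (m : nat) (S : 'M[R]_m) (j : 'I_m) :
  ((delta_mx j 0 : 'cV[R]_m)^T *m S *m (delta_mx j 0 : 'cV[R]_m)) 0 0 = S j j.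
Proof. by rewrite trmx_delta -rowE -colE !mxE. Qed.
Theorem theorem4p4 (R : realType) (d : measure_display) (Omega : measurableType d)
  (P : probability Omega R) (X : int -> Omega -> R) (theta : R)
  (pi : nat -> R) (pi2 : R -> nat -> nat -> R) (b : nat -> nat) :
  (forall t : int, measurable_fun setT (X t)) ->
  strictly_stationary P X ->
  continuous (Fcdf P X) ->
  cluster_family pi pi2 ->
  ((b n)%:R : R) @[n --> \oo] --> +oo%R ->
  ((b n)%:R / n%:R : R) @[n --> \oo] --> (0:R) ->
  conditionC P X theta pi pi2 b ->
  (exists eps2 : R, 0 < eps2 /\
     Num.sqrt (kn b n)%:R * beta_eps P X eps2 (b n) @[n --> \oo] --> (0:R)) ->
  forall (m : nat) (Sdb Ssb A : 'M[R]_m),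
    (1 <= m)%N ->
    cov_matrix Sdb -> cov_matrix Ssb ->
    cvg_law_mnormal P (s_db X b theta pi m) Sdb ->
    cvg_law_mnormal P (s_sb X b theta pi m) Ssb ->
    is_Am theta pi A ->
    [/\ loewner_le Ssb Sdb,
        loewner_le (A *m Ssb *m A^T) (A *m Sdb *m A^T)
      & forall j : 'I_m,
          Ssb j j <= Sdb j j /\ (A *m Ssb *m A^T) j j <= (A *m Sdb *m A^T) j j].

Proof.
move=> mX statX _ _ b_large b_small condC _ m Sdb Ssb A _ covD _ cvd cvs _.
have form_le c := quadratic_form_le mX statX b_large b_small condC c covD cvd cvs.
have conj_le (c : 'cV[R]_m) :
    (c^T *m (A *m Ssb *m A^T) *m c) 0 0 <= (c^T *m (A *m Sdb *m A^T) *m c) 0 0.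
  by rewrite !quadratic_form_conj.
split.
- by move=> x; rewrite mulmxBr mulmxBl mxE [X in _ + X]mxE subr_ge0.
- by move=> x; rewrite mulmxBr mulmxBl mxE [X in _ + X]mxE subr_ge0.
- by move=> j; rewrite -!(quadratic_form_delta _ j).
Qed.
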